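(* Let $a\ge 0$ and $M=\mathbb{H}^2(-a^2)$, and let $\widetilde{\mathbf V}=\{u\in H^1(\Lambda^1): d^\ast u=0\}$. Then $$\widetilde{\mathbf V}=\overline{\Lambda^1_{c,\sigma}}^{H^1}\oplus\mathcal{H}^1=\overline{d^\ast\Lambda^2_c}^{H^1}\oplus\mathcal{H}^1 .$$
   Context: $M=\mathbb{H}^2(-a^2)$ denotes the $2$-dimensional complete simply connected Riemannian manifold without boundary of constant sectional curvature $-a^2$ (so $M=\mathbb{R}^2$ if $a=0$), with metric $g$ and Levi-Civita connection $\nabla$. $\Lambda^k_c$ is the space of smooth compactly supported $k$-forms on $M$. $d^\ast$ is the usual codifferential (formal adjoint of the exterior derivative $d$ for the standard $L^2$ inner product on forms); in dimension 2, $d^\ast=-\star d\star$. For $u\in H^1$, $d^\ast u$ is taken in the weak sense. $\Lambda^1_{c,\sigma}=\{v\in\Lambda^1_c: d^\ast v=0\}$. For covariant tensors of the same rank, $g(\cdot,\cdot)$ is the full contraction and $(u,v)=\int_M g(u,v)\,\mathrm{Vol}_M$. On $1$-forms, $[u,v]=(u,v)+(\nabla u,\nabla v)$, $\|u\|_{H^1}=\sqrt{[u,u]}$; $H^1(\Lambda^1)$ is the closure (completion) of $\Lambda^1_c$ in this norm, and $\overline{A}^{H^1}$ denotes closure of $A$ in $H^1(\Lambda^1)$. $\mathcal{H}^1$ (not to be confused with the Sobolev space $H^1$) is the space of $1$-forms $\gamma\in L^2$ that are harmonic: $(dd^\ast+d^\ast d)\gamma=0$. *)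

(* Defs.v *)
From HB Require Import structures.
From mathcomp Require Import all_boot all_order all_algebra.
From mathcomp Require Import all_classical all_reals all_analysis.

Set Implicit Arguments.
Unset Strict Implicit.
Unset Printing Implicit Defensive.

Import Order.TTheory GRing.Theory Num.Theory.
Import numFieldNormedType.Exports.

Local Open Scope classical_set_scope.
Local Open Scope ring_scope.

(* H^2(-a^2) is the disc a^2 |x|^2 < 4 (the whole plane when a = 0) with the
   metric (1 - a^2 |x|^2 / 4)^-2 (dx_1^2 + dx_2^2).  Tensor fields are given by
   their components in this global chart, as functions on all of R^2 whose
   values outside the disc are irrelevant: every condition below is restricted
   to the disc, which is open.  Indices 1, 2 are the elements 0, 1 of 'I_2. *)

Section HyperbolicPlane.
Context {R : realType}.
Variable a : R.

Local Notation leb2 := (@lebesgue_measure R \x @lebesgue_measure R)%E.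

Definition sqnorm (x : R * R) : R := x.1 ^+ 2 + x.2 ^+ 2.

Definition disc : set (R * R) := [set x | a ^+ 2 * sqnorm x < 4].

Definition metric (x : R * R) : 'M[R]_2 :=
  (((1 - a ^+ 2 * sqnorm x / 4)^-1) ^+ 2)%:M.

Definition cometric (x : R * R) : 'M[R]_2 := invmx (metric x).

Definition vol (x : R * R) : R := Num.sqrt (\det (metric x)).

Definition basis (i : 'I_2) : R * R := if i == 0 then (1, 0) else (0, 1).

Definition pd (i : 'I_2) (f : R * R -> R) : R * R -> R :=
  fun x => 'D_(basis i) f x.

Definition form0 := R * R -> R.
Definition form1 := 'I_2 -> R * R -> R.
(* The 2-form phi dx_1 /\ dx_2 is represented by phi. *)
Definition form2 := R * R -> R.
Definition tensor2 := 'I_2 -> 'I_2 -> R * R -> R.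

Definition add1 (u v : form1) : form1 := fun i x => u i x + v i x.
Definition sub1 (u v : form1) : form1 := fun i x => u i x - v i x.

Fixpoint Ck (n : nat) (f : R * R -> R) : Prop :=
  (forall x, disc x -> {for x, continuous f}) /\
  (if n is m.+1 then
     forall i : 'I_2, (forall x, disc x -> derivable f x (basis i)) /\
                      Ck m (pd i f)
   else True).

Definition smooth (f : R * R -> R) : Prop := forall n, Ck n f.

Definition compactly_supported (f : R * R -> R) : Prop :=
  exists K : set (R * R),
    [/\ compact K, K `<=` disc & forall x, disc x -> ~ K x -> f x = 0].

Definition Lambda0c : set form0 :=
  [set f | smooth f /\ compactly_supported f].
Definition Lambda1c : set form1 :=
  [set u | forall i, smooth (u i) /\ compactly_supported (u i)].
Definition Lambda2c : set form2 :=
  [set w | smooth w /\ compactly_supported w].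

(* Levi-Civita connection: christoffel k i j is Gamma^k_{ij} and
   nabla u i j is (nabla_i u)_j. *)
Definition christoffel (k i j : 'I_2) (x : R * R) : R :=
  2^-1 * \sum_(l < 2) cometric x k l *
    (pd i (fun y => metric y j l) x + pd j (fun y => metric y i l) x
     - pd l (fun y => metric y i j) x).

Definition nabla (u : form1) : tensor2 := fun i j x =>
  pd i (u j) x - \sum_(k < 2) christoffel k i j x * u k x.

Definition d0 (f : form0) : form1 := fun i => pd i f.
Definition d1 (u : form1) : form2 := fun x => pd 0 (u 1) x - pd 1 (u 0) x.

Definition star1 (u : form1) : form1 := fun j x =>
  if j == 0 then - (vol x * \sum_(k < 2) cometric x 1 k * u k x)
  else vol x * \sum_(k < 2) cometric x 0 k * u k x.
Definition star2 (w : form2) : form0 := fun x => w x / vol x.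

Definition codiff1 (u : form1) : form0 := fun x => - star2 (d1 (star1 u)) x.
Definition codiff2 (w : form2) : form1 := fun i x =>
  - star1 (d0 (star2 w)) i x.

Definition hodge_laplacian1 (u : form1) : form1 :=
  add1 (d0 (codiff1 u)) (codiff2 (d1 u)).

Definition contract1 (u v : form1) (x : R * R) : R :=
  \sum_(i < 2) \sum_(j < 2) cometric x i j * u i x * v j x.
Definition contract2 (S T : tensor2) (x : R * R) : R :=
  \sum_(i < 2) \sum_(j < 2) \sum_(k < 2) \sum_(l < 2)
    cometric x i k * cometric x j l * S i j x * T k l x.

Definition integral0 (f : R * R -> R) : R :=
  \int[leb2]_(x in disc) (f x * vol x).

Definition inner1 (u v : form1) : R := integral0 (contract1 u v).
Definition inner2 (S T : tensor2) : R := integral0 (contract2 S T).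

Definition L2norm (u : form1) : R := Num.sqrt (inner1 u u).
Definition inner_H1 (u v : form1) : R :=
  inner1 u v + inner2 (nabla u) (nabla v).
Definition H1norm (u : form1) : R := Num.sqrt (inner_H1 u u).

(* Elements of L^2 and H^1 are not quotiented: the sets of 1-forms below
   consist of all representatives, and are invariant under equality almost
   everywhere on the disc. *)
Definition ae_eq1 (u v : form1) : Prop :=
  forall i, {ae leb2, forall x, disc x -> u i x = v i x}.

Definition L2 : set form1 :=
  [set u | (forall i, measurable_fun disc (u i)) /\
     leb2.-integrable disc (fun x => (contract1 u u x * vol x)%:E)].

(* The completion of Lambda1c for H1norm is realised inside L^2: an element
   is the L^2 limit of an H1norm-Cauchy sequence (nabla is closable, so this
   limit determines the class of the sequence).  The closure in H^1 of
   A `<=` Lambda1c is obtained from the Cauchy sequences in A. *)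
Definition H1_closure (A : set form1) : set form1 :=
  [set u | L2 u /\ exists s : nat -> form1,
     [/\ forall n, A (s n),
         forall e : R, 0 < e -> exists N : nat, forall m n : nat,
           (N <= m)%N -> (N <= n)%N -> H1norm (sub1 (s m) (s n)) < e &
         L2norm (sub1 (s n) u) @[n --> \oo] --> (0 : R)]].

Definition H1 : set form1 := H1_closure Lambda1c.

Definition weak_codiff1 (u : form1) (h : form0) : Prop :=
  forall f, Lambda0c f -> inner1 u (d0 f) = integral0 (fun x => h x * f x).

Definition Vtilde : set form1 :=
  [set u | H1 u /\ weak_codiff1 u (fun=> 0)].

Definition Lambda1csigma : set form1 :=
  [set v | Lambda1c v /\ forall x, disc x -> codiff1 v x = 0].

Definition codiff_Lambda2c : set form1 := [set codiff2 w | w in Lambda2c].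

Definition L2_harmonic1 : set form1 :=
  [set u | L2 u /\ exists gamma : form1,
     [/\ forall i, smooth (gamma i),
         forall i x, disc x -> hodge_laplacian1 gamma i x = 0 &
         ae_eq1 u gamma]].

Definition is_direct_sum (V A B : set form1) : Prop :=
  V = [set add1 u v | u in A & v in B] /\
  (forall u, A u -> B u -> ae_eq1 u (fun _ _ => 0)).

End HyperbolicPlane.

(* Main.v *)
(* In the conformal chart the problem becomes one on the disc.  The L^2 product
   of 1-forms is the Euclidean one, [codiff2] produces the fields
   (d_2 f, - d_1 f), and by Bochner's formula the H^1 norm of a compactly
   supported form is that of (1 + a^2) |u|^2 + kap^2 (curl^2 + div^2), where
   kap = 1 - a^2 |x|^2 / 4.

   Let u in V be the limit of s_n, and let p_n be an almost H^1-orthogonal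
   projection of s_n onto the coexact test forms.  Then s_n - p_n is Cauchy and
   its L^2 limit g is weakly divergence free.  By orthogonality the limit Q of
   the rescaled curls is such that q = kap Q solves (1 + a^2) q / kap^2 = lap q
   weakly; testing a mollification of this equation against chi_n^2 q gives
   Q = 0, for cutoffs chi_n with kap |grad chi_n| <= C / n, which exist since
   the metric is complete.  Hence g is also weakly curl free, so it is smooth by
   Weyl's lemma and harmonic, and u - g is the limit of the p_n.

   Conversely, if g is an L^2 harmonic form, then div g and curl g satisfy
   Cauchy-Riemann equations, and an integration by parts shows that
   kap^2 (div^2 + curl^2) (chi_n g) and kap^2 |grad chi_n|^2 |g|^2 have the same
   integral, which tends to 0.  Thus g belongs to V and is L^2-orthogonal to the
   coexact test forms, so that the sum is direct.  Both closures agree because a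
   compactly supported divergence free field has a compactly supported stream
   function. *)
From HB Require Import structures.
From mathcomp Require Import all_boot all_order all_algebra.
From mathcomp Require Import all_classical all_reals all_analysis.
From mathcomp Require Import measurable_realfun ring lra.
Require Import Defs.
Set Implicit Arguments.
Unset Strict Implicit.
Unset Printing Implicit Defensive.
Import Order.TTheory GRing.Theory Num.Theory.
Import numFieldNormedType.Exports.
Local Open Scope classical_set_scope.
Local Open Scope ring_scope.

(** The first obstacle is that forms are bare functions on the plane and inner products are real
    integrals, bilinear only on square integrable functions. Every object is therefore reached
    through sequences of test forms: the projection is a minimiser up to an error 1 / (n + 1), and
    completeness enters through Riesz-Fischer, applied to the components of s_n - p_n and to their
    rescaled curls. Mollifications converge in L^2 for limits of test functions ([approximable]), a
    property that g and Q inherit from their approximating sequences. The second obstacle is that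
    [kap] vanishes at the boundary of the disc when a > 0. A mollified equation holds on a ball
    inside the disc, for radii that are small in terms of this ball. Hence the radius tends to 0 for
    a fixed cutoff, and n tends to infinity afterwards. In dimension 2 the powers of [kap] cancel in
    the L^2 pairing of 1-forms, so that Weyl's lemma can be the Euclidean one. The constant 1 + a^2
    is the sum of the L^2 term of the H^1 norm and of the Ricci term of Bochner's formula. *)

Lemma quadratic_discr (R : realFieldType) (p q r : R) : 0 <= r ->
  (forall t, 0 <= p + 2 * q * t + r * t ^+ 2) -> q ^+ 2 <= p * r.
Proof.
rewrite le_eqVlt => /predU1P[<-|r0] H.
  have [->|q0] := eqVneq q 0; first by rewrite expr0n mulr0.
  (* For r = 0 the polynomial is affine, and a nonzero slope would make it reach -1; for r > 0 it is
     evaluated at its vertex below. *)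
  have := H (- (p + 1) / (2 * q)).
  have -> : p + 2 * q * (- (p + 1) / (2 * q)) +
     0 * (- (p + 1) / (2 * q)) ^+ 2 = -1 by field.
  by rewrite oppr_ge0 ler10.
have := H (- q / r).
have -> : p + 2 * q * (- q / r) + r * (- q / r) ^+ 2 = (p * r - q ^+ 2) / r.
  by field; rewrite gt_eqF.
by rewrite pmulr_lge0 ?invr_gt0// subr_ge0.
Qed.

(** * Almost projections and square integrable functions *)

Section SemiInnerProduct.
Context {R : realType} (V : lmodType R) (S : V -> Prop) (B : V -> V -> R).
Hypothesis S0 : S 0.
Hypothesis SDZ : forall k u v, S u -> S v -> S (k *: u + v).
Hypothesis BC : forall u v, S u -> S v -> B u v = B v u.
Hypothesis BDZ : forall k u v w, S u -> S v -> S w ->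
  B (k *: u + v) w = k * B u w + B v w.
Hypothesis B_ge0 : forall u, S u -> 0 <= B u u.

Definition snorm u := Num.sqrt (B u u).

Lemma semi_D u v : S u -> S v -> S (u + v).
Proof. by move=> Su Sv; have := SDZ 1 Su Sv; rewrite scale1r. Qed.

Lemma semi_Z k u : S u -> S (k *: u).
Proof. by move=> Su; have := SDZ k Su S0; rewrite addr0. Qed.

Lemma semi_B u v : S u -> S v -> S (u - v).
Proof. by move=> Su Sv; have := SDZ (-1) Sv Su; rewrite scaleN1r addrC. Qed.

Lemma sformBl u v w : S u -> S v -> S w -> B (u - v) w = B u w - B v w.
Proof. by move=> ? ? ?; rewrite addrC -scaleN1r BDZ// mulN1r addrC. Qed.

Lemma sformBr u v w : S u -> S v -> S w -> B w (u - v) = B w u - B w v.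
Proof.
by move=> ? ? ?; rewrite BC ?sformBl// ?(BC (u := w))//; exact: semi_B.
Qed.

Lemma sform_line u v t : S u -> S v ->
  B (t *: v + u) (t *: v + u) = B u u + 2 * B u v * t + B v v * t ^+ 2.
Proof.
move=> Su Sv; have Sw := SDZ t Sv Su.
rewrite BDZ// [B v _]BC// [B u (_ + _)]BC// !BDZ// (BC Sv Su).
by ring.
Qed.

Lemma snorm_sqr u : S u -> snorm u ^+ 2 = B u u.
Proof. by move=> Su; rewrite sqr_sqrtr// B_ge0. Qed.

Lemma snorm_ge0 u : 0 <= snorm u.
Proof. exact: sqrtr_ge0. Qed.

Lemma semi_cauchy_schwarz u v : S u -> S v -> `|B u v| <= snorm u * snorm v.
Proof.
move=> Su Sv; rewrite /snorm -(@sqrtrM R _ _ (B_ge0 Su)) -sqrtr_sqr ler_sqrt ?mulr_ge0 ?B_ge0//.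
apply: quadratic_discr; first exact: B_ge0.
by move=> t; rewrite -sform_line// B_ge0//; exact: SDZ.
Qed.

Lemma snormD u v : S u -> S v -> snorm (u + v) <= snorm u + snorm v.
Proof.
move=> Su Sv; rewrite -(@ler_pXn2r _ 2%N) ?nnegrE ?addr_ge0 ?snorm_ge0//.
rewrite snorm_sqr; last exact: semi_D.
have -> : u + v = 1 *: v + u by rewrite scale1r addrC.
rewrite sform_line// sqrrD !snorm_sqr// expr1n !mulr1 mulr_natl.
by rewrite lerD2r lerD2l lerMn2r/= (le_trans (ler_norm _))// semi_cauchy_schwarz.
Qed.

Lemma snormN u : S u -> snorm (- u) = snorm u.
Proof.
move=> Su; have := @sform_line 0 u (-1) S0 Su.
rewrite scaleN1r addr0 /snorm => ->.
have B0 w : S w -> B 0 w = 0.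
  by move=> Sw; have := BDZ (-1) S0 S0 Sw; rewrite scaler0 addr0 mulN1r addNr.
by rewrite !B0//; congr Num.sqrt; ring.
Qed.

Lemma snormB u v : S u -> S v -> snorm (u - v) <= snorm u + snorm v.
Proof.
move=> Su Sv; rewrite -(snormN Sv) snormD// -scaleN1r; exact: semi_Z.
Qed.

Variable A : V -> Prop.
Hypothesis A0 : A 0.
Hypothesis AS : forall u, A u -> S u.
Hypothesis ADZ : forall k u v, A u -> A v -> A (k *: u + v).

(* A near minimiser of the distance to [A] is almost orthogonal to [A]: neither
   completeness nor the existence of a projection is needed. *)
Lemma almost_projection u e : S u -> 0 < e ->
  exists2 p, A p & forall w, A w -> `|B (u - p) w| <= e * snorm w.
Proof.
move=> Su e0.
pose E := [set B (u - p) (u - p) | p in A].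
have E0 : has_inf E.
  split; first by exists (B (u - 0) (u - 0)), 0.
  by exists 0 => _ [p Ap <-]; apply/B_ge0/semi_B => //; exact: AS.
have [_ [p Ap <-] pE] : exists2 x, E x & x < inf E + e ^+ 2.
  by apply: inf_adherent => //; exact: exprn_gt0.
exists p => // w Aw.
have Sup : S (u - p) by apply: semi_B => //; exact: AS.
have -> : e * snorm w = Num.sqrt (e ^+ 2 * B w w).
  by rewrite sqrtrM ?sqr_ge0// sqrtr_sqr ger0_norm ?ltW.
rewrite -sqrtr_sqr ler_sqrt; last by rewrite mulr_ge0 ?sqr_ge0// B_ge0//; exact: AS.
apply: quadratic_discr; first exact/B_ge0/AS.
move=> t.
have : inf E <= B (t *: w + (u - p)) (t *: w + (u - p)).
  apply: inf_lbound; first by case: E0.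
  exists ((- t) *: w + p); first exact: ADZ.
  by rewrite scaleNr opprD opprK [X in B X _ = _]addrCA [X in B _ X = _]addrCA.
rewrite sform_line//; last exact: AS.
lra.
Qed.

Definition scauchy (s : nat -> V) := forall e : R, 0 < e ->
  exists N : nat, forall m n : nat, (N <= m)%N -> (N <= n)%N ->
    snorm (s m - s n) < e.

Lemma scauchyB s t : (forall n, S (s n)) -> (forall n, S (t n)) ->
  scauchy s -> scauchy t -> scauchy (fun n => s n - t n).
Proof.
move=> Ss St cs ct e e0; have e20 : 0 < e / 2 by rewrite divr_gt0.
have [N1 H1] := cs _ e20; have [N2 H2] := ct _ e20.
exists (maxn N1 N2) => m n; rewrite !geq_max => /andP[m1 m2] /andP[n1 n2].
rewrite (_ : _ - _ = (s m - s n) - (t m - t n)); last first.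
  by rewrite !opprD !opprK addrACA.
rewrite [ltRHS]splitr.
apply: le_lt_trans (snormB (semi_B (Ss m) (Ss n)) (semi_B (St m) (St n))) _.
by apply: ltrD; [exact: H1|exact: H2].
Qed.

(** Let x, y, z be the differences of two terms of s - p, s and p, so that x = y - z. Then |x|^2 =
    <x, y> - <x, z>: the first product is at most |x| |y|, the second is small by almost
    orthogonality, z being in [A] with |z| <= |x| + |y|. *)
Lemma almost_projection_cauchy (s p : nat -> V) (d : nat -> R) :
  (forall n, S (s n)) -> (forall n, A (p n)) ->
  (forall n w, A w -> `|B (s n - p n) w| <= d n * snorm w) ->
  (forall n, 0 <= d n) -> d @ \oo --> 0 -> scauchy s ->
  scauchy (fun n => s n - p n).
Proof.
move=> Ss Ap Hp d_ge0 d0 cs e e0.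
(* With errors below e / 8, the final estimate is |x|^2 <= |x| e / 8 + (e / 4) (|x| + e / 8); if |x|
   were at least e, the right side would be at most (13 / 32) |x|^2. *)
have e40 : 0 < e / 8 by rewrite divr_gt0.
have [N1 H1] := cs _ e40.
have [N2 _ H2] : \forall n \near \oo, d n < e / 8.
  have /cvgrPdist_lt/(_ _ e40) := d0; apply: filterS => n.
  by rewrite sub0r normrN ger0_norm.
exists (maxn N1 N2) => m n; rewrite !geq_max => /andP[m1 m2] /andP[n1 n2].
have Sp k : S (p k) by exact: AS.
have Ssp k : S (s k - p k) by exact: semi_B.
set x := s m - p m - (s n - p n); set y := s m - s n; set z := p m - p n.
have Sy : S y by exact: semi_B.
have Az : A z by rewrite /z addrC -scaleN1r; exact: ADZ.
have Sz : S z by exact: AS.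
have Sx : S x by exact: semi_B.
have xE : x = y - z.
  by rewrite /x /y /z !opprD !opprK addrACA.
have Y : snorm y < e / 8 by exact: H1.
have Z : snorm z <= snorm x + snorm y.
  have -> : z = y - x by rewrite xE opprB addrCA subrr addr0.
  by rewrite [leRHS]addrC snormB.
have D : `|B x z| <= (d m + d n) * snorm z.
  rewrite /x sformBl// mulrDl (le_trans (ler_normB _ _))// lerD//; exact: Hp.
have X : snorm x ^+ 2 <= snorm x * (e / 8) + (e / 4) * (snorm x + e / 8).
  rewrite snorm_sqr// [X in B _ X]xE sformBr//.
  have := semi_cauchy_schwarz Sx Sy; have /ltW := H2 _ m2; have /ltW := H2 _ n2.
  move: D; rewrite !ler_norml => /andP[D1 D2] dn dm /andP[C1 C2].
  have L1 : snorm x * snorm y <= snorm x * (e / 8).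
    by rewrite ler_wpM2l ?snorm_ge0// ltW.
  have L2 : (d m + d n) * snorm z <= (e / 4) * (snorm x + e / 8).
    apply: ler_pM; rewrite ?addr_ge0 ?snorm_ge0//; lra.
  lra.
rewrite ltNge; apply/negP => ex.
have := snorm_ge0 x; nra.
Qed.

End SemiInnerProduct.

(** * Square integrable functions and their inner product *)

Section SquareIntegrable.
Context d (T : measurableType d) (R : realType).
Variable mu : {measure set T -> \bar R}.
Implicit Types f g h : T -> R.

Definition sqint f := measurable_fun setT f /\
  mu.-integrable setT (fun x => (f x ^+ 2)%:E).

(** A real integral reads an infinite value as 0, so bilinearity is only available on [sqint]; this
    is why the abstract semi-inner products carry a predicate [S]. *)
Definition ip f g : R := \int[mu]_x (f x * g x).

Lemma integrable_scale k f : mu.-integrable setT (EFin \o f) ->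
  mu.-integrable setT (EFin \o (fun x => k * f x)).
Proof.
move=> If; rewrite (_ : _ \o _ = (fun x => k%:E * (EFin \o f) x)%E)//.
exact: integrableZl.
Qed.

Lemma integrable_add f g : mu.-integrable setT (EFin \o f) ->
  mu.-integrable setT (EFin \o g) ->
  mu.-integrable setT (EFin \o (fun x => f x + g x)).
Proof.
move=> If Ig; rewrite (_ : _ \o _ = ((EFin \o f) \+ (EFin \o g))%E)//.
exact: integrableD.
Qed.

Lemma sqint_mul f g : sqint f -> sqint g ->
  mu.-integrable setT (EFin \o (fun x => f x * g x)).
Proof.
move=> [mf if2] [mg ig2].
apply: (le_integrable measurableT _ _ (integrableD measurableT if2 ig2)).
  by apply/measurable_EFinP/measurable_funM.
move=> x _ /=; rewrite lee_fin normrM.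
rewrite [leRHS]ger0_norm ?addr_ge0 ?sqr_ge0//.
rewrite -[f x ^+ 2]real_normK ?num_real// -[g x ^+ 2]real_normK ?num_real//.
have := sqr_ge0 (`|f x| - `|g x|); have := normr_ge0 (f x).
have := normr_ge0 (g x); nra.
Qed.

Lemma sqint_dominated f g : measurable_fun setT f -> sqint g ->
  (forall x, f x ^+ 2 <= g x ^+ 2) -> sqint f.
Proof.
move=> mf [mg ig] fg; split=> //.
apply: (le_integrable measurableT _ _ ig).
  by apply/measurable_EFinP; exact: measurable_funX.
by move=> x _ /=; rewrite lee_fin !ger0_norm ?sqr_ge0// fg.
Qed.

Lemma sqintDZ k f g : sqint f -> sqint g -> sqint (k *: f + g).
Proof.
move=> If Ig; have [mf if2] := If; have [mg ig2] := Ig; split.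
  by apply: measurable_funD => //; exact: measurable_funM.
rewrite (_ : (fun x => _) = EFin \o (fun x => k ^+ 2 * f x ^+ 2 +
    (2 * k) * (f x * g x) + g x ^+ 2)); last first.
  apply/funext => x; congr EFin; rewrite !fctE/= -[k *: f x]/(k * f x); ring.
apply: integrable_add => //; apply: integrable_add.
  exact: integrable_scale if2.
exact/integrable_scale/sqint_mul.
Qed.

Lemma sqint0 : sqint 0.
Proof.
split; first exact: measurable_cst.
by under eq_fun do rewrite expr0n; exact: integrable0.
Qed.

Lemma ipC f g : ip f g = ip g f.
Proof. by apply: eq_Rintegral => x _; rewrite mulrC. Qed.

Lemma ipDZ k f g h : sqint f -> sqint g -> sqint h ->
  ip (k *: f + g) h = k * ip f h + ip g h.
Proof.
move=> If Ig Ih; rewrite /ip -RintegralZl//; last exact: sqint_mul.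
rewrite -RintegralD//.
- by apply: eq_Rintegral => x _; rewrite !fctE mulrDl -scalerAl.
- exact/integrable_scale/sqint_mul.
- exact: sqint_mul.
Qed.

Lemma ip_ge0 f : 0 <= ip f f.
Proof. by apply: Rintegral_ge0 => x _; rewrite -expr2 sqr_ge0. Qed.

End SquareIntegrable.

(** * Completeness of L^2 *)

Section RieszFischer.
Context d (T : measurableType d) (R : realType).
Variable mu : {measure set T -> \bar R}.
Implicit Types f g h : T -> R.

Lemma ip_EFin f : sqint mu f ->
  (ip mu f f)%:E = (\int[mu]_x (f x ^+ 2)%:E)%E.
Proof.
move=> If; have [mf if2] := If.
rewrite /ip /Rintegral fineK; first by apply: eq_integral => x _; rewrite -expr2.
exact: (integrable_fin_num measurableT (sqint_mul If If)).
Qed.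

(** Fatou's lemma for the squares, in extended reals so that it also proves the square integrability
    of a limit. *)
Lemma fatou_sqr (h_ : nat -> T -> R) h (e : R) :
  (forall k, measurable_fun setT (h_ k)) ->
  (forall x, h_ ^~ x @ \oo --> h x) ->
  (\forall k \near \oo, (\int[mu]_x (h_ k x ^+ 2)%:E <= e%:E)%E) ->
  (\int[mu]_x (h x ^+ 2)%:E <= e%:E)%E.
Proof.
move=> mh hh [N _ He].
pose g k x := (h_ (k + N)%N x ^+ 2)%:E.
have mg k : measurable_fun setT (g k).
  by apply/measurable_EFinP; exact: measurable_funX.
have g0 k x : setT x -> (0 <= g k x)%E by move=> _; rewrite lee_fin sqr_ge0.
have gh x : g ^~ x @ \oo --> (h x ^+ 2)%:E.
  apply: cvg_EFin; first exact: nearW.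
  rewrite [X in X @ _ --> _](_ : _ = (fun k => h_ (k + N)%N x ^+ 2))//.
  rewrite (cvg_shiftn N (fun k => h_ k x ^+ 2)).
  by rewrite expr2; under eq_fun do rewrite expr2; exact: cvgM.
have := fatou mu measurableT mg g0.
under eq_integral => x _ do rewrite (cvg_limn_einf_sup (gh x)).1.
move/le_trans; apply.
rewrite limn_einf_lim; apply: lime_le; first exact: is_cvg_einfs.
apply: nearW => n; rewrite /einfs.
apply: ereal_inf_le; exists (\int[mu]_x g n x)%E; first by exists n => /=.
by apply: He => /=; rewrite leq_addl.
Qed.

Lemma cvg_summable (u : nat -> R) (C : R) :
  (forall k, `|u k.+1 - u k| <= C * 2^-1 ^+ k) -> cvgn u.
Proof.
move=> uC.
rewrite (_ : u = (fun n => u 0%N + series (telescope u) n)); last first.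
  by apply/funext => n; rewrite -eq_sum_telescope.
apply: is_cvgD; first exact: is_cvg_cst.
apply: normed_cvg; apply: (@series_le_cvg _ _ (geometric C 2^-1)).
- by move=> n; exact: normr_ge0.
- by move=> n /=; apply: le_trans (uC n).
- by move=> n; exact: uC.
- by apply: is_cvg_geometric_series; rewrite ger0_norm//; lra.
Qed.

(** Along a subsequence with squared distances below 8^-k, the sum [H] of 4^k times the squared
    increments has integral at most the sum of 2^-k, hence is finite almost everywhere. Where it is
    finite, the increments are at most sqrt(H) 2^-k, so the subsequence converges pointwise; Fatou's
    lemma turns this into convergence in L^2 of the whole sequence. *)
Theorem riesz_fischer (f_ : nat -> T -> R) : (forall n, sqint mu (f_ n)) ->
  (forall e : R, 0 < e -> exists N : nat, forall m n, (N <= m)%N -> (N <= n)%N ->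
     ip mu (f_ m - f_ n) (f_ m - f_ n) < e) ->
  exists2 f, sqint mu f &
    (fun n => ip mu (f_ n - f) (f_ n - f)) @ \oo --> (0 : R).
Proof.
move=> If Cf.
have IB m n : sqint mu (f_ m - f_ n).
  by rewrite -scaleN1r addrC; exact: sqintDZ.
have /choice[N HN] : forall k, exists N : nat, forall m n,
    (N <= m)%N -> (N <= n)%N ->
    ip mu (f_ m - f_ n) (f_ m - f_ n) < 8^-1 ^+ k.
  by move=> k; apply: Cf; rewrite exprn_gt0// invr_gt0.
(* Summing the thresholds makes [nu] nondecreasing while keeping it above both [N k] and [k]. *)
pose nu k := (\sum_(j < k.+1) (N j).+1)%N.
have nuN k : (N k <= nu k)%N.
  by rewrite /nu big_ord_recr (leq_trans (leqnSn _))// leq_addl.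
have nuS k : (nu k <= nu k.+1)%N by rewrite /nu [leqRHS]big_ord_recr leq_addr.
have nuk k : (k <= nu k)%N.
  elim: k => // k IH; rewrite /nu big_ord_recr/= -/(nu k).
  by rewrite -addn1 leq_add.
pose g k x := (4 ^+ k * (f_ (nu k.+1) x - f_ (nu k) x) ^+ 2)%:E : \bar R.
have mg k : measurable_fun setT (g k).
  apply/measurable_EFinP/measurable_funM => //; apply: measurable_funX.
  by apply: measurable_funB; exact: (If _).1.
have g0 k x : (0 <= g k x)%E by rewrite lee_fin mulr_ge0 ?sqr_ge0// exprn_ge0.
have ig k : (\int[mu]_x g k x <= (2^-1 ^+ k)%:E)%E.
  rewrite /g; under eq_integral do rewrite EFinM.
  rewrite integralZl//; last exact: (IB (nu k.+1) (nu k)).2.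
  rewrite -[X in (_ * X)%E](ip_EFin (IB (nu k.+1) (nu k))) -EFinM lee_fin.
  have -> : 2^-1 ^+ k = 4 ^+ k * 8^-1 ^+ k :> R by rewrite -exprMn; congr (_ ^+ _); lra.
  rewrite ler_wpM2l ?exprn_ge0// ltW// HN//.
  by rewrite (leq_trans (nuN _)).
pose H x := (\sum_(k <oo) g k x)%E.
have mH : measurable_fun setT H.
  rewrite (_ : H = fun x => (\sum_(k <oo | k \in xpredT) g k x)%E); last first.
    by apply/funext => x; apply: eq_eseriesl => k.
  by apply: ge0_emeasurable_sum => // k _; exact: mg.
have H0 x : (0 <= H x)%E by apply: nneseries_ge0 => *.
have iH : mu.-integrable setT H.
  apply/integrableP; split => //.
  under eq_integral do rewrite gee0_abs//.
  rewrite integral_nneseries//.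
  apply: (@le_lt_trans _ _ (\sum_(i <oo) (2 / (2 ^ i.+1)%:R)%:E)%E).
    apply: lee_nneseries => [k _ _|k _]; first exact: integral_ge0.
    apply: le_trans (ig k) _; rewrite lee_fin exprVn natrX exprS.
    by rewrite invfM mulrA divff// mul1r.
  by apply: le_lt_trans (epsilon_trick0 _ _) _ => //; rewrite ltry.
pose E := [set x | H x \is a fin_num].
have mE : measurable E.
  by have := emeasurable_fin_num measurableT mH; rewrite setTI.
have aeE : {ae mu, forall x, E x}.
  by have := integrable_ae measurableT iH; apply: filterS => x; exact.
(* Setting the subsequence to 0 off [E] makes it converge everywhere, so that its limit is
   measurable. *)
pose h k x := f_ (nu k) x * \1_E x.
have mh k : measurable_fun setT (h k).
  by apply: measurable_funM; [exact: (If _).1|exact: measurable_indic].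
have hcvg x : cvgn (h ^~ x).
  rewrite /h indicE; have [/set_mem Ex|_] := boolP (x \in E); last first.
    by under eq_fun do rewrite mulr0; exact: is_cvg_cst.
  under eq_fun do rewrite mulr1.
  pose C := Num.sqrt (fine (H x)).
  apply: (@cvg_summable _ C) => k.
  have gH : (g k x <= H x)%E.
    have := @nneseries_lim_ge R (g ^~ x) xpredT 0 k.+1 (fun n _ _ => g0 n x).
    apply: le_trans; rewrite big_mkord big_ord_recr/= leeDr//.
    by apply: sume_ge0 => *.
  have : 4 ^+ k * (f_ (nu k.+1) x - f_ (nu k) x) ^+ 2 <= fine (H x).
    by rewrite -lee_fin fineK.
  rewrite -ler_pdivlMl ?exprn_gt0// => L.
  rewrite -sqrtr_sqr.
  have -> : C * 2^-1 ^+ k = Num.sqrt ((4 ^+ k)^-1 * fine (H x)).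
    rewrite mulrC /C sqrtrM ?invr_ge0 ?exprn_ge0//; congr (_ * _).
    have -> : (4 ^+ k)^-1 = (2^-1 ^+ k) ^+ 2 :> R.
      by rewrite -exprM mulnC exprM -exprVn; congr (_ ^+ _); lra.
    by rewrite sqrtr_sqr ger0_norm// exprn_ge0.
  by rewrite ler_sqrt// mulr_ge0 ?invr_ge0 ?exprn_ge0 ?fine_ge0.
pose f x := limn (h ^~ x).
have hf x : h ^~ x @ \oo --> f x by exact: hcvg.
have mf : measurable_fun setT f.
  by apply: (measurable_fun_cvg mh) => x _; exact: hf.
(* Stated before [f] is known to be square integrable: this bound is also what proves it. *)
have bnd (e : R) n :
    (forall k, (nu k >= n)%N -> ip mu (f_ n - f_ (nu k)) (f_ n - f_ (nu k)) <= e) ->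
    (\int[mu]_x ((f_ n - f) x ^+ 2)%:E <= e%:E)%E.
  move=> He; apply: (@fatou_sqr (fun k => f_ n - h k)).
  - by move=> k; apply: measurable_funB; [exact: (If _).1|exact: mh].
  - move=> x; apply: cvgB; [exact: cvg_cst|exact: hf].
  - exists n => // k /= nk.
    have := He k (leq_trans nk (nuk k)); rewrite -lee_fin ip_EFin//; apply: le_trans.
    rewrite le_eqVlt; apply/orP; left; apply/eqP; apply: ae_eq_integral => //.
    + apply/measurable_EFinP; apply: measurable_funX.
      by apply: measurable_funB; [exact: (If _).1|exact: mh].
    + by apply/measurable_EFinP; apply: measurable_funX; exact: (IB _ _).1.
    + apply: filterS aeE => x Ex _; rewrite !fctE /h indicE mem_set//.
      by rewrite mulr1.
have IBf n (e : R) :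
    (forall k, (nu k >= n)%N -> ip mu (f_ n - f_ (nu k)) (f_ n - f_ (nu k)) <= e) ->
    sqint mu (f_ n - f).
  move=> He.
  have mB : measurable_fun setT (f_ n - f).
    by apply: measurable_funB => //; exact: (If _).1.
  split=> //; apply/integrableP; split.
    by apply/measurable_EFinP; apply: measurable_funX.
  under eq_integral do rewrite gee0_abs ?lee_fin ?sqr_ge0//.
  by rewrite (le_lt_trans (bnd e n He))// ltry.
have If_ : sqint mu f.
  have [n Hn] := Cf 1 ltr01.
  have : sqint mu (f_ n - f).
    by apply: (IBf n 1) => k nk; exact/ltW/Hn.
  move=> I; have := sqintDZ (-1) I (If n).
  by rewrite scaleN1r opprB subrK.
exists f => //.
apply/cvgrPdist_le => e e0; have [n Hn] := Cf e e0.
exists n => // m /= nm.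
have He k : (nu k >= m)%N -> ip mu (f_ m - f_ (nu k)) (f_ m - f_ (nu k)) <= e.
  by move=> km; apply/ltW/Hn => //; exact: leq_trans km.
rewrite sub0r normrN ger0_norm ?ip_ge0// -lee_fin ip_EFin; last exact: IBf He.
exact: bnd.
Qed.

End RieszFischer.

(** * Smooth functions on open subsets of the plane *)

Section SmoothOn.
Context {R : realType}.
Implicit Types (U V : set (R * R)) (f g : R * R -> R) (i j : 'I_2).

(** [Ck] with the disc replaced by any set: test functions live on the whole plane and are glued
    from the disc and the exterior of a ball. *)
Fixpoint CkU U (n : nat) f : Prop :=
  (forall x, U x -> {for x, continuous f}) /\
  (if n is m.+1 then
     forall i : 'I_2, (forall x, U x -> derivable f x (basis i)) /\
                      CkU U m (pd i f)
   else True).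

Definition smooth_on U f := forall n, CkU U n f.

Lemma CkE (a : R) n f : Ck a n f <-> CkU (disc a) n f.
Proof.
elim: n f => //= n IH f; split=> -[cf H]; split=> // i; have [df ?] := H i;
  by split => //; apply/IH.
Qed.

Lemma smoothE (a : R) f : smooth a f <-> smooth_on (disc a) f.
Proof. by split=> H n; apply/CkE. Qed.

Lemma CkU_continuous U n f x : CkU U n f -> U x -> {for x, continuous f}.
Proof. by case: n => [|n] [cf _]; exact: cf. Qed.

Lemma smo_continuous U f x : smooth_on U f -> U x -> {for x, continuous f}.
Proof. by move=> /(_ 0%N); exact: CkU_continuous. Qed.

Lemma smo_derivable U f x i : smooth_on U f -> U x -> derivable f x (basis i).
Proof. by move=> /(_ 1%N)[_ /(_ i)[]] H _; exact: H. Qed.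

Lemma smo_pd U f i : smooth_on U f -> smooth_on U (pd i f).
Proof. by move=> sf n; have [_ /(_ i)[]] := sf n.+1. Qed.

Arguments smo_derivable {U f x} i.

Lemma eq_near_pd i f g x : (\near x, f x = g x) -> pd i f x = pd i g x.
Proof. exact: near_eq_derive. Qed.

Lemma eq_on_pd U i f g x : open U -> {in U, f =1 g} -> U x ->
  pd i f x = pd i g x.
Proof.
move=> oU fg Ux; apply: eq_near_pd.
by have := open_nbhs_nbhs (conj oU Ux); apply: filterS => y /mem_set/fg.
Qed.

Lemma eq_on_continuous U f g x : open U -> {in U, f =1 g} -> U x ->
  {for x, continuous f} -> {for x, continuous g}.
Proof.
move=> oU fg Ux cf; have nUx : nbhs x U by apply: open_nbhs_nbhs.
rewrite /prop_for /continuous_at -(fg x (mem_set Ux)).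
apply: cvg_trans cf; apply: near_eq_cvg.
by apply: filterS nUx => y /mem_set/fg.
Qed.

Lemma eq_CkU U n f g : open U -> {in U, f =1 g} -> CkU U n f -> CkU U n g.
Proof.
move=> oU; elim: n f g => [|n IH] f g fg [cf H].
  by split=> // x Ux; apply: eq_on_continuous fg Ux (cf x Ux).
split=> [x Ux|i]; first exact: eq_on_continuous fg Ux (cf x Ux).
have [df cdf] := H i; split=> [x Ux|].
  have nUx : nbhs x U by apply: open_nbhs_nbhs.
  apply: near_eq_derivable (df x Ux).
  by apply: filterS nUx => y /mem_set/fg.
apply: IH cdf => x /set_mem Ux; exact: eq_on_pd fg Ux.
Qed.

Lemma eq_smo U f g : open U -> {in U, f =1 g} -> smooth_on U f -> smooth_on U g.
Proof. by move=> oU fg sf n; exact: eq_CkU fg (sf n). Qed.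

Lemma sub_smo U V f : V `<=` U -> smooth_on U f -> smooth_on V f.
Proof.
move=> VU sf n; move: (sf n); elim: n f {sf} => [|n IH] f [cf H].
  by split=> // x /VU; exact: cf.
split=> [x /VU|i]; first exact: cf.
by have [df cdf] := H i; split=> [x /VU|]; [exact: df|exact: IH].
Qed.

(** Continuity and derivability at a point are taken in the plane and not within the set, so
    smoothness is a condition on each point separately. *)
Lemma smo_local U f :
  (forall x, U x -> exists V, V x /\ smooth_on V f) -> smooth_on U f.
Proof.
move=> H n; elim: n f H => [|n IH] f H.
  by split=> // x /H[V [Vx sf]]; exact: smo_continuous sf Vx.
split=> [x /H[V [Vx sf]]|i]; first exact: smo_continuous sf Vx.
split=> [x /H[V [Vx sf]]|]; first exact: smo_derivable i sf Vx.
by apply: IH => x /H[V [Vx sf]]; exists V; split=> //; exact: smo_pd.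
Qed.

Lemma smo_cst U k : smooth_on U (cst k).
Proof.
move=> n; elim: n k => [|n IH] k; first by split=> // x _; exact: cvg_cst.
split=> [x _|i]; first exact: cvg_cst.
split=> [x _|]; first exact: derivable_cst.
rewrite (_ : pd i (cst k) = cst 0); first exact: IH.
by apply/funext => x; exact: derive_cst.
Qed.

Lemma CkUS U n f : CkU U n.+1 f -> CkU U n f.
Proof.
elim: n f => [|n IH] f; first by case.
move=> [cf H]; split=> // i; have [df cdf] := H i; split=> //; exact: IH.
Qed.

Lemma CkUD U n f g : open U -> CkU U n f -> CkU U n g ->
  CkU U n (fun x => f x + g x).
Proof.
move=> oU; elim: n f g => [|n IH] f g [cf Hf] [cg Hg].
  by split=> // x Ux; apply: cvgD; [exact: cf|exact: cg].
split=> [x Ux|i]; first by apply: cvgD; [exact: cf|exact: cg].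
have [df cdf] := Hf i; have [dg cdg] := Hg i; split=> [x Ux|].
  by apply: derivableD; [exact: df|exact: dg].
apply: eq_CkU (IH _ _ cdf cdg) => // x /set_mem Ux.
by rewrite /pd deriveD//; [exact: df|exact: dg].
Qed.

Lemma CkUM U n f g : open U -> CkU U n f -> CkU U n g ->
  CkU U n (fun x => f x * g x).
Proof.
move=> oU; elim: n f g => [|n IH] f g Cf Cg; have [cf Hf] := Cf; have [cg Hg] := Cg.
  by split=> // x Ux; apply: cvgM; [exact: cf|exact: cg].
split=> [x Ux|i]; first by apply: cvgM; [exact: cf|exact: cg].
have [df cdf] := Hf i; have [dg cdg] := Hg i; split=> [x Ux|].
  by apply: derivableM; [exact: df|exact: dg].
have := CkUD oU (IH _ _ (CkUS Cf) cdg) (IH _ _ (CkUS Cg) cdf).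
apply: eq_CkU => // x /set_mem Ux.
by rewrite /pd deriveM//; [exact: df|exact: dg].
Qed.

Lemma smoD U f g : open U -> smooth_on U f -> smooth_on U g -> smooth_on U (fun x => f x + g x).
Proof. by move=> oU sf sg n; exact: CkUD. Qed.

Lemma smoM U f g : open U -> smooth_on U f -> smooth_on U g -> smooth_on U (fun x => f x * g x).
Proof. by move=> oU sf sg n; exact: CkUM. Qed.

Lemma smoZ U k f : open U -> smooth_on U f -> smooth_on U (fun x => k * f x).
Proof. by move=> oU sf; apply: smoM => //; exact: smo_cst. Qed.

Lemma smoN U f : open U -> smooth_on U f -> smooth_on U (fun x => - f x).
Proof.
by move=> oU sf; under eq_fun do rewrite -mulN1r; exact: smoZ.
Qed.

Lemma smoB U f g : open U -> smooth_on U f -> smooth_on U g -> smooth_on U (fun x => f x - g x).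
Proof. by move=> oU sf sg; apply: smoD => //; exact: smoN. Qed.

Lemma smoX U f n : open U -> smooth_on U f -> smooth_on U (fun x => f x ^+ n).
Proof.
move=> oU sf; elim: n => [|n IH].
  by under eq_fun do rewrite expr0; exact: smo_cst.
by under eq_fun do rewrite exprS; exact: smoM.
Qed.

Lemma derive_line f x (v : R * R) :
  'D_v f x = (fun h : R => f (h *: v + x))^`()%classic 0.
Proof.
rewrite derive1E /derive.
set g1 := fun h => h^-1 *: _; set g2 := fun h => h^-1 *: _.
suff -> : g1 = g2 by [].
by rewrite funeqE /g1 /g2 => h /=; rewrite addr0 scale0r add0r [_%:A]mulr1.
Qed.

Lemma derivable_line f x (v : R * R) :
  derivable f x v <-> derivable (fun h : R => f (h *: v + x)) 0 1.
Proof. exact: derivable1P. Qed.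

Lemma is_derive_comp (h : R -> R) f x (v : R * R) (d : R) :
  is_derive (f x) 1 h d -> derivable f x v ->
  is_derive x v (h \o f) (d * 'D_v f x).
Proof.
move=> [dh <-] df.
have df0 : derivable (fun t : R => f (t *: v + x)) 0 1 by exact/derivable_line.
have dh0 : derivable h ((fun t : R => f (t *: v + x)) 0) 1.
  by rewrite /= scale0r add0r.
apply: DeriveDef.
  apply/derivable_line/derivable1_diffP.
  apply: (@differentiable_comp _ _ _ _ (fun t : R => f (t *: v + x)) h).
    exact/derivable1_diffP.
  exact/derivable1_diffP.
rewrite derive_line (derive1_comp df0 dh0) -derive_line; congr (_ * _).
by rewrite scale0r add0r derive1E.
Qed.

(** The family [h] lists the successive derivatives of [h 0]. The derivative of [h k \o f] is
    [h k.+1 \o f] times that of [f], so the induction on the order must hold for all [k] at once. *)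
Lemma smo_comp_family U (h : nat -> R -> R) f : open U ->
  (forall k x, U x -> is_derive (f x) 1 (h k) (h k.+1 (f x))) ->
  smooth_on U f -> smooth_on U (h 0%N \o f).
Proof.
move=> oU dh sf n; elim: n 0%N => [|n IH] k.
  split=> // x Ux; apply: continuous_comp; first exact: smo_continuous sf Ux.
  by apply/differentiable_continuous/derivable1_diffP; case: (dh k x Ux).
split=> [x Ux|i].
  apply: continuous_comp; first exact: smo_continuous sf Ux.
  by apply/differentiable_continuous/derivable1_diffP; case: (dh k x Ux).
have D x : U x -> is_derive x (basis i) (h k \o f) (h k.+1 (f x) * pd i f x).
  by move=> Ux; exact: (is_derive_comp (dh k x Ux) (smo_derivable i sf Ux)).
split=> [x /D[]//|].
have := CkUM oU (IH k.+1) (smo_pd i sf n).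
by apply: eq_CkU => // x /set_mem /D[_ <-].
Qed.

(** The derivative of 1 / f is - (1 / f)^2 times that of f, hence of class C^n as soon as 1 / f
    is. *)
Lemma smoV U f : open U -> (forall x, U x -> f x != 0) -> smooth_on U f ->
  smooth_on U (fun x => (f x)^-1).
Proof.
move=> oU f0 sf; have cf x : U x -> {for x, continuous (fun x => (f x)^-1)}.
  by move=> Ux; apply: cvgV; [exact: f0|exact: smo_continuous sf Ux].
elim=> [|n IH]; split=> // i; split=> [x Ux|].
  by apply: derivableV; [exact: f0|exact: smo_derivable i sf Ux].
have := CkUM oU (smo_cst U (-1) n)
   (CkUM oU (CkUM oU IH IH) (smo_pd i sf n)).
apply: eq_CkU => // x /set_mem Ux.
rewrite /pd [RHS]deriveV; [|exact: f0|exact: smo_derivable i sf Ux].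
by rewrite /cst mulN1r -exprVn -[RHS]/(- _ * _) mulNr expr2.
Qed.

Lemma smo_ln U f : open U -> (forall x, U x -> 0 < f x) -> smooth_on U f ->
  smooth_on U (fun x => ln (f x)).
Proof.
move=> oU f0 sf.
have D i x : U x -> is_derive x (basis i) (@ln R \o f) ((f x)^-1 * pd i f x).
  move=> Ux.
  exact: (is_derive_comp (is_derive1_ln (f0 x Ux)) (smo_derivable i sf Ux)).
have cf x : U x -> {for x, continuous (fun x => ln (f x))}.
  move=> Ux; apply: continuous_comp; first exact: smo_continuous sf Ux.
  by apply: continuous_ln; exact: f0.
case=> [|n]; split=> // i; split=> [x /(D i)[]//|].
have sV : smooth_on U (fun x => (f x)^-1).
  by apply: smoV => // x /f0; rewrite lt0r => /andP[].
have := CkUM oU (sV n) (smo_pd i sf n).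
by apply: eq_CkU => // x /set_mem /(D i)[_ <-].
Qed.

End SmoothOn.

Arguments smo_derivable {R U f x} i.

(** * Partial derivatives on the plane and symmetry of second derivatives *)

Section PlaneCalculus.
Context {R : realType}.
Implicit Types (U V : set (R * R)) (f g : R * R -> R) (i j : 'I_2) (x y : R * R).

Lemma plane_continuousP f x : {for x, continuous f} <->
  forall e, 0 < e -> exists2 d, 0 < d &
    forall y, `|y.1 - x.1| < d -> `|y.2 - x.2| < d -> `|f y - f x| < e.
Proof.
split=> [cf e e0|H].
  have /cvgrPdist_lt/(_ e e0)/nbhs_ballP[d /= d0 Hd] := cf.
  exists d => // y y1 y2; rewrite distrC; apply: Hd.
  by split; rewrite /ball/= distrC.
apply/cvgrPdist_lt => e e0; have [d d0 Hd] := H e e0.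
have := nbhsx_ballx x d d0; apply: filterS => y [y1 y2]; rewrite distrC.
by apply: Hd; rewrite distrC.
Qed.

Lemma plane_openP U x : open U -> U x -> exists2 d, 0 < d &
  forall y, `|y.1 - x.1| < d -> `|y.2 - x.2| < d -> U y.
Proof.
move=> oU Ux; have /nbhs_ballP[d /= d0 Hd] := open_nbhs_nbhs (conj oU Ux).
by exists d => // y y1 y2; apply: Hd; split; rewrite /ball/= distrC.
Qed.

Lemma basis0 : Defs.basis 0 = (1, 0) :> R * R. Proof. by []. Qed.
Lemma basis1 : Defs.basis 1 = (0, 1) :> R * R. Proof. by []. Qed.

Lemma I2P i : i = 0 \/ i = 1.
Proof. by case: i => [[|[|//]] H]; [left|right]; apply/val_inj. Qed.

Lemma derivable_slice0 f x : derivable f x (Defs.basis 0) <->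
  derivable (fun s => f (s, x.2)) x.1 1.
Proof.
rewrite /derivable basis0; set g1 := fun h => h^-1 *: _; set g2 := fun h => h^-1 *: _.
suff -> : g1 = g2 by [].
apply/funext => h; rewrite /g1 /g2/= -[(_, _) + x]/(h * 1 + x.1, h * 0 + x.2).
by rewrite mulr0 add0r -surjective_pairing.
Qed.

Lemma derivable_slice1 f x : derivable f x (Defs.basis 1) <->
  derivable (fun s => f (x.1, s)) x.2 1.
Proof.
rewrite /derivable basis1; set g1 := fun h => h^-1 *: _; set g2 := fun h => h^-1 *: _.
suff -> : g1 = g2 by [].
apply/funext => h; rewrite /g1 /g2/= -[(_, _) + x]/(h * 0 + x.1, h * 1 + x.2).
by rewrite mulr0 add0r -surjective_pairing.
Qed.

Lemma pd_slice0 f (s t : R) : pd 0 f (s, t) = 'D_1 (fun s => f (s, t)) s.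
Proof.
rewrite /pd /derive basis0; set g1 := fun h => h^-1 *: _.
set g2 := fun h => h^-1 *: _.
suff -> : g1 = g2 by [].
apply/funext => h; rewrite /g1 /g2/= -[(_, _) + (s, t)]/(h * 1 + s, h * 0 + t).
by rewrite mulr0 add0r.
Qed.

Lemma pd_slice1 f (s t : R) : pd 1 f (s, t) = 'D_1 (fun t => f (s, t)) t.
Proof.
rewrite /pd /derive basis1; set g1 := fun h => h^-1 *: _.
set g2 := fun h => h^-1 *: _.
suff -> : g1 = g2 by [].
apply/funext => h; rewrite /g1 /g2/= -[(_, _) + (s, t)]/(h * 0 + s, h * 1 + t).
by rewrite mulr0 add0r.
Qed.

Lemma is_derive_slice0 f (s t : R) : derivable f (s, t) (Defs.basis 0) ->
  is_derive s 1 (fun s => f (s, t)) (pd 0 f (s, t)).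
Proof.
move=> /(derivable_slice0 f (s, t)).1/= df.
by apply: DeriveDef; [exact: df|rewrite pd_slice0].
Qed.

Lemma is_derive_slice1 f (s t : R) : derivable f (s, t) (Defs.basis 1) ->
  is_derive t 1 (fun t => f (s, t)) (pd 1 f (s, t)).
Proof.
move=> /(derivable_slice1 f (s, t)).1/= df.
by apply: DeriveDef; [exact: df|rewrite pd_slice1].
Qed.

Lemma mvt_exists (g dg : R -> R) (a b : R) : a < b ->
  (forall t, a <= t <= b -> is_derive t 1 g (dg t)) ->
  exists2 c, a < c < b & g b - g a = dg c * (b - a).
Proof.
move=> ab dgt.
have D t : t \in `]a, b[ -> is_derive t 1 g (dg t).
  by rewrite in_itv/= => /andP[at_ tb]; apply: dgt; rewrite !ltW.
have C : {within `[a, b], continuous g}.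
  apply: derivable_within_continuous => t; rewrite in_itv/= => tab.
  by case: (dgt t tab).
have [c + ->] := MVT ab D C.
by rewrite in_itv/=; exists c.
Qed.

Lemma mvt_bound (g dg : R -> R) (a b C : R) :
  (forall t, `|t - a| <= `|b - a| -> is_derive t 1 g (dg t)) ->
  (forall t, `|t - a| <= `|b - a| -> `|dg t| <= C) ->
  `|g b - g a| <= C * `|b - a|.
Proof.
move=> dgt bC; have [ab|ba|->] := ltgtP a b; last by rewrite !subrr normr0 mulr0.
- have I t : a <= t <= b -> `|t - a| <= `|b - a|.
    by move=> /andP[at_ tb]; rewrite !ger0_norm ?subr_ge0 ?(ltW ab)// lerD2r.
  have [c /andP[ac cb] ->] := mvt_exists ab (fun t tI => dgt t (I t tI)).
  by rewrite normrM ler_wpM2r// bC// I// !ltW.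
- have I t : b <= t <= a -> `|t - a| <= `|b - a|.
    by move=> /andP[at_ tb]; rewrite !ler0_norm ?subr_le0 ?(ltW ba)// lerN2 lerD2r.
  have [c /andP[ac cb] E] := mvt_exists ba (fun t tI => dgt t (I t tI)).
  by rewrite distrC E normrM (distrC a) ler_wpM2r// bC// I// !ltW.
Qed.

Lemma norm_lt_add1 (u v : R) : `|u - v| < 1 -> `|u| < `|v| + 1.
Proof. by rewrite -ltrBlDl; apply: le_lt_trans; exact: lerB_dist. Qed.

(** The second difference of f over a square of side h at x is, by the mean value theorem used in
    either order of the variables, h^2 times either mixed derivative at some point of the square.
    Continuity of both at x concludes, for h small. *)
Lemma pdC U f x : open U -> smooth_on U f -> U x ->
  pd 0 (pd 1 f) x = pd 1 (pd 0 f) x.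
Proof.
move=> oU sf Ux; apply/eqP; rewrite -subr_eq0 -normr_le0.
apply/ler_addgt0Pr => e e0; rewrite add0r; have e20 : 0 < e / 2 by rewrite divr_gt0.
have s01 := smo_pd 0 (smo_pd 1 sf); have s10 := smo_pd 1 (smo_pd 0 sf).
have [d d0 Hd] := plane_openP oU Ux.
have [d1 d10 H1] := (plane_continuousP _ _).1 (smo_continuous s01 Ux) _ e20.
have [d2 d20 H2] := (plane_continuousP _ _).1 (smo_continuous s10 Ux) _ e20.
pose m := Num.min d (Num.min d1 d2); pose h := m / 2.
have m0 : 0 < m by rewrite !lt_min d0 d10 d20.
have [md md1 md2] : [/\ m <= d, m <= d1 & m <= d2].
  by split; rewrite !ge_min lexx ?orbT.
have h0 : 0 < h by rewrite divr_gt0.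
have hm : h < m by rewrite /h; lra.
have near1 (a t : R) : a <= t <= a + h -> `|t - a| < m.
  by move=> /andP[at_ ta]; rewrite ger0_norm ?subr_ge0//; lra.
have box (s t : R) : x.1 <= s <= x.1 + h -> x.2 <= t <= x.2 + h -> U (s, t).
  by move=> /near1 s1 /near1 t1; apply: Hd => /=; exact: lt_le_trans md.
have end2 : x.2 <= x.2 + h <= x.2 + h by rewrite lexx lerDl ltW.
have beg2 : x.2 <= x.2 <= x.2 + h by rewrite lexx lerDl ltW.
have end1 : x.1 <= x.1 + h <= x.1 + h by rewrite lexx lerDl ltW.
have beg1 : x.1 <= x.1 <= x.1 + h by rewrite lexx lerDl ltW.
have lt1 : x.1 < x.1 + h by rewrite ltrDl.
have lt2 : x.2 < x.2 + h by rewrite ltrDl.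
have [xi xiI E1] := mvt_exists (g := fun s => f (s, x.2 + h) - f (s, x.2))
  (dg := fun s => pd 0 f (s, x.2 + h) - pd 0 f (s, x.2)) lt1
  (fun t tI => is_deriveB (is_derive_slice0 (smo_derivable 0 sf (box _ _ tI end2)))
                (is_derive_slice0 (smo_derivable 0 sf (box _ _ tI beg2)))).
have xiI' : x.1 <= xi <= x.1 + h by case/andP: xiI => *; rewrite !ltW.
have [eta etaI E2] := mvt_exists (g := fun t => pd 0 f (xi, t))
  (dg := fun t => pd 1 (pd 0 f) (xi, t)) lt2
  (fun t tI => is_derive_slice1 (smo_derivable 1 (smo_pd 0 sf) (box _ _ xiI' tI))).
have [eta' eta'I E1'] := mvt_exists (g := fun t => f (x.1 + h, t) - f (x.1, t))
  (dg := fun t => pd 1 f (x.1 + h, t) - pd 1 f (x.1, t)) lt2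
  (fun t tI => is_deriveB (is_derive_slice1 (smo_derivable 1 sf (box _ _ end1 tI)))
                (is_derive_slice1 (smo_derivable 1 sf (box _ _ beg1 tI)))).
have eta'I' : x.2 <= eta' <= x.2 + h by case/andP: eta'I => *; rewrite !ltW.
have [xi' xi'I E2'] := mvt_exists (g := fun s => pd 1 f (s, eta'))
  (dg := fun s => pd 0 (pd 1 f) (s, eta')) lt1
  (fun t tI => is_derive_slice0 (smo_derivable 0 (smo_pd 1 sf) (box _ _ tI eta'I'))).
have E : pd 1 (pd 0 f) (xi, eta) = pd 0 (pd 1 f) (xi', eta').
  have K1 : x.1 + h - x.1 = h by rewrite addrAC subrr add0r.
  have K2 : x.2 + h - x.2 = h by rewrite addrAC subrr add0r.
  rewrite K1 in E1 E2'; rewrite K2 in E2 E1'; cbv beta in E1, E2, E1', E2'.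
  apply: (mulIf (lt0r_neq0 h0)); apply: (mulIf (lt0r_neq0 h0)).
  transitivity (f (x.1 + h, x.2 + h) - f (x.1 + h, x.2) -
               (f (x.1, x.2 + h) - f (x.1, x.2))).
    by rewrite E1 E2.
  transitivity (f (x.1 + h, x.2 + h) - f (x.1, x.2 + h) -
               (f (x.1 + h, x.2) - f (x.1, x.2))).
    by rewrite !opprD !opprK !addrA; congr (_ + _); rewrite addrAC.
  by rewrite E1' E2'.
have etaI' : x.2 <= eta <= x.2 + h by case/andP: etaI => *; rewrite !ltW.
have xi'I' : x.1 <= xi' <= x.1 + h by case/andP: xi'I => *; rewrite !ltW.
have L1 := H1 (xi', eta') (lt_le_trans (near1 _ _ xi'I') md1)
  (lt_le_trans (near1 _ _ eta'I') md1).
have L2 := H2 (xi, eta) (lt_le_trans (near1 _ _ xiI') md2)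
  (lt_le_trans (near1 _ _ etaI') md2).
rewrite E in L2; rewrite distrC in L1.
apply: le_trans (ler_distD (pd 0 (pd 1 f) (xi', eta')) _ _) _.
by rewrite [leRHS]splitr; apply: lerD; apply: ltW; [exact: L1|exact: L2].
Qed.

End PlaneCalculus.

(** * Coordinates, the squared norm and reflections *)

Section SmoothExamples.
Context {R : realType}.
Implicit Types (U V : set (R * R)) (f g : R * R -> R) (i j : 'I_2) (x y : R * R).

Definition crd i x : R := if i == 0 then x.1 else x.2.

Lemma scaleR_mul (u v : R) : u *: v = u * v.
Proof. by []. Qed.

Lemma crd_line i x (v : R * R) (h : R) :
  crd i (h *: v + x) = h * crd i v + crd i x.
Proof. by rewrite /crd; case: (i == 0). Qed.

Lemma is_derive_crd i x (v : R * R) : is_derive x v (crd i) (crd i v).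
Proof.
have D : is_derive (0 : R) 1 (fun h => h * crd i v + crd i x) (crd i v).
  have D := is_deriveD (is_deriveM (is_derive_id (0 : R) 1)
    (is_derive_cst (crd i v) (0 : R) 1)) (is_derive_cst (crd i x) (0 : R) 1).
  by apply: is_derive_eq D _; rewrite scaler0 add0r addr0 scaleR_mul mulr1.
apply: DeriveDef.
  by apply/derivable_line; under eq_fun do rewrite crd_line; case: D.
rewrite derive_line derive1E; under eq_fun do rewrite crd_line.
by case: D.
Qed.

Lemma pd_crd i j x : pd i (crd j) x = (i == j)%:R.
Proof.
rewrite /pd; have [_ ->] := is_derive_crd j x (Defs.basis i).
by case: (I2P i) => ->; case: (I2P j) => ->.
Qed.

Lemma continuous_crd i : continuous (crd i).
Proof.
move=> x; apply/plane_continuousP => e e0; exists e => // y y1 y2.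
by rewrite /crd; case: (i == 0).
Qed.

Lemma smo_crd U i : open U -> smooth_on U (crd i).
Proof.
move=> oU; case=> [|n]; first by split=> // x _; exact: continuous_crd.
split=> [x _|j]; first exact: continuous_crd.
split=> [x _|]; first by case: (is_derive_crd i x (Defs.basis j)).
rewrite (_ : pd j (crd i) = cst (j == i)%:R); first exact: smo_cst.
by apply/funext => x; rewrite pd_crd.
Qed.

Lemma sqnormE x : sqnorm x = crd 0 x * crd 0 x + crd 1 x * crd 1 x.
Proof. by rewrite /sqnorm !expr2. Qed.

Lemma smo_sqnorm U : open U -> smooth_on U sqnorm.
Proof.
move=> oU; rewrite (_ : sqnorm = fun x => crd 0 x * crd 0 x + crd 1 x * crd 1 x).
  by apply: smoD => //; apply: smoM => //; exact: smo_crd.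
by apply/funext => x; rewrite sqnormE.
Qed.

Lemma is_derive_sqnorm i x : is_derive x (Defs.basis i) sqnorm (2 * crd i x).
Proof.
rewrite (_ : sqnorm = crd 0 * crd 0 + crd 1 * crd 1); last first.
  by apply/funext => y; rewrite sqnormE.
have D j := is_deriveM (is_derive_crd j x (Defs.basis i))
  (is_derive_crd j x (Defs.basis i)).
apply: is_derive_eq (is_deriveD (D 0) (D 1)) _.
by rewrite !scaleR_mul; case: (I2P i) => ->; rewrite /crd/=; ring.
Qed.

Lemma sqnorm_ge0 x : 0 <= sqnorm x.
Proof. by rewrite addr_ge0 ?sqr_ge0. Qed.

Lemma continuous_sqnorm : continuous (@sqnorm R).
Proof. by move=> x; apply: (smo_continuous (smo_sqnorm openT)). Qed.

Lemma open_disc (a : R) : open (disc a).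
Proof.
rewrite (_ : disc a = (fun x => a ^+ 2 * sqnorm x) @^-1` [set t | t < 4])//.
apply: open_comp; last exact: open_lt.
by move=> x _; apply: cvgM; [exact: cvg_cst|exact: continuous_sqnorm].
Qed.

Lemma open_sqnorm_gt (M : R) : open [set x | M < sqnorm x].
Proof.
rewrite (_ : [set _ | _] = sqnorm @^-1` [set t | M < t])//.
by apply: open_comp; [move=> x _; exact: continuous_sqnorm|exact: open_gt].
Qed.

Lemma derivable_reflect (f : R * R -> R) z x (v : R * R) :
  derivable f (z - x) v -> is_derive x v (fun y => f (z - y)) (- 'D_v f (z - x)).
Proof.
move=> /derivable_line df.
have E : (fun h : R => f (z - (h *: v + x))) =
    (fun h => f (h *: v + (z - x))) \o (fun h => - h).
  by apply/funext => h /=; congr f; rewrite scaleNr opprD addrCA.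
have D : is_derive (0 : R) 1 ((fun h => f (h *: v + (z - x))) \o (fun h => - h))
    ('D_1 (fun h : R => f (h *: v + (z - x))) 0 * (- 1)).
  apply: is_derive1_comp; first by rewrite oppr0; apply: DeriveDef.
apply: DeriveDef; first by apply/derivable_line; rewrite E; case: D.
rewrite derive_line derive1E E; case: D => _ ->.
by rewrite mulrN1 derive_line derive1E.
Qed.

Lemma smo_reflect f z : smooth_on setT f -> smooth_on setT (fun y => f (z - y)).
Proof.
move=> sf n; elim: n f sf => [|n IH] f sf.
  split=> // x _; apply: (@continuous_comp _ _ _ (fun y => z - y) f).
    by apply: cvgB; [exact: cvg_cst|exact: cvg_id].
  exact: (smo_continuous sf).
split=> [x _|i].
  apply: (@continuous_comp _ _ _ (fun y => z - y) f).
    by apply: cvgB; [exact: cvg_cst|exact: cvg_id].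
  exact: (smo_continuous sf).
have D x := derivable_reflect (smo_derivable i sf (I : setT (z - x))).
split=> [x _|]; first by case: (D x).
rewrite (_ : pd i _ = fun y => - (pd i f) (z - y)); last first.
  by apply/funext => x; case: (D x).
have := CkUM openT (smo_cst setT (-1) n) (IH _ (smo_pd i sf)).
by apply: eq_CkU => [|x _]; [exact: openT|rewrite /cst mulN1r].
Qed.

Lemma pd_reflect f z i x : smooth_on setT f ->
  pd i (fun y => f (z - y)) x = - pd i f (z - x).
Proof.
by move=> sf; case: (derivable_reflect (smo_derivable i sf (I : setT (z - x)))).
Qed.

End SmoothExamples.

(** * The function exp(-1/t) and its derivatives *)

Section FlatFunction.
Context {R : realType}.
Implicit Types (p : {poly R}) (t s : R).

(* The derivatives of exp(-1/t) are polynomials in 1/t times exp(-1/t), whence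
   the polynomial parameter. *)
Definition flat p t : R := if 0 < t then p.[t^-1] * expR (- t^-1) else 0.

(** With s = 1/t one has d/dt = - s^2 d/ds, and p(s) exp(-s) has s-derivative (p' - p)(s)
    exp(-s). *)
Definition dflat p : {poly R} := 'X^2 * (p - p^`()).

Lemma horner_growth p : exists (C : R) (n : nat), 0 <= C /\
  forall s, 1 <= s -> `|p.[s]| <= C * s ^+ n.
Proof.
elim/poly_ind: p => [|p c [C [n [C0 H]]]].
  by exists 0, 0%N; split=> // s _; rewrite horner0 normr0 mul0r.
exists (C + `|c|), n.+1; split=> [|s s1]; first by rewrite addr_ge0.
rewrite !hornerE (le_trans (ler_normD _ _))// mulrDl lerD//.
  by rewrite normrM exprSr mulrA [`|s|]ger0_norm ?ler_wpM2r ?H// (le_trans _ s1).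
by rewrite ler_peMr// exprn_ege1.
Qed.

(** If |p(s)| <= C s^n, then exp(-s) <= (n + 2)! / s^(n + 2) leaves a factor s^-2 = t^2. The square
    is what makes the difference quotient at 0 tend to 0. *)
Lemma flat_bound p : exists2 C : R, 0 <= C &
  forall t, t <= 1 -> `|flat p t| <= C * t ^+ 2.
Proof.
have [C [n [C0 H]]] := horner_growth p.
exists (C * (n.+2)`!%:R) => [|t t1]; first by rewrite mulr_ge0.
rewrite /flat; case: ifPn => [t0|_]; last by rewrite normr0 mulr_ge0 ?sqr_ge0// mulr_ge0.
have s1 : 1 <= t^-1 by rewrite invf_ge1.
have s0 : 0 < t^-1 by rewrite invr_gt0.
rewrite normrM [`|expR _|]ger0_norm ?expR_ge0//.
apply: (@le_trans _ _ (C * t^-1 ^+ n * (((n.+2)`!)%:R * (t^-1 ^+ n.+2)^-1))).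
  apply: ler_pM; [exact: normr_ge0|exact: expR_ge0|exact: H|].
  rewrite expRN -[X in X / _]invrK -invfM lef_pV2 ?posrE ?expR_gt0//.
    rewrite mulrC; apply: le_trans (expR_ge1Dxn n.+1 (ltW s0)).
    by rewrite lerDr.
  by rewrite mulr_gt0 ?exprn_gt0// invr_gt0 ltr0n fact_gt0.
rewrite le_eqVlt; apply/orP; left; apply/eqP.
rewrite -[n.+2]addn2 exprD; field.
by rewrite expf_neq0 ?gt_eqF.
Qed.

Lemma is_derive_flat p t : is_derive t 1 (flat p) (flat (dflat p) t).
Proof.
have [t0|t0|t0] := ltgtP 0 t; last rewrite -t0.
- have E : \forall s \near t, p.[s^-1] * expR (- s^-1) = flat p s.
    near=> s; rewrite /flat ifT//; near: s; exact: lt_nbhsr.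
  have Dv : is_derive t 1 (fun s => s^-1) (- t^-2).
    apply: is_derive_eq; first by apply: is_deriveV; rewrite gt_eqF.
    by rewrite -[_ *: _]/(_ * _) mulr1.
  have D1 := is_derive1_comp (is_derive_poly p t^-1) Dv.
  have D2 : is_derive t 1 (expR \o (fun s => - s^-1)) (expR (- t^-1) * t^-2).
    apply: is_derive_eq (is_derive1_comp (is_derive_expR _) (is_deriveN Dv)) _.
    by rewrite opprK.
  have D := is_deriveM D1 D2.
  apply: (near_eq_is_derive E); apply: is_derive_eq D _.
  rewrite !scaleR_mul /flat t0 /dflat /= !hornerE/= exprVn.
  by ring.
- have E : \forall s \near t, 0 = flat p s.
    near=> s; rewrite /flat ifF//; apply/negbTE; rewrite -leNgt ltW//; near: s.
    exact: lt_nbhsl.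
  apply: (near_eq_is_derive E); apply: is_derive_eq.
  by rewrite /flat ifF//; apply/negbTE; rewrite -leNgt ltW.
- have F0 : flat p 0 = 0 by rewrite /flat ltxx.
  have -> : flat (dflat p) 0 = 0 by rewrite /flat ltxx.
  have [C C0 H] := flat_bound p.
  suff L : (fun h : R => h^-1 *: ((flat p \o shift 0) (h *: 1) - flat p 0)) @ 0^' --> (0 : R).
    by apply: DeriveDef; [apply/cvg_ex; exists 0|exact/cvg_lim].
  apply/cvgrPdist_le => e e0; near=> h.
  have h0 : h != 0 by near: h; exact: nbhs_dnbhs_neq.
  rewrite sub0r normrN F0 subr0 /= addr0 -[h *: 1]/(h * 1) mulr1.
  rewrite -[_ *: _]/(_ * _) normrM normfV ler_pdivrMl ?normr_gt0//.
  have h1 : h <= 1.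
    apply: (le_trans (ler_norm _)); near: h.
    exact: dnbhs0_le.
  apply: le_trans (H _ h1) _.
  rewrite -[h ^+ 2]real_normK ?num_real// expr2 mulrA [leRHS]mulrC ler_wpM2r//.
  have C1 : 0 < C + 1 by rewrite ltr_wpDl.
  have : `|h| <= e / (C + 1).
    near: h; apply: dnbhs0_le.
    by rewrite divr_gt0// ltr_wpDl.
  rewrite ler_pdivlMr// mulrDr mulr1 mulrC; apply: le_trans.
  by rewrite lerDl.
Unshelve. all: by end_near. Qed.

Lemma flat_ge0 t : 0 <= flat 1 t.
Proof.
by rewrite /flat; case: ifPn => // _; rewrite hornerC mul1r expR_ge0.
Qed.

Lemma flatX2_ge0 t : 0 <= flat 'X^2 t.
Proof.
rewrite /flat; case: ifPn => // _.
by rewrite hornerXn mulr_ge0 ?expR_ge0 ?sqr_ge0.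
Qed.

Lemma flat_le0 p t : t <= 0 -> flat p t = 0.
Proof. by move=> t0; rewrite /flat ifF//; apply/negbTE; rewrite -leNgt. Qed.

Lemma is_derive_flat1 t : is_derive t 1 (flat 1) (flat 'X^2 t).
Proof.
have := is_derive_flat 1 t.
by rewrite /dflat derivC subr0 mulr1.
Qed.

Lemma smo_flat (U : set (R * R)) p (f : R * R -> R) : open U -> smooth_on U f ->
  smooth_on U (fun x => flat p (f x)).
Proof.
move=> oU; apply: (smo_comp_family (h := fun k => flat (iter k dflat p))) => // k x _.
exact: is_derive_flat.
Qed.

End FlatFunction.

(** * Integration by parts and convolution *)

Section PlaneMeasure.
Context {R : realType}.
Local Notation leb := (@lebesgue_measure R).
Local Notation leb2 := (@lebesgue_measure R \x @lebesgue_measure R)%E.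
Local Notation PR := (measurableTypeR R * measurableTypeR R)%type.
Implicit Types (U V : set (R * R)) (f g : R * R -> R) (i j : 'I_2) (x y : R * R).

(** The measurable structure is the product one, so an open set is written as the countable union of
    the rational boxes that it contains; a box that is not contained contributes the empty set. *)
Lemma open_plane_measurable U : open U -> measurable (U : set PR).
Proof.
move=> oU; suff : measurable U by [].
pose box (k : rat * rat * nat) : set (R * R) :=
  [set s | `|s - ratr k.1.1| < k.2.+1%:R^-1] `*`
  [set t | `|t - ratr k.1.2| < k.2.+1%:R^-1].
pose F k : set (R * R) := [set x | box k x /\ box k `<=` U].
have mball (c r : R) : measurable [set s : R | `|s - c| < r].
  rewrite (_ : [set _ | _] = `]c - r, c + r[%classic); first exact: measurable_itv.
  by apply/seteqP; split=> s /=; rewrite in_itv/= ltr_distl.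
have -> : U = \bigcup_k F k.
  apply/seteqP; split=> [x Ux|x [k _ [bx]]]; last exact.
  have [d d0 Hd] := plane_openP oU Ux.
  have [n n_d] : exists n : nat, n.+1%:R^-1 < d / 2.
    have [n _ Hn] := near_infty_natSinv_lt (PosNum (divr_gt0 d0 (ltr0n _ 2))).
    by exists n; apply: (Hn n) => /=.
  have n0 : 0 < n.+1%:R^-1 :> R by rewrite invr_gt0.
  have [p1 P1] : exists p : rat, `|x.1 - ratr p| < n.+1%:R^-1.
    have lt : x.1 - n.+1%:R^-1 < x.1 + n.+1%:R^-1 by rewrite ltrD2l gtrN.
    have [p] := rat_in_itvoo lt.
    by rewrite in_itv/= -ltr_distl distrC; exists p.
  have [p2 P2] : exists p : rat, `|x.2 - ratr p| < n.+1%:R^-1.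
    have lt : x.2 - n.+1%:R^-1 < x.2 + n.+1%:R^-1 by rewrite ltrD2l gtrN.
    have [p] := rat_in_itvoo lt.
    by rewrite in_itv/= -ltr_distl distrC; exists p.
  exists ((p1, p2), n) => //; split=> // y [/= y1 y2]; apply: Hd.
    rewrite (le_lt_trans (ler_distD (ratr p1) _ _))// [ltRHS]splitr ltrD//.
      exact: lt_trans n_d.
    by rewrite distrC; exact: lt_trans n_d.
  rewrite (le_lt_trans (ler_distD (ratr p2) _ _))// [ltRHS]splitr ltrD//.
    exact: lt_trans n_d.
  by rewrite distrC; exact: lt_trans n_d.
apply: countable_bigcupT_measurable => [|k]; first exact: countableP.
have [kU|kU] := pselect (box k `<=` U).
  rewrite (_ : F k = box k); first exact: measurableX.
  by apply/seteqP; split=> x; [case|split].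
rewrite (_ : F k = set0)//.
by apply/seteqP; split=> x [].
Qed.

Lemma plane_continuous_measurable f : continuous f ->
  measurable_fun (setT : set PR) f.
Proof.
move=> /continuousP cf; suff : measurable_fun setT f by []. apply: (measurability _ (RGenOpens.measurableE R)) => //.
move=> _ [_ [a [b ->] <-]]; rewrite setTI.
have : measurable (f @^-1` `]a, b[ : set PR).
  apply: open_plane_measurable.
  by apply: cf; exact: interval_open.
by [].
Qed.

Definition box (N : R) : set (R * R) := `[- N, N] `*` `[- N, N].

Lemma measurable_box N : measurable (box N : set PR).
Proof. by apply: measurableX; exact: measurable_itv. Qed.

Lemma box_lty N : (leb2 (box N) < +oo)%E.
Proof.
rewrite product_measure1E; [|exact: measurable_itv..].
have L : (leb `[(- N)%R, N] < +oo)%E.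
  by rewrite lebesgue_measure_itv/=; case: ifP => // _; rewrite -EFinB ltry.
by rewrite lte_mul_pinfty// ge0_fin_numE.
Qed.

(** M + 1 is a crude bound for the square root of M, which keeps everything polynomial. *)
Lemma box_supp M x : sqnorm x <= M -> box (M + 1) x.
Proof.
move=> xM; have H (t : R) : t ^+ 2 <= M -> t \in `[- (M + 1), M + 1].
  by rewrite in_itv/= => tM; apply/andP; split; nra.
by split; apply: H; apply: le_trans xM; rewrite ?lerDl ?lerDr sqr_ge0.
Qed.

Lemma compact_box N : compact (box N).
Proof. by apply: compact_setX; exact: segment_compact. Qed.

Lemma continuous_box_bounded f N : continuous f ->
  exists2 C, 0 <= C & forall x, box N x -> `|f x| <= C.
Proof.
move=> cf; have [[x0 Nx0]|N0] := pselect (box N !=set0); last first.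
  by exists 0 => // x Nx; exfalso; apply: N0; exists x.
have cn : continuous (fun x => `|f x|).
  by move=> x; apply: (@continuous_comp _ _ _ f (fun t => `|t|)); [exact: cf|exact: norm_continuous].
have [c _ Hc] := @compact_EVT_max _ R (fun x => `|f x|) (box N)
  (ex_intro _ x0 Nx0) (@compact_box N) (continuous_subspaceT cn).
by exists `|f c| => // x Nx; apply: Hc; exact: mem_set.
Qed.

Definition supp (M : R) f := forall x, M < sqnorm x -> f x = 0.

Lemma supp_bounded f M : continuous f -> supp M f ->
  exists2 C, 0 <= C & forall x, `|f x| <= C.
Proof.
move=> cf sf; have [C C0 H] := continuous_box_bounded (M + 1) cf.
exists C => // x; have [xM|xM] := leP (sqnorm x) M; last by rewrite sf// normr0.
by apply: H; exact: box_supp.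
Qed.

Lemma integrable_bounded_supp f M C : measurable_fun (setT : set PR) f -> supp M f ->
  (forall x, `|f x| <= C) -> leb2.-integrable setT (EFin \o f).
Proof.
move=> mf sf fC.
have mB := measurable_box (M + 1).
have I : leb2.-integrable (box (M + 1)) (EFin \o cst C).
  by apply: measurable_bounded_integrable => //; [exact: box_lty|exact: bounded_cst].
have {}I : leb2.-integrable setT (EFin \o (cst C \_ (box (M + 1)))).
  rewrite -restrict_EFin; apply: (@integrable_restrict _ _ R leb2 _ mB _ measurableT _).1.
  by rewrite setTI.
apply: (le_integrable measurableT _ _ I); first exact/measurable_EFinP.
move=> x _; rewrite lee_fin/= patchE; case: ifPn => [_|].
  exact: le_trans (fC x) (ler_norm _).
rewrite notin_setE => nx; rewrite normr0 sf ?normr0// ltNge; apply/negP => xM.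
by apply: nx; exact: box_supp.
Qed.

Lemma integrable_supp f M : continuous f -> supp M f ->
  leb2.-integrable setT (EFin \o f).
Proof.
move=> cf sf; have [C _ fC] := supp_bounded cf sf.
by apply: (integrable_bounded_supp _ sf fC); exact: plane_continuous_measurable.
Qed.

Lemma sqint_supp f M : continuous f -> supp M f -> sqint leb2 f.
Proof.
move=> cf sf; split; first exact: plane_continuous_measurable.
apply: (@integrable_supp (fun x => f x ^+ 2) M).
  move=> x; under eq_fun do rewrite expr2.
  by apply: cvgM; exact: cf.
by move=> x Mx; rewrite sf// expr0n.
Qed.

Lemma integral_derive0 (g dg : R -> R) (N : R) : 0 < N ->
  (forall t : R, is_derive t 1 g (dg t)) -> continuous dg ->
  (forall t, N <= `|t| -> g t = 0) -> (forall t, N <= `|t| -> dg t = 0) ->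
  (\int[leb]_t (dg t)%:E = 0)%E.
Proof.
move=> N0 Dg cdg g0 dg0.
have E : (EFin \o dg) \_ `[- N, N] = EFin \o dg.
  apply/funext => t; rewrite patchE; case: ifPn => // /negP tN /=.
  rewrite dg0// leNgt; apply/negP => /ltW; rewrite ler_norml => ?.
  by apply: tN; rewrite inE/= in_itv.
rewrite -[X in integral _ _ X]E -integral_mkcond.
have NN : - N < N by rewrite gtrN.
have cg : continuous g.
  by move=> t; apply/differentiable_continuous/derivable1_diffP; case: (Dg t).
rewrite (@continuous_FTC2 _ dg g _ _ NN).
- by rewrite (g0 N) ?(g0 (- N)) ?normrN ?ger0_norm ?(ltW N0)// sube0.
- exact: continuous_subspaceT.
- split=> [t _||]; first by case: (Dg t).
    by apply: cvg_at_right_filter; exact: cg.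
  by apply: cvg_at_left_filter; exact: cg.
- by move=> t _; rewrite derive1E; case: (Dg t).
Qed.

Lemma abs_supp (M : R) x i : M + 1 <= `|crd i x| -> M < sqnorm x.
Proof.
rewrite -[sqnorm x]/(x.1 ^+ 2 + x.2 ^+ 2) => H; rewrite ltNge; apply/negP => xM.
have : `|crd i x| ^+ 2 <= M.
  rewrite real_normK ?num_real//; apply: le_trans xM.
  by rewrite /crd; case: (i == 0); rewrite ?lerDl ?lerDr sqr_ge0.
nra.
Qed.

Lemma continuous_slice0 f (t : R) : continuous f ->
  continuous (fun s : R => f (s, t)).
Proof.
move=> cf s; apply/cvgrPdist_lt => e e0.
have [d d0 H] := (plane_continuousP _ _).1 (cf (s, t)) e e0.
near=> u; rewrite distrC; apply: H => /=; last by rewrite subrr normr0.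
by rewrite distrC; near: u; exact: cvgr_dist_lt.
Unshelve. all: by end_near. Qed.

Lemma continuous_slice1 f (s : R) : continuous f ->
  continuous (fun t : R => f (s, t)).
Proof.
move=> cf t; apply/cvgrPdist_lt => e e0.
have [d d0 H] := (plane_continuousP _ _).1 (cf (s, t)) e e0.
near=> u; rewrite distrC; apply: H => /=; first by rewrite subrr normr0.
by rewrite distrC; near: u; exact: cvgr_dist_lt.
Unshelve. all: by end_near. Qed.

Lemma supp_pd M f i : supp M f -> supp M (pd i f).
Proof.
move=> sf x Mx.
rewrite (@eq_on_pd _ [set y | M < sqnorm y] i f (cst 0)) ?/pd ?derive_cst//.
  exact: open_sqnorm_gt.
by move=> y /set_mem; exact: sf.
Qed.

(** By Fubini the integration starts with the axis of differentiation, on which the fundamental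
    theorem of calculus gives 0. *)
Theorem integral_pd0 f M i : (forall x, derivable f x (Defs.basis i)) ->
  continuous (pd i f) -> supp M f ->
  \int[leb2]_x pd i f x = 0.
Proof.
move=> df cdf sf; have sdf := supp_pd i sf.
have If := integrable_supp cdf sdf.
pose N := `|M| + 1.
have N0 : 0 < N by rewrite ltr_wpDl.
have far j x : N <= `|crd j x| -> M < sqnorm x.
  by move=> H; rewrite (@abs_supp _ _ j)// (le_trans _ H)// lerD2r ler_norm.
rewrite /Rintegral; case: (I2P i) df cdf sdf If => -> df cdf sdf If.
- rewrite -(integral21_prod_meas1 If) /fubini_G/=.
  rewrite integral0_eq// => t _.
  apply: (integral_derive0 (g := fun s : R => f (s, t)) (dg := fun s : R => pd 0 f (s, t)) N0).
  + by move=> s; exact: is_derive_slice0.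
  + exact: continuous_slice0.
  + by move=> s sN; apply: sf; exact: (far 0).
  + by move=> s sN; apply: sdf; exact: (far 0).
- rewrite -(integral12_prod_meas1 If) /fubini_F/=.
  rewrite integral0_eq// => s _.
  apply: (integral_derive0 (g := fun t : R => f (s, t)) (dg := fun t : R => pd 1 f (s, t)) N0).
  + by move=> t; exact: is_derive_slice1.
  + exact: continuous_slice1.
  + by move=> t tN; apply: sf; exact: (far 1).
  + by move=> t tN; apply: sdf; exact: (far 1).
Qed.

End PlaneMeasure.

(** * Convolution with a smooth compactly supported kernel *)

Section Convolution.
Context {R : realType}.
Local Notation leb2 := (@lebesgue_measure R \x @lebesgue_measure R)%E.
Local Notation PR := (measurableTypeR R * measurableTypeR R)%type.
Implicit Types (U V : set (R * R)) (f g K : R * R -> R) (i j : 'I_2) (x y : R * R).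

(** This class contains the square integrable functions and also the constants, whose convolutions
    compute the mass of a kernel. *)
Definition locint f := measurable_fun (setT : set PR) f /\
  forall N, leb2.-integrable (box N) (EFin \o f).

Lemma box_cover x : exists2 N, 0 <= N & box N x.
Proof.
exists (`|x.1| + `|x.2|); first by rewrite addr_ge0.
by split; rewrite /= in_itv/= -ler_norml ?lerDl ?lerDr.
Qed.

Lemma box_norm N x : box N x <-> `|x.1| <= N /\ `|x.2| <= N.
Proof. by split=> -[]; rewrite /= ?in_itv/= -?ler_norml; split; rewrite /= ?in_itv/= -?ler_norml. Qed.

Lemma sqint_locint f : sqint leb2 f -> locint f.
Proof.
move=> If; split=> [|N]; first exact: If.1.
have mB := measurable_box N.
have I1 : leb2.-integrable (box N) (EFin \o cst 1).
  by apply: measurable_bounded_integrable => //; [exact: box_lty|exact: bounded_cst].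
have I2 := integrableS measurableT mB (@subsetT _ _) If.2.
apply: (le_integrable mB _ _ (integrableD mB I1 I2)).
  by apply/measurable_EFinP; apply: measurable_funTS; exact: If.1.
move=> x _ /=; rewrite lee_fin [leRHS]ger0_norm ?addr_ge0 ?sqr_ge0//.
rewrite -[f x ^+ 2]real_normK ?num_real//.
have := sqr_ge0 (`|f x| - 1); have := normr_ge0 (f x); nra.
Qed.

Lemma continuous_locint f : continuous f -> locint f.
Proof.
move=> cf; split=> [|N]; first exact: plane_continuous_measurable.
have [C C0 fC] := continuous_box_bounded N cf.
apply: measurable_bounded_integrable.
- exact: measurable_box.
- exact: box_lty.
- exact: (measurable_funTS (plane_continuous_measurable cf)).
- exists C; split; first exact: num_real.
  by move=> c Cc x Nx /=; apply: le_trans (fC x Nx) (ltW Cc).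
Qed.

Lemma locint_sqr f : sqint leb2 f -> locint (fun x => f x ^+ 2).
Proof.
move=> [mf f2]; split=> [|N]; first exact: measurable_funX.
by apply: integrableS f2 => //; exact: measurable_box.
Qed.

Lemma locint_abs_box f N C : locint f ->
  leb2.-integrable setT (EFin \o (fun x => C * `|(f \_ (box N)) x|)).
Proof.
move=> [mf If]; apply: integrable_scale.
rewrite (_ : _ \o _ = (fun x => `|((EFin \o f) \_ (box N)) x|%E)); last first.
  by apply/funext => x /=; rewrite !patchE; case: ifP.
apply: (@integrable_abse _ _ R leb2 setT); apply: (@integrable_restrict _ _ R leb2 _ (measurable_box N) _ measurableT _).1.
by rewrite setTI.
Qed.

Lemma locint_mul f g N C : locint f -> measurable_fun (setT : set PR) g ->
  (forall x, ~ box N x -> g x = 0) -> (forall x, `|g x| <= C) ->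
  leb2.-integrable setT (EFin \o (fun x => g x * f x)).
Proof.
move=> lf mg g0 gC.
apply: (le_integrable measurableT _ _ (locint_abs_box N C lf)).
  by apply/measurable_EFinP; apply: measurable_funM => //; exact: lf.1.
move=> x _; rewrite lee_fin/= normrM patchE; case: ifPn => [_|].
  by rewrite [leRHS]ger0_norm ?ler_wpM2r// mulr_ge0// (le_trans _ (gC x)).
by rewrite notin_setE => /g0 ->; rewrite normr0 mul0r.
Qed.

Definition convol K f x := \int[leb2]_y (K (x - y) * f y).

Lemma supp_shift K M N x y : supp M K -> box N x -> ~ box (N + (M + 1)) y ->
  K (x - y) = 0.
Proof.
move=> sK /box_norm[x1 x2] Ny; apply: sK; rewrite ltNge; apply/negP.
move=> /box_supp/box_norm[/= xy1 xy2]; apply: Ny; apply/box_norm; split.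
  by have := ler_normB x.1 (x.1 - y.1); rewrite opprB addrC subrK; lra.
by have := ler_normB x.2 (x.2 - y.2); rewrite opprB addrC subrK; lra.
Qed.

Lemma continuous_shift K x : continuous K -> continuous (fun y => K (x - y)).
Proof.
move=> cK y; apply: (@continuous_comp _ _ _ (fun y => x - y) K).
  by apply: cvgB; [exact: cvg_cst|exact: cvg_id].
exact: cK.
Qed.

Lemma convol_integrable K f M x : continuous K -> supp M K -> locint f ->
  leb2.-integrable setT (EFin \o (fun y => K (x - y) * f y)).
Proof.
move=> cK sK lf; have [C C0 KC] := supp_bounded cK sK.
have [N N0 Nx] := box_cover x.
apply: (@locint_mul _ (fun y => K (x - y)) (N + (M + 1)) C) => //.
- exact: (plane_continuous_measurable (@continuous_shift K x cK)).
- by move=> y; exact: supp_shift.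
Qed.

Lemma convol_bounded K f M N : continuous K -> supp M K -> locint f ->
  exists C, forall x, box N x -> `|convol K f x| <= C.
Proof.
move=> cK sK lf; have [C C0 KC] := supp_bounded cK sK.
have I := locint_abs_box (N + (M + 1)) C lf.
exists (\int[leb2]_y (C * `|(f \_ (box (N + (M + 1)))) y|)) => x Nx; apply: le_trans (le_normr_Rintegral measurableT (convol_integrable x cK sK lf)) _.
apply: le_Rintegral I _ => //.
  by have := integrable_abse (convol_integrable x cK sK lf).
move=> y _; rewrite normrM patchE; case: ifPn => [_|].
  by rewrite ler_wpM2r.
by rewrite notin_setE => /(supp_shift sK Nx) ->; rewrite normr0 mul0r mulr_ge0.
Qed.

Lemma line_shift x y (h : R) i :
  h *: Defs.basis i + (x - y) = (h *: Defs.basis i + x) - y.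
Proof. by rewrite addrA. Qed.

Lemma box_line x i (h N : R) : box N x -> `|h| < 1 ->
  box (N + 1) (h *: Defs.basis i + x).
Proof.
move=> /box_norm[x1 x2] h1; apply/box_norm.
case: (I2P i) => ->; rewrite ?basis0 ?basis1;
  rewrite -[_ *: (_, _) + x]/(h * _ + x.1, h * _ + x.2) /= !(mulr1, mulr0, add0r).
- by split; [apply: le_trans (ler_normD _ _) _; lra|lra].
- by split; [lra|apply: le_trans (ler_normD _ _) _; lra].
Qed.

Lemma is_derive_line K i z (h : R) : smooth_on setT K ->
  is_derive h 1 (fun t : R => K (t *: Defs.basis i + z))
    (pd i K (h *: Defs.basis i + z)).
Proof.
move=> sK; set w := h *: Defs.basis i + z.
have dK : derivable K w (Defs.basis i) by exact: (smo_derivable i sK).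
have D0 : is_derive ((fun t : R => t - h) h) 1
    (fun t : R => K (t *: Defs.basis i + w)) (pd i K w).
  rewrite /= subrr; apply: DeriveDef; first exact/derivable_line.
  by rewrite /pd derive_line derive1E.
have D1 : is_derive h 1 (fun t : R => t - h) 1.
  by apply: is_derive_eq (is_deriveB (is_derive_id h 1) (is_derive_cst h h 1)) _; rewrite subr0.
have := @is_derive1_comp R _ _ h _ _ D0 D1; rewrite mulr1.
rewrite (_ : _ \o _ = (fun t : R => K (t *: Defs.basis i + z)))//.
by apply/funext => t; rewrite /= /w scalerBl addrA subrK.
Qed.

(** Differentiation under the integral sign puts the derivative on the kernel; for |h| < 1 the
    integrands are dominated by a multiple of |f| restricted to one fixed box. *)
Lemma is_derive_convol K f M i x : smooth_on setT K -> supp M K -> locint f ->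
  is_derive x (Defs.basis i) (convol K f) (convol (pd i K) f x).
Proof.
move=> sK suK lf; have cK : continuous K by move=> z; exact: (smo_continuous sK).
have [N N0 Nx] := box_cover x.
have sdK := smo_pd i sK; have sudK := supp_pd i suK.
have cdK : continuous (pd i K) by move=> z; exact: (smo_continuous sdK).
have [C C0 dKC] := supp_bounded cdK sudK.
pose F (h : R) y := K ((h *: Defs.basis i + x) - y) * f y.
have I01 : `]-1, 1[%classic (0 : R) by rewrite /= in_itv/= ltrN10 ltr01.
have dF (h : R) y : is_derive h 1 (F^~ y) (pd i K ((h *: Defs.basis i + x) - y) * f y).
  have Dl := is_derive_line i (x - y) h sK.
  have Dm := is_deriveM Dl (is_derive_cst (f y) h 1).
  have -> : F^~ y = (fun t : R => K (t *: Defs.basis i + (x - y))) * cst (f y).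
    by apply/funext => t; rewrite /F -line_shift.
  apply: is_derive_eq Dm _.
  by rewrite scaler0 add0r line_shift scaleR_mul mulrC.
have intF h : `]-1, 1[%classic h -> leb2.-integrable setT (EFin \o F h).
  by move=> _; exact: (convol_integrable _ cK suK lf).
have derF (h : R) y : `]-1, 1[%classic h -> setT y -> derivable (F^~ y) h 1.
  by move=> _ _; case: (dF h y).
have bndF h y : `]-1, 1[%classic h -> setT y ->
    `|partial1of2 F h y| <= C * `|(f \_ (box (N + 1 + (M + 1)))) y|.
  rewrite /= in_itv/= -ltr_norml => h1 _; rewrite partial1of2E.
  case: (dF h y) => _ ->; rewrite normrM patchE; case: ifPn => [_|].
    by rewrite ler_wpM2r.
  rewrite notin_setE => /(supp_shift sudK (box_line i Nx h1)) ->.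
  by rewrite normr0 mul0r mulr_ge0.
have G0 y : 0 <= C * `|(f \_ (box (N + 1 + (M + 1)))) y| by rewrite mulr_ge0.
have IG := locint_abs_box (N + 1 + (M + 1)) C lf.
have E : (fun h => convol K f (h *: Defs.basis i + x)) =
  (fun h => \int[leb2]_(y in setT) F h y) by [].
apply: DeriveDef.
  apply/derivable_line; rewrite E.
  exact: (derivable_under_integral measurableT I01 intF derF G0 IG bndF).
rewrite derive_line E.
rewrite (differentiation_under_integral measurableT I01 intF derF G0 IG bndF).
apply: eq_Rintegral => y _; rewrite partial1of2E.
by case: (dF 0 y) => _ ->; rewrite scale0r add0r.
Qed.

(** The mean value theorem along the two sides of an L-shaped path makes f locally Lipschitz.
    Continuity of convolutions and of primitives is thus deduced from their derivatives. *)
Lemma continuous_of_bounded_pd f : (forall i x, derivable f x (Defs.basis i)) ->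
  (forall i N, exists C, forall x, box N x -> `|pd i f x| <= C) -> continuous f.
Proof.
move=> df bf x; apply/plane_continuousP => e e0.
have [N N0 Nx] := box_cover x.
have [C0 H0] := bf 0 (N + 1); have [C1 H1] := bf 1 (N + 1).
pose C := `|C0| + `|C1| + 1.
have C_gt0 : 0 < C by rewrite ltr_wpDl// addr_ge0.
have nearx y : `|y.1 - x.1| < 1 -> `|y.2 - x.2| < 1 -> box (N + 1) y.
  move=> y1 y2; have /box_norm[x1 x2] := Nx; apply/box_norm.
  have := norm_lt_add1 y1; have := norm_lt_add1 y2; lra.
have bC0 y : `|y.1 - x.1| < 1 -> `|y.2 - x.2| < 1 -> `|pd 0 f y| <= C.
  move=> y1 y2; apply: le_trans (H0 y (nearx y y1 y2)) _.
  by have := ler_norm C0; rewrite /C; have := normr_ge0 C1; lra.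
have bC1 y : `|y.1 - x.1| < 1 -> `|y.2 - x.2| < 1 -> `|pd 1 f y| <= C.
  move=> y1 y2; apply: le_trans (H1 y (nearx y y1 y2)) _.
  by have := ler_norm C1; rewrite /C; have := normr_ge0 C0; lra.
exists (Num.min 1 (e / (2 * C))).
  by rewrite lt_min ltr01 divr_gt0// mulr_gt0.
move=> [y1 y2]/=; rewrite !lt_min => /andP[y11 y1e] /andP[y21 y2e].
rewrite ltr_pdivlMr ?mulr_gt0// in y1e; rewrite ltr_pdivlMr ?mulr_gt0// in y2e.
have A : `|f (y1, y2) - f (x.1, y2)| <= C * `|y1 - x.1|.
  apply: (mvt_bound (g := fun s => f (s, y2)) (dg := fun s => pd 0 f (s, y2))) => t.
    by move=> _; exact: is_derive_slice0.
  by move=> ty; apply: bC0 => //=; exact: le_lt_trans ty _.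
have B : `|f (x.1, y2) - f (x.1, x.2)| <= C * `|y2 - x.2|.
  apply: (mvt_bound (g := fun s => f (x.1, s)) (dg := fun s => pd 1 f (x.1, s))) => t.
    by move=> _; exact: is_derive_slice1.
  move=> ty; apply: bC1 => //=; first by rewrite subrr normr0.
  exact: le_lt_trans ty _.
rewrite -surjective_pairing in B.
apply: le_lt_trans (ler_distD (f (x.1, y2)) _ _) _.
apply: le_lt_trans (lerD A B) _.
have hlf u : u * (2 * C) < e -> C * u < e / 2.
  by rewrite ltr_pdivlMr// (mulrC C) -mulrA (mulrC C).
by rewrite [ltRHS]splitr ltrD// hlf.
Qed.

Lemma smo_continuousT f : smooth_on setT f -> continuous f.
Proof. by move=> sf x; exact: (smo_continuous sf). Qed.

Lemma pd_convol K f M i : smooth_on setT K -> supp M K -> locint f ->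
  pd i (convol K f) = convol (pd i K) f.
Proof.
by move=> sK uK lf; apply/funext => x; case: (is_derive_convol i x sK uK lf).
Qed.

Lemma continuous_convol K f M : smooth_on setT K -> supp M K -> locint f ->
  continuous (convol K f).
Proof.
move=> sK uK lf; apply: continuous_of_bounded_pd => i.
  by move=> x; case: (is_derive_convol i x sK uK lf).
move=> N; rewrite (pd_convol i sK uK lf); apply: (convol_bounded (M := M)) => //.
  exact: smo_continuousT (smo_pd i sK).
exact: supp_pd.
Qed.

Lemma smo_convol K f M : smooth_on setT K -> supp M K -> locint f ->
  smooth_on setT (convol K f).
Proof.
move=> sK uK lf n; elim: n K sK uK => [|n IH] K sK uK.
  by split=> // x _; exact: (continuous_convol sK uK lf).
split=> [x _|i]; first exact: (continuous_convol sK uK lf).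
split=> [x _|]; first by case: (is_derive_convol i x sK uK lf).
by rewrite (pd_convol i sK uK lf); apply: IH; [exact: smo_pd|exact: supp_pd].
Qed.

Lemma eq0_pd0 f : (forall i x, is_derive x (Defs.basis i) f 0) ->
  forall x, f x = f 0.
Proof.
move=> df x; apply/eqP; rewrite -subr_eq0 -normr_le0.
have df0 i y : derivable f y (Defs.basis i) by case: (df i y).
have d0 i y : pd i f y = 0 by case: (df i y).
have A : `|f (x.1, x.2) - f (0, x.2)| <= 0 * `|x.1 - 0|.
  apply: (mvt_bound (g := fun s => f (s, x.2)) (dg := fun s => pd 0 f (s, x.2))) => t _.
    exact: is_derive_slice0.
  by rewrite d0 normr0.
have B : `|f (0, x.2) - f (0, 0)| <= 0 * `|x.2 - 0|.
  apply: (mvt_bound (g := fun s => f (0, s)) (dg := fun s => pd 1 f (0, s))) => t _.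
    exact: is_derive_slice1.
  by rewrite d0 normr0.
rewrite mul0r in A; rewrite mul0r in B.
rewrite [x in f x]surjective_pairing; apply: le_trans (ler_distD (f (0, x.2)) _ _) _.
by rewrite -[leRHS]addr0 lerD.
Qed.

Lemma integral_pd_reflect K M i z : smooth_on setT K -> supp M K ->
  \int[leb2]_y pd i K (z - y) = 0.
Proof.
move=> sK uK.
have sr := smo_reflect z sK.
have cdr := smo_continuousT (smo_pd i sr).
(* This radius comes from |y|^2 <= 2 |z - y|^2 + 2 |z|^2, the difference of the two sides being |2 z
   - y|^2. *)
have ur : supp (2 * M + 2 * sqnorm z) (fun y => K (z - y)).
  move=> y yM; apply: uK; rewrite ltNge; apply/negP; move: yM.
  rewrite /sqnorm /= ltNge => /negP + H; apply.
  have := sqr_ge0 (2 * z.1 - y.1); have := sqr_ge0 (2 * z.2 - y.2); nra.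
transitivity (\int[leb2]_y (-1 * pd i (fun y => K (z - y)) y)).
  by apply: eq_Rintegral => y _; rewrite mulN1r pd_reflect// opprK.
rewrite RintegralZl//; last exact: (integrable_supp cdr (supp_pd i ur)).
by rewrite (integral_pd0 _ cdr ur) ?mulr0// => y; exact: (smo_derivable i sr).
Qed.

(** As a function of x the left side is the convolution of K with 1, and its gradient vanishes
    because derivatives of K have integral 0. This gives translation invariance without a change of
    variables. *)
Lemma integral_reflect K M x : smooth_on setT K -> supp M K ->
  \int[leb2]_y K (x - y) = \int[leb2]_y K (0 - y).
Proof.
move=> sK uK.
have l1 : locint (cst 1) by apply: continuous_locint => y; exact: cvg_cst.
have E K' z : \int[leb2]_y K' (z - y) = convol K' (cst 1) z.
  by apply: eq_Rintegral => y _; rewrite mulr1.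
rewrite !E; apply: eq0_pd0 => i z.
apply: is_derive_eq (is_derive_convol i z sK uK l1) _.
by rewrite -E (integral_pd_reflect i z sK uK).
Qed.

End Convolution.

(** * Mollifiers and Weyl's lemma *)

(** By Tonelli the integration in x can be done first, and then only sees the mass of k(., y), which
    is 1. *)
Lemma schur_sqr_le d (T : measurableType d) (R : realType)
    (m : {sigma_finite_measure set T -> \bar R}) (k : T * T -> R) (f g : T -> R) :
  measurable_fun setT k -> (forall z, 0 <= k z) ->
  measurable_fun setT f -> measurable_fun setT g ->
  (forall y, (\int[m]_x (k (x, y))%:E = 1)%E) ->
  (forall x, ((g x ^+ 2)%:E <= \int[m]_y (k (x, y) * f y ^+ 2)%:E)%E) ->
  (\int[m]_x (g x ^+ 2)%:E <= \int[m]_y (f y ^+ 2)%:E)%E.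
Proof.
move=> mk k0 mf mg k1 gk.
pose H z := (k z * f z.2 ^+ 2)%:E.
have mH : measurable_fun setT H.
  apply/measurable_EFinP; apply: measurable_funM => //.
  by apply: measurable_funX; apply: measurableT_comp.
have H0 z : (0 <= H z)%E by rewrite lee_fin mulr_ge0 ?sqr_ge0.
apply: (@le_trans _ _ (\int[m]_x \int[m]_y H (x, y))%E).
  apply: ge0_le_integral => //.
  - by move=> x _; rewrite lee_fin sqr_ge0.
  - by apply/measurable_EFinP; exact: measurable_funX.
  - exact: (measurable_fun_fubini_tonelli_F H mH H0).
rewrite (fubini_tonelli H mH H0) /fubini_G le_eqVlt; apply/orP; left; apply/eqP.
apply: eq_integral => y _; rewrite /H/=.
under eq_integral do rewrite mulrC EFinM.
rewrite ge0_integralZl_EFin ?sqr_ge0//; last 2 first.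
- by move=> x _; rewrite lee_fin.
- by apply/measurable_EFinP; exact: (measurableT_comp mk (pair2_measurable y)).
by rewrite k1 mule1.
Qed.

Section PlaneSigmaFinite.
Context {R : realType}.
Local Notation leb2 := (@lebesgue_measure R \x @lebesgue_measure R)%E.
Local Notation PR := (measurableTypeR R * measurableTypeR R)%type.

(* The measure [leb2] is given a sigma-finite structure through this alias. *)
Definition plane_measure : set PR -> \bar R := leb2.
HB.instance Definition _ := Measure.copy plane_measure leb2.

Lemma plane_sigma_finite : sigma_finite setT plane_measure.
Proof.
exists (fun n => box n%:R).
  apply/esym/seteqP; split=> // x _; have [N N0 /box_norm[x1 x2]] := box_cover x.
  exists (Num.trunc N).+1 => //; apply/box_norm.
  have NN := ltW (truncnS_gt N).
  by split; apply: le_trans NN.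
by move=> n; split; [exact: measurable_box|exact: box_lty].
Qed.

HB.instance Definition _ := @Measure_isSigmaFinite.Build _ _ _ plane_measure
  plane_sigma_finite.

End PlaneSigmaFinite.

(** * Mollifying kernels and their dependence on the radius *)

Section Mollifier.
Context {R : realType}.
Local Notation leb2 := (@lebesgue_measure R \x @lebesgue_measure R)%E.
Local Notation PR := (measurableTypeR R * measurableTypeR R)%type.
Implicit Types (U V : set (R * R)) (f g K : R * R -> R) (i j : 'I_2) (x y z : R * R).

(** Expanding the integral of K(x - y) (f(y) - c)^2 >= 0 with c = [convol K f x] gives Jensen's
    inequality; [schur_sqr_le] then integrates it in x. *)
Lemma sqint_convol K f M : smooth_on setT K -> supp M K -> (forall z, 0 <= K z) ->
  (forall z, K (- z) = K z) -> (forall x, \int[leb2]_y K (x - y) = 1) ->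
  sqint leb2 f ->
  sqint leb2 (convol K f) /\ ip leb2 (convol K f) (convol K f) <= ip leb2 f f.
Proof.
move=> sK uK K0 Ke K1 If.
have lf := sqint_locint If; have lf2 := locint_sqr If.
have cK := smo_continuousT sK.
have cc := continuous_convol sK uK lf.
have l1 : locint (cst 1 : R * R -> R) by apply: continuous_locint => y; exact: cvg_cst.
have IK x : leb2.-integrable setT (EFin \o (fun y => K (x - y))).
  have := convol_integrable x cK uK l1.
  by rewrite (_ : (fun y => _) = (fun y => K (x - y)))//; apply/funext => y; rewrite mulr1.
have jensen x : convol K f x ^+ 2 <= convol K (fun y => f y ^+ 2) x.
  set c := convol K f x.
  have I1 := convol_integrable x cK uK lf; have I2 := convol_integrable x cK uK lf2.
  have : 0 <= \int[leb2]_y (K (x - y) * (f y - c) ^+ 2).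
    by apply: Rintegral_ge0 => y _; rewrite mulr_ge0 ?sqr_ge0.
  rewrite (_ : \int[leb2]_y _ = \int[leb2]_y
      (K (x - y) * f y ^+ 2 + ((- 2 * c) * (K (x - y) * f y) + c ^+ 2 * K (x - y)))).
    rewrite RintegralD//.
    - rewrite RintegralD//; [|exact: integrable_scale|exact: integrable_scale].
      rewrite !RintegralZl// K1 -/(convol K f x) -/c -/(convol K _ x).
      by lra.
    - by apply: integrable_add; exact: integrable_scale.
  by apply: eq_Rintegral => y _; ring.
have Kxy : measurable_fun (setT : set (PR * PR)) (fun z : PR * PR => K (z.1 - z.2)).
  pose S (z : PR * PR) : PR := (z.1.1 - z.2.1, z.1.2 - z.2.2).
  have mS : measurable_fun setT S.
    by apply: measurable_fun_pair; apply: measurable_funB;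
      do ?apply: measurableT_comp => //.
  exact: (measurableT_comp (plane_continuous_measurable cK) mS).
have mc : measurable_fun (setT : set PR) (convol K f) := plane_continuous_measurable cc.
have key : (\int[leb2]_x ((convol K f x) ^+ 2)%:E <= \int[leb2]_y (f y ^+ 2)%:E)%E.
  apply: (@schur_sqr_le _ PR R plane_measure (fun z : PR * PR => K (z.1 - z.2))) => //.
  - exact: If.1.
  - move=> y.
    (* Evenness of the kernel exchanges the mass in x, needed here, with the mass in y, which is
       given. *)
    rewrite (_ : (fun x => _) = (fun x => (K (y - x))%:E)); last first.
      by apply/funext => x /=; rewrite -Ke opprB.
    have := congr1 EFin (K1 y); rewrite /Rintegral fineK//.
    exact: (integrable_fin_num measurableT (IK y)).
  - move=> x; have I2 := convol_integrable x cK uK lf2.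
    rewrite (_ : (\int[leb2]_y _)%E = (convol K (fun y => f y ^+ 2) x)%:E).
      by rewrite lee_fin.
    by rewrite /convol /Rintegral fineK//; exact: (integrable_fin_num measurableT I2).
have Ic : sqint leb2 (convol K f).
  split=> //; apply/integrableP; split.
    by apply/measurable_EFinP; exact: measurable_funX.
  under eq_integral do rewrite gee0_abs ?lee_fin ?sqr_ge0//.
  by apply: le_lt_trans key _; rewrite -ip_EFin// ltry.
by split=> //; rewrite -lee_fin !ip_EFin.
Qed.

(* The derivative [dmker e] of [mker e] in [e] is the Laplacian of a multiple of
   the compactly supported function [mpot e], by [lap_mpot]: convolving a weakly
   harmonic function with [mker e] gives a result independent of [e]. *)
Definition mker (e : R) z : R := e^-1 ^+ 2 * flat 'X^2 (1 - e^-1 ^+ 2 * sqnorm z).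
Definition mpot (e : R) z : R := flat 1 (1 - e^-1 ^+ 2 * sqnorm z).
Definition dmker (e : R) z : R := - 2 * e^-1 ^+ 3 * flat 'X^2 (1 - e^-1 ^+ 2 * sqnorm z)
  + 2 * sqnorm z * e^-1 ^+ 5 * flat (dflat 'X^2) (1 - e^-1 ^+ 2 * sqnorm z).
Definition lap f x : R := pd 0 (pd 0 f) x + pd 1 (pd 1 f) x.

Lemma smo_lap f : smooth_on setT f -> smooth_on setT (lap f).
Proof. by move=> sf; apply: smoD; [exact: openT|exact/smo_pd/smo_pd..]. Qed.

Lemma supp_lap M f : supp M f -> supp M (lap f).
Proof.
move=> uf x Mx; rewrite /lap (supp_pd 0 (supp_pd 0 uf))//.
by rewrite (supp_pd 1 (supp_pd 1 uf))// addr0.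
Qed.

Lemma smo_arg (e : R) : smooth_on setT (fun z => 1 - e^-1 ^+ 2 * sqnorm z).
Proof.
by apply: smoB; [exact: openT|exact: smo_cst|apply: smoZ; [exact: openT|exact: (smo_sqnorm openT)]].
Qed.

Lemma smo_mker e : smooth_on setT (mker e).
Proof. by apply: smoZ; [exact: openT|apply: smo_flat; [exact: openT|exact: smo_arg]]. Qed.

Lemma smo_mpot e : smooth_on setT (mpot e).
Proof. by apply: smo_flat; [exact: openT|exact: smo_arg]. Qed.

Lemma arg_le0 (e : R) z : 0 < e -> e ^+ 2 < sqnorm z -> 1 - e^-1 ^+ 2 * sqnorm z <= 0.
Proof.
move=> e0 ez; rewrite subr_le0 exprVn mulrC ler_pdivlMr ?exprn_gt0// mul1r.
exact: ltW.
Qed.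

Lemma supp_mker e : 0 < e -> supp (e ^+ 2) (mker e).
Proof. by move=> e0 z ez; rewrite /mker flat_le0 ?mulr0// arg_le0. Qed.

Lemma supp_mpot e : 0 < e -> supp (e ^+ 2) (mpot e).
Proof. by move=> e0 z ez; rewrite /mpot flat_le0// arg_le0. Qed.

Lemma supp_dmker e : 0 < e -> supp (e ^+ 2) (dmker e).
Proof. by move=> e0 z ez; rewrite /dmker !flat_le0 ?mulr0 ?addr0// arg_le0. Qed.

Lemma is_derive_arg (e : R) i z :
  is_derive z (Defs.basis i) (fun z => 1 - e^-1 ^+ 2 * sqnorm z)
    (- (e^-1 ^+ 2 * (2 * crd i z))).
Proof.
have D := is_deriveB (is_derive_cst (1 : R) z (Defs.basis i))
  (is_deriveZ (e^-1 ^+ 2) (is_derive_sqnorm i z)).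
by apply: is_derive_eq D _; rewrite sub0r scaleR_mul.
Qed.

Lemma is_derive_flat_arg (e : R) p i z :
  is_derive z (Defs.basis i) (fun z => flat p (1 - e^-1 ^+ 2 * sqnorm z))
    (flat (dflat p) (1 - e^-1 ^+ 2 * sqnorm z) * - (e^-1 ^+ 2 * (2 * crd i z))).
Proof.
have [Da <-] := is_derive_arg e i z.
exact: (is_derive_comp (is_derive_flat p _) Da).
Qed.

Lemma pd_mpot e i : pd i (mpot e) =
  fun z => - 2 * e^-1 ^+ 2 * (crd i z * flat 'X^2 (1 - e^-1 ^+ 2 * sqnorm z)).
Proof.
apply/funext => z; have [_ E] := is_derive_flat_arg e 1 i z.
by rewrite /pd /mpot E /dflat derivC subr0 mulr1; ring.
Qed.

(** With phi = [flat 1], both sides combine phi' and |z|^2 phi''. The coefficients of phi' agree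
    because the weight e^-2 of [mker] has the dimension, 2, as its exponent. *)
Lemma lap_mpot e z : 0 < e -> lap (mpot e) z = 2 * e * dmker e z.
Proof.
move=> e0; have D i : pd i (pd i (mpot e)) z =
    - 2 * e^-1 ^+ 2 * (flat 'X^2 (1 - e^-1 ^+ 2 * sqnorm z) +
     crd i z * (flat (dflat 'X^2) (1 - e^-1 ^+ 2 * sqnorm z) *
      - (e^-1 ^+ 2 * (2 * crd i z)))).
  rewrite pd_mpot.
  have Dm := is_deriveZ (- 2 * e^-1 ^+ 2)
    (is_deriveM (is_derive_crd i z (Defs.basis i)) (is_derive_flat_arg e 'X^2 i z)).
  have [_ E] := Dm; rewrite /pd; apply: etrans E _.
  have -> : crd i (Defs.basis i : R * R) = 1 by case: (I2P i) => ->.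
  by rewrite !scaleR_mul; ring.
rewrite /lap !D /dmker sqnormE; field.
by rewrite gt_eqF.
Qed.

Lemma is_derive_mker (e : R) z : 0 < e -> is_derive e 1 (mker^~ z) (dmker e z).
Proof.
move=> e0.
have Dv : is_derive e 1 (fun t : R => t^-1) (- e^-2).
  apply: is_derive_eq (is_deriveV _ (is_derive_id e 1)) _; first by rewrite gt_eqF.
  by rewrite scaleR_mul mulr1.
have D2 := is_deriveM Dv Dv.
have D3 := is_deriveB (is_derive_cst (1 : R) e 1) (is_deriveM D2 (is_derive_cst (sqnorm z) e 1)).
have D4 := is_derive1_comp (is_derive_flat 'X^2 _) D3.
have := is_deriveM D2 D4.
have -> : mker^~ z = (fun t : R => t^-1) * (fun t : R => t^-1) * (flat 'X^2 \o
    (cst 1 - (fun t : R => t^-1) * (fun t : R => t^-1) * cst (sqnorm z))).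
  by apply/funext => t; rewrite /mker !expr2.
move/is_derive_eq; apply.
rewrite !scaleR_mul /dmker /= !fctE /cst/= -exprVn !expr2.
by move: e^-1 => w; ring.
Qed.

Lemma flat_bounded p : exists2 C : R, 0 <= C & forall t, t <= 1 -> `|flat p t| <= C.
Proof.
have [C C0 H] := flat_bound p; exists C => // t t1.
have [t0|t0] := leP t 0; first by rewrite flat_le0// normr0.
by rewrite (le_trans (H t t1))// ler_piMr// expr_le1// ltW.
Qed.

(** On the support |z|^2 <= e^2, so that |z|^2 e^-5 <= e^-3 <= u^-3. *)
Lemma dmker_bounded (u : R) : 0 < u ->
  exists2 C : R, 0 <= C & forall e z, u < e -> `|dmker e z| <= C.
Proof.
move=> u0; have [C1 C10 H1] := flat_bounded 'X^2.
have [C2 C20 H2] := flat_bounded (dflat 'X^2).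
exists (2 * u^-1 ^+ 3 * (C1 + C2)) => [|e z ue].
  by apply: mulr_ge0; rewrite ?addr_ge0// mulr_ge0// exprn_ge0// invr_ge0 ltW.
have e0 : 0 < e by exact: lt_trans ue.
have ei0 : 0 <= e^-1 by rewrite invr_ge0 ltW.
have [ez|ez] := ltP (e ^+ 2) (sqnorm z).
  rewrite supp_dmker// normr0; apply: mulr_ge0; rewrite ?addr_ge0// mulr_ge0//.
  by rewrite exprn_ge0// invr_ge0 ltW.
have e3 : e^-1 ^+ 3 <= u^-1 ^+ 3 by rewrite lerXn2r ?nnegrE ?invr_ge0 ?ltW// ltf_pV2.
have t1 : 1 - e^-1 ^+ 2 * sqnorm z <= 1.
  by rewrite gerBl mulr_ge0 ?sqr_ge0 ?sqnorm_ge0.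
have e5 : sqnorm z * e^-1 ^+ 5 <= e^-1 ^+ 3.
  rewrite (_ : 5%N = (2 + 3)%N)// exprD mulrA ler_piMl ?exprn_ge0//.
  by rewrite exprVn ler_pdivrMr ?exprn_gt0// mul1r.
have s0 := sqnorm_ge0 z.
rewrite /dmker (le_trans (ler_normD _ _))// [leRHS]mulrDr lerD//.
  have p0 : 0 <= 2 * e^-1 ^+ 3 by rewrite mulr_ge0// exprn_ge0.
  rewrite !mulNr normrN normrM [`|2 * _|]ger0_norm//.
  by apply: ler_pM => //; [rewrite ler_wpM2l|exact: H1].
have p0 : 0 <= 2 * sqnorm z * e^-1 ^+ 5 by rewrite mulr_ge0 ?exprn_ge0// mulr_ge0.
rewrite normrM [`|2 * _ * _|]ger0_norm//.
apply: ler_pM => //; last exact: H2.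
by rewrite -mulrA ler_wpM2l// (le_trans e5).
Qed.

(** This plays the part of the mean value property: the derivative in e of the convolution is the
    pairing of f with a multiple of the Laplacian of [mpot], which vanishes. *)
Lemma mker_convol_const f x (r : R) : locint f ->
  (forall e, 0 < e < r -> \int[leb2]_y (lap (mpot e) (x - y) * f y) = 0) ->
  forall e e', 0 < e -> e < e' -> e' < r -> convol (mker e) f x = convol (mker e') f x.
Proof.
move=> lf lapf e e' e0 ee' e'r.
have [N N0 Nx] := box_cover x.
(* The open interval from u to r contains [e, e'] and stays away from 0, where [dmker] is
   unbounded. *)
pose u := e / 2; have u0 : 0 < u by rewrite divr_gt0.
have ue : u < e by rewrite /u; lra.
have [C C0 dC] := dmker_bounded u0.
have cmk t : continuous (mker t) := smo_continuousT (smo_mker t).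
have D (t : R) : u < t < r -> is_derive t 1 (fun s => convol (mker s) f x) 0.
  move=> /andP[ut tr]; have t0 : 0 < t by exact: lt_trans ut.
  pose F (s : R) y := mker s (x - y) * f y.
  have Iut : `]u, r[%classic t by rewrite /= in_itv/= ut tr.
  have pos s : `]u, r[%classic s -> 0 < s.
    by rewrite /= in_itv/= => /andP[us _]; exact: lt_trans us.
  have intF s : `]u, r[%classic s -> leb2.-integrable setT (EFin \o F s).
    by move=> /pos s0; exact: (convol_integrable _ (cmk s) (supp_mker s0) lf).
  have dF (s : R) y : 0 < s -> is_derive s 1 (F^~ y) (dmker s (x - y) * f y).
    move=> s0; have Dm := is_deriveM (is_derive_mker (x - y) s0) (is_derive_cst (f y) s 1).
    by apply: is_derive_eq Dm _; rewrite scaler0 add0r scaleR_mul mulrC.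
  have derF (s : R) y : `]u, r[%classic s -> setT y -> derivable (F^~ y) s 1.
    by move=> /pos s0 _; case: (dF s y s0).
  have bndF (s : R) y : `]u, r[%classic s -> setT y ->
      `|partial1of2 F s y| <= C * `|(f \_ (box (N + (r ^+ 2 + 1)))) y|.
    move=> Is _; have s0 := pos s Is; rewrite partial1of2E; case: (dF s y s0) => _ ->.
    move: Is; rewrite /= in_itv/= => /andP[us sr].
    rewrite normrM patchE; case: ifPn => [_|].
      by rewrite ler_wpM2r ?dC.
    rewrite notin_setE => ny; rewrite (@supp_shift _ (dmker s) (r ^+ 2) N)//.
      by rewrite normr0 mul0r mulr_ge0.
    move=> z rz; apply: supp_dmker => //; apply: le_lt_trans rz.
    by rewrite lerXn2r ?nnegrE ?ltW// (lt_trans s0).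
  have G0 y : 0 <= C * `|(f \_ (box (N + (r ^+ 2 + 1)))) y| by rewrite mulr_ge0.
  have IG := locint_abs_box (N + (r ^+ 2 + 1)) C lf.
  apply: DeriveDef.
    exact: (derivable_under_integral measurableT Iut intF derF G0 IG bndF).
  rewrite -derive1E.
  rewrite (differentiation_under_integral measurableT Iut intF derF G0 IG bndF).
  transitivity (\int[leb2]_y ((2 * t)^-1 * (lap (mpot t) (x - y) * f y))).
    apply: eq_Rintegral => y _; rewrite partial1of2E; case: (dF t y t0) => _ ->.
    by rewrite lap_mpot// -[2 * t * _ * _]mulrA mulKf// gt_eqF// mulr_gt0.
  rewrite RintegralZl//; first by rewrite lapf ?t0// mulr0.
  have cl := smo_continuousT (smo_lap (smo_mpot t)).
  exact: (convol_integrable x cl (supp_lap (supp_mpot t0)) lf).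
have De t : e <= t <= e' -> is_derive t 1 (fun s => convol (mker s) f x) ((fun=> 0) t).
  move=> /andP[et te']; apply: D.
  by rewrite (lt_le_trans ue et) (le_lt_trans te' e'r).
have [c _] := mvt_exists ee' De.
by move=> E; apply/esym/subr0_eq; rewrite E mul0r.
Qed.

End Mollifier.

(** * L^2 norms and convergence of mollifications *)

Section L2Plane.
Context {R : realType}.
Local Notation leb := (@lebesgue_measure R).
Local Notation leb2 := (@lebesgue_measure R \x @lebesgue_measure R)%E.
Local Notation PR := (measurableTypeR R * measurableTypeR R)%type.
Implicit Types (U V : set (R * R)) (f g h K : R * R -> R) (i j : 'I_2) (x y z : R * R).

Definition l2n f : R := snorm (ip leb2) f.

Lemma l2n_ge0 f : 0 <= l2n f. Proof. exact: sqrtr_ge0. Qed.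

Lemma l2n_sqr f : l2n f ^+ 2 = ip leb2 f f.
Proof. by rewrite sqr_sqrtr// ip_ge0. Qed.

Let ipC' f g : sqint leb2 f -> sqint leb2 g -> ip leb2 f g = ip leb2 g f.
Proof. by move=> _ _; exact: ipC. Qed.

Lemma l2_cauchy_schwarz f g : sqint leb2 f -> sqint leb2 g ->
  `|ip leb2 f g| <= l2n f * l2n g.
Proof.
apply: (semi_cauchy_schwarz (S := sqint leb2)) => //.
- by move=> k u v Iu Iv; exact: sqintDZ.
- by move=> k u v w Iu Iv Iw; exact: ipDZ.
- by move=> u _; exact: ip_ge0.
Qed.

Lemma l2nD f g : sqint leb2 f -> sqint leb2 g -> l2n (f + g) <= l2n f + l2n g.
Proof.
apply: (snormD (S := sqint leb2)) => //.
- by move=> k u v Iu Iv; exact: sqintDZ.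
- by move=> k u v w Iu Iv Iw; exact: ipDZ.
- by move=> u _; exact: ip_ge0.
Qed.

Lemma sqintB f g : sqint leb2 f -> sqint leb2 g -> sqint leb2 (f - g).
Proof. by move=> If Ig; rewrite addrC -scaleN1r; exact: sqintDZ. Qed.

Lemma sqintD f g : sqint leb2 f -> sqint leb2 g -> sqint leb2 (f + g).
Proof. by move=> If Ig; rewrite -[f]scale1r; exact: sqintDZ. Qed.

Lemma l2n_distC f g : l2n (f - g) = l2n (g - f).
Proof.
congr Num.sqrt; apply: eq_Rintegral => x _.
by rewrite !fctE -(opprB (g x)) mulrNN.
Qed.

Lemma l2n_dist f g h : sqint leb2 f -> sqint leb2 g -> sqint leb2 h ->
  l2n (f - h) <= l2n (f - g) + l2n (g - h).
Proof.
move=> If Ig Ih.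
have -> : f - h = (f - g) + (g - h) by rewrite addrA subrK.
by apply: l2nD; exact: sqintB.
Qed.

Lemma ip_le f g : sqint leb2 f -> sqint leb2 g -> (forall x, f x ^+ 2 <= g x ^+ 2) ->
  ip leb2 f f <= ip leb2 g g.
Proof.
move=> If Ig fg; apply: le_Rintegral => //; [exact: sqint_mul|exact: sqint_mul|].
by move=> x _; rewrite -!expr2.
Qed.

Lemma ip_box_bound h N C : measurable_fun (setT : set PR) h ->
  (forall x, `|h x| <= C) -> (forall x, ~ box N x -> h x = 0) ->
  sqint leb2 h /\ ip leb2 h h <= C ^+ 2 * fine (leb2 (box N)).
Proof.
move=> mh hC h0; have mB := measurable_box N.
have C0 : 0 <= C := le_trans (normr_ge0 _) (hC 0).
have I : leb2.-integrable setT (EFin \o (cst (C ^+ 2) \_ (box N))).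
  rewrite -restrict_EFin; apply: (@integrable_restrict _ _ R leb2 _ mB _ measurableT _).1.
  rewrite setTI; apply: measurable_bounded_integrable => //; [exact: box_lty|exact: bounded_cst].
have le x : h x ^+ 2 <= (cst (C ^+ 2) \_ (box N)) x.
  rewrite patchE; case: ifPn => [_|].
    by rewrite -[h x ^+ 2]real_normK ?num_real// lerXn2r ?nnegrE.
  by rewrite notin_setE => /h0 ->; rewrite expr0n.
have Ih : sqint leb2 h.
  split=> //; apply: (le_integrable measurableT _ _ I).
    by apply/measurable_EFinP; exact: measurable_funX.
  move=> x _ /=; rewrite lee_fin ger0_norm ?sqr_ge0//.
  exact: le_trans (le x) (ler_norm _).
split=> //; apply: (@le_trans _ _ (\int[leb2]_x (cst (C ^+ 2) \_ (box N)) x)).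
  apply: le_Rintegral => //; first exact: sqint_mul.
  by move=> x _; rewrite -expr2.
by rewrite -Rintegral_mkcond Rintegral_cst.
Qed.

Lemma convolB K f g M : continuous K -> supp M K -> locint f -> locint g ->
  convol K (f - g) = convol K f - convol K g.
Proof.
move=> cK uK lf lg; apply/funext => x; rewrite /convol -[RHS]/(_ - _).
rewrite -RintegralB//; [|exact: (convol_integrable x cK uK lf)|exact: (convol_integrable x cK uK lg)].
by apply: eq_Rintegral => y _; rewrite !fctE mulrBr.
Qed.

Definition mass : R := \int[leb2]_y mker 1 (0 - y).

Lemma mker_ge0 (e : R) z : 0 <= mker e z.
Proof. by rewrite mulr_ge0 ?sqr_ge0// flatX2_ge0. Qed.

Lemma sqnormN z : sqnorm (- z) = sqnorm z.
Proof. by rewrite /sqnorm /= !sqrrN. Qed.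

Lemma sqnorm_half z : box (1 / 2) z -> sqnorm z <= 1 / 2.
Proof.
move=> /box_norm[z1 z2]; rewrite /sqnorm.
rewrite -[z.1 ^+ 2]real_normK ?num_real// -[z.2 ^+ 2]real_normK ?num_real//.
have := normr_ge0 z.1; have := normr_ge0 z.2; nra.
Qed.

Lemma mass_gt0 : 0 < mass.
Proof.
(* On the box of half-side 1/2 the argument t = 1 - |z|^2 lies between 1/2 and 1, hence t^-2
   exp(-1/t) >= exp(-2). *)
pose c : R := expR (- 2).
have c0 : 0 < c by exact: expR_gt0.
have mB := @measurable_box R (1 / 2).
have I : leb2.-integrable setT (EFin \o (cst c \_ (box (1 / 2)))).
  rewrite -restrict_EFin; apply: (@integrable_restrict _ _ R leb2 _ mB _ measurableT _).1.
  rewrite setTI; apply: measurable_bounded_integrable => //; [exact: box_lty|exact: bounded_cst].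
have sm := smo_reflect 0 (@smo_mker R 1).
have um : supp 1 (fun y => mker 1 (0 - y)).
  by move=> y y1; apply: supp_mker => //; rewrite sub0r sqnormN expr1n.
apply: (@lt_le_trans _ _ (\int[leb2]_x (cst c \_ (box (1 / 2))) x)).
  rewrite -Rintegral_mkcond Rintegral_cst// mulr_gt0//.
  have E1 : (leb2 (box (1 / 2)) = 1)%E.
    rewrite /box product_measure1E; [|exact: measurable_itv..].
    have L1 : (leb `[(- (1 / 2))%R, (1 / 2)%R] = 1)%E.
      rewrite lebesgue_measure_itv/= lte_fin ifT; last by lra.
      by rewrite -EFinB; congr EFin; lra.
    by transitivity (1 * 1 : \bar R)%E; [congr (_ * _)%E; exact: L1|rewrite mule1].
  have : 0 < fine (leb2 (box (1 / 2))) by rewrite E1.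
  exact.
apply: le_Rintegral => //; first exact: (integrable_supp (smo_continuousT sm) um).
move=> x _; rewrite patchE; case: ifPn => [|_]; last exact: mker_ge0.
move=> /set_mem /sqnorm_half xh; rewrite sub0r /mker sqnormN invr1 expr1n !mul1r.
have s0 := sqnorm_ge0 x.
have t0 : 0 < 1 - sqnorm x by lra.
rewrite /flat t0 hornerXn /cst -[leLHS]mul1r; apply: ler_pM => //.
- exact: ltW.
- by rewrite exprn_ege1// invf_ge1//; lra.
- rewrite ler_expR lerN2 invf_ple ?posrE//; lra.
Qed.

(** The constant 1 is weakly harmonic, so [mker_convol_const] makes the mass independent of e,
    without a change of scale in the integral. *)
Lemma mass_mker (e : R) x : 0 < e -> \int[leb2]_y mker e (x - y) = mass.
Proof.
move=> e0; rewrite (integral_reflect x (@smo_mker R e) (supp_mker e0)).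
have l1 : locint (cst 1 : R * R -> R) by apply: continuous_locint => y; exact: cvg_cst.
have E K' z : \int[leb2]_y K' (z - y) = convol K' (cst 1) z.
  by apply: eq_Rintegral => y _; rewrite mulr1.
have lap0 (r t : R) : 0 < t < r -> \int[leb2]_y (lap (mpot t) (0 - y) * cst 1 y) = 0.
  move=> /andP[t0 _]; under eq_Rintegral do rewrite mulr1.
  have s i := smo_pd i (@smo_mpot R t); have u i := supp_pd i (@supp_mpot R t t0).
  rewrite /lap RintegralD//.
  - rewrite -[RHS]addr0; congr (_ + _).
      exact: (integral_pd_reflect 0 0 (s 0) (u 0)).
    exact: (integral_pd_reflect 1 0 (s 1) (u 1)).
  - have := convol_integrable 0 (smo_continuousT (smo_pd 0 (s 0))) (supp_pd 0 (u 0)) l1.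
    by under [X in _ \o X]eq_fun do rewrite mulr1.
  - have := convol_integrable 0 (smo_continuousT (smo_pd 1 (s 1))) (supp_pd 1 (u 1)) l1.
    by under [X in _ \o X]eq_fun do rewrite mulr1.
rewrite /mass !E; have [e1|e1|->//] := ltgtP e 1.
- by apply: (@mker_convol_const _ _ 0 2 l1 (lap0 2)) => //; lra.
- by apply/esym; apply: (@mker_convol_const _ _ 0 (e + 1) l1 (lap0 (e + 1))) => //; lra.
Qed.

Definition nmk (e : R) z := mass^-1 * mker e z.

Lemma smo_nmk e : smooth_on setT (nmk e).
Proof. by apply: smoZ; [exact: openT|exact: smo_mker]. Qed.

Lemma supp_nmk e : 0 < e -> supp (e ^+ 2) (nmk e).
Proof. by move=> e0 z ez; rewrite /nmk supp_mker ?mulr0. Qed.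

Lemma nmk_ge0 e z : 0 <= nmk e z.
Proof. by rewrite mulr_ge0 ?mker_ge0// invr_ge0 ltW// mass_gt0. Qed.

Lemma nmkN e z : nmk e (- z) = nmk e z.
Proof. by rewrite /nmk /mker sqnormN. Qed.

Lemma mker_integrable (e : R) x : 0 < e ->
  leb2.-integrable setT (EFin \o (fun y => mker e (x - y))).
Proof.
move=> e0.
have l1 : locint (cst 1 : R * R -> R) by apply: continuous_locint => y; exact: cvg_cst.
have := convol_integrable x (smo_continuousT (@smo_mker R e)) (supp_mker e0) l1.
by under [X in _ \o X]eq_fun do rewrite mulr1.
Qed.

Lemma mass_nmk (e : R) x : 0 < e -> \int[leb2]_y nmk e (x - y) = 1.
Proof.
move=> e0; rewrite /nmk RintegralZl//; last exact: mker_integrable.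
by rewrite mass_mker// mulVf// gt_eqF// mass_gt0.
Qed.

Definition mol (e : R) f := convol (nmk e) f.

Lemma sqint_mol e f : 0 < e -> sqint leb2 f -> sqint leb2 (mol e f).
Proof.
move=> e0 If; apply: (sqint_convol (smo_nmk e) (supp_nmk e0) _ _ _ If).1.
- exact: nmk_ge0.
- exact: nmkN.
- by move=> x; exact: mass_nmk.
Qed.

Lemma l2n_mol e f : 0 < e -> sqint leb2 f -> l2n (mol e f) <= l2n f.
Proof.
move=> e0 If; rewrite ler_sqrt ?ip_ge0//.
apply: (sqint_convol (smo_nmk e) (supp_nmk e0) _ _ _ If).2.
- exact: nmk_ge0.
- exact: nmkN.
- by move=> x; exact: mass_nmk.
Qed.

Lemma molB e f g : 0 < e -> locint f -> locint g -> mol e (f - g) = mol e f - mol e g.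
Proof. by move=> e0; exact: (convolB (smo_continuousT (smo_nmk e)) (supp_nmk e0)). Qed.

Lemma smo_mol e f : 0 < e -> locint f -> smooth_on setT (mol e f).
Proof. by move=> e0; exact: (smo_convol (smo_nmk e) (supp_nmk e0)). Qed.

Lemma lipschitz_supp f M : smooth_on setT f -> supp M f ->
  exists2 L : R, 0 <= L & forall x y, `|f y - f x| <= L * (`|y.1 - x.1| + `|y.2 - x.2|).
Proof.
move=> sf uf.
have [L0 L00 H0] := supp_bounded (smo_continuousT (smo_pd 0 sf)) (supp_pd 0 uf).
have [L1 L10 H1] := supp_bounded (smo_continuousT (smo_pd 1 sf)) (supp_pd 1 uf).
exists (L0 + L1) => [|x y]; first exact: addr_ge0.
have A : `|f (y.1, y.2) - f (x.1, y.2)| <= L0 * `|y.1 - x.1|.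
  apply: (mvt_bound (g := fun s => f (s, y.2)) (dg := fun s => pd 0 f (s, y.2))) => t _.
    by apply: is_derive_slice0; exact: (smo_derivable 0 sf).
  exact: H0.
have B : `|f (x.1, y.2) - f (x.1, x.2)| <= L1 * `|y.2 - x.2|.
  apply: (mvt_bound (g := fun s => f (x.1, s)) (dg := fun s => pd 1 f (x.1, s))) => t _.
    by apply: is_derive_slice1; exact: (smo_derivable 1 sf).
  exact: H1.
rewrite -!surjective_pairing in A B.
apply: le_trans (ler_distD (f (x.1, y.2)) _ _) _; apply: le_trans (lerD A B) _.
have := normr_ge0 (y.1 - x.1); have := normr_ge0 (y.2 - x.2).
move: `|y.1 - x.1| `|y.2 - x.2| => u v u0 v0.
by rewrite mulrDr !mulrDl; nra.
Qed.

Lemma sqnorm_le_coord z (e : R) : 0 <= e -> sqnorm z <= e ^+ 2 -> `|z.1| <= e /\ `|z.2| <= e.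
Proof.
move=> e0 ze; split; rewrite -[e]ger0_norm// -ler_sqr ?nnegrE//;
  rewrite !real_normK ?num_real//; apply: le_trans ze; by rewrite ?lerDl ?lerDr sqr_ge0.
Qed.

Lemma mol_supp e f M x : 0 < e <= 1 -> supp M f -> ~ box (M + 2) x -> mol e f x = 0.
Proof.
move=> /andP[e0 e1] uf nx; rewrite /mol /convol.
transitivity (\int[leb2]_(y in setT) (0 : R)); last by rewrite Rintegral_cst// mul0r.
apply: eq_Rintegral => y _.
have [ye|ye] := leP (sqnorm (x - y)) (e ^+ 2); last by rewrite supp_nmk// mul0r.
have [yM|yM] := leP (sqnorm y) M; last by rewrite uf// mulr0.
exfalso; apply: nx; have /box_norm[y1 y2] := box_supp yM.
have [/= c1 c2] := sqnorm_le_coord (ltW e0) ye; apply/box_norm; split.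
  by have := ler_normD (x.1 - y.1) y.1; rewrite subrK; lra.
by have := ler_normD (x.2 - y.2) y.2; rewrite subrK; lra.
Qed.

(** As [nmk] has mass 1, the difference at x is the mollification of f - f(x), of size at most 2 L e
    since only points at distance at most e count; it is supported in a box that does not depend on
    e. *)
Lemma mol_test f M : smooth_on setT f -> supp M f ->
  exists2 C : R, 0 <= C & forall e, 0 < e <= 1 ->
    l2n (mol e f - f) <= C * e.
Proof.
move=> sf uf; have [L L0 HL] := lipschitz_supp sf uf.
have cf := smo_continuousT sf.
have lf : locint f := continuous_locint cf.
pose v := fine (leb2 (box (M + 2))).
exists (2 * L * Num.sqrt v) => [|e e01]; first by rewrite !mulr_ge0// sqrtr_ge0.
have /andP[e0 e1] := e01.
have hC x : `|(mol e f - f) x| <= 2 * L * e.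
  have cK := smo_continuousT (smo_nmk e).
  have uK := supp_nmk e0.
  have l1 : locint (cst (f x) : R * R -> R) by apply: continuous_locint => y; exact: cvg_cst.
  have lB : locint (f - cst (f x)).
    by apply: continuous_locint => y; apply: cvgB; [exact: cf|exact: cvg_cst].
  have E : (mol e f - f) x = mol e (f - cst (f x)) x.
    rewrite molB// -![(_ - _) x]/(_ - _); congr (_ - _).
    rewrite /mol /convol RintegralZr ?mass_nmk ?mul1r//.
    exact/integrable_scale/mker_integrable.
  rewrite E; apply: le_trans (le_normr_Rintegral measurableT _) _.
    exact: (convol_integrable x cK uK lB).
  have M1 : \int[leb2]_y (nmk e (x - y) * (2 * L * e)) = 2 * L * e.
    rewrite RintegralZr ?mass_nmk ?mul1r//.
    exact/integrable_scale/mker_integrable.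
  rewrite -[leRHS]M1.
  apply: le_Rintegral => //.
  - by have := integrable_abse (convol_integrable x cK uK lB).
  - rewrite (_ : (fun y => _) = (fun y => (2 * L * e) * nmk e (x - y))).
      exact/integrable_scale/integrable_scale/mker_integrable.
    by apply/funext => y; rewrite mulrC.
  - move=> y _; rewrite normrM [`|nmk _ _|]ger0_norm ?nmk_ge0//.
    have [ye|ye] := leP (sqnorm (x - y)) (e ^+ 2); last by rewrite supp_nmk// !mul0r.
    rewrite ler_wpM2l ?nmk_ge0//; apply: le_trans (HL x y) _.
    have [/= c1 c2] := sqnorm_le_coord (ltW e0) ye.
    rewrite (distrC y.1) (distrC y.2).
    rewrite (_ : 2 * L * e = L * (e + e)); last by ring.
    by rewrite ler_wpM2l// lerD.
have h0 x : ~ box (M + 2) x -> (mol e f - f) x = 0.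
  move=> nx; rewrite -[LHS]/(_ - _) (mol_supp e01 uf nx) uf ?subrr//.
  rewrite ltNge; apply/negP => /box_supp/box_norm[x1 x2]; apply: nx.
  by apply/box_norm; lra.
have mh : measurable_fun (setT : set PR) (mol e f - f).
  apply: plane_continuous_measurable => y; apply: cvgB; last exact: cf.
  exact: (smo_continuousT (smo_mol e0 lf)).
have [_] := ip_box_bound mh hC h0.
rewrite -/v => H; rewrite /l2n /snorm.
have -> : 2 * L * Num.sqrt v * e = Num.sqrt ((2 * L * e) ^+ 2 * v).
  have p0 : 0 <= 2 * L * e by apply: mulr_ge0; [exact: mulr_ge0|exact: ltW].
  by rewrite sqrtrM ?sqr_ge0// sqrtr_sqr (ger0_norm p0) mulrAC.
by rewrite ler_sqrt// mulr_ge0 ?sqr_ge0// fine_ge0.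
Qed.

(** A function with this property lies in the L^2 closure of the test functions. It is carried as a
    hypothesis and supplied by [approximable_lim], the functions to be mollified being built from
    limits of test functions. *)
Definition approximable f := forall e : R, 0 < e ->
  exists2 phi, smooth_on setT phi /\ exists M, supp M phi & l2n (f - phi) < e.

(** Three-term comparison through a test function phi: mollification contracts the L^2 norm, so f -
    phi is counted twice, and phi itself is handled by [mol_test]. *)
Lemma mol_cvg f : sqint leb2 f -> approximable f ->
  forall d : R, 0 < d -> exists2 e0 : R, 0 < e0 &
    forall e, 0 < e <= e0 -> l2n (mol e f - f) < d.
Proof.
move=> If af d d0.
have [phi [sp [M up]] fp] := af (d / 4) (divr_gt0 d0 (ltr0n _ 4)).
have [C C0 HC] := mol_test sp up.
have C1 : 0 < C + 1 by rewrite ltr_wpDl.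
have Ip := sqint_supp (smo_continuousT sp) up.
exists (Num.min 1 (d / 4 / (C + 1))).
  by rewrite lt_min ltr01 !divr_gt0.
move=> e /andP[e0]; rewrite le_min => /andP[e1 eC].
have I1 := sqint_mol e0 If; have I2 := sqint_mol e0 Ip.
have A : l2n (mol e f - mol e phi) <= l2n (f - phi).
  rewrite -molB//; [|exact: sqint_locint..].
  by apply: l2n_mol => //; exact: sqintB.
have B : l2n (mol e phi - phi) <= d / 4.
  apply: le_trans (HC e _) _; first by rewrite e0.
  move: eC; rewrite ler_pdivlMr// => eC; apply: le_trans eC.
  by rewrite mulrC ler_wpM2l ?ltW// ltrDl.
have := l2n_dist I1 I2 If; have := l2n_dist I2 Ip If.
rewrite (l2n_distC phi f); move: A B fp.
move: (l2n _) (l2n _) (l2n _) (l2n _) (l2n _) => t1 t2 t3 t4 t5; lra.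
Qed.

End L2Plane.

(** * Test functions in the disc and mollification of weakly harmonic fields *)

Section Weyl.
Context {R : realType} (a : R).
Local Notation leb2 := (@lebesgue_measure R \x @lebesgue_measure R)%E.
Implicit Types (U V : set (R * R)) (f g h K : R * R -> R) (i j : 'I_2) (x y z : R * R).

(* The condition on [M] makes the closed ball of squared radius [M] a compact
   subset of the disc. *)
Definition test f := smooth_on setT f /\ exists2 M, a ^+ 2 * M < 4 & supp M f.

Lemma test_pd f i : test f -> test (pd i f).
Proof. by move=> [sf [M aM uf]]; split; [exact: smo_pd|exists M => //; exact: supp_pd]. Qed.

Lemma test_continuous f : test f -> continuous f.
Proof. by move=> [sf _]; exact: smo_continuousT. Qed.

Lemma test_sqint f : test f -> sqint leb2 f.
Proof. by move=> tf; have [sf [M aM uf]] := tf; exact: sqint_supp (test_continuous tf) uf. Qed.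

Lemma sqnormB_le x z (t : R) : 0 < t ->
  sqnorm (x - z) <= (1 + t) * sqnorm x + (1 + t^-1) * sqnorm z.
Proof.
move=> t0.
have H (u v : R) : (u - v) ^+ 2 <= (1 + t) * u ^+ 2 + (1 + t^-1) * v ^+ 2.
  rewrite -subr_ge0.
  have -> : (1 + t) * u ^+ 2 + (1 + t^-1) * v ^+ 2 - (u - v) ^+ 2 =
     t * (u + v / t) ^+ 2 by field; rewrite gt_eqF.
  by rewrite mulr_ge0 ?sqr_ge0// ltW.
by rewrite /sqnorm/= !mulrDr addrACA lerD.
Qed.

(** A kernel of radius r centred in the ball of squared radius M stays in a compact part of the
    disc. The slack d = 4 - a^2 M is shared in [sqnormB_le]: the parameter t costs at most d / 2,
    and then the radius costs at most d / 4. *)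
Lemma good_radius M : a ^+ 2 * M < 4 -> exists2 r : R, 0 < r &
  exists2 M1 : R, a ^+ 2 * M1 < 4 &
    forall x z, sqnorm x <= M -> sqnorm z <= r ^+ 2 -> sqnorm (x - z) <= M1.
Proof.
move=> aM; have [M0|M0] := ltP M 0.
  exists 1 => //; exists 0; first by rewrite mulr0.
  by move=> x z xM; have := sqnorm_ge0 x; lra.
pose d := 4 - a ^+ 2 * M; have d0 : 0 < d by rewrite subr_gt0.
have a20 : 0 <= a ^+ 2 by exact: sqr_ge0.
have am0 : 0 <= a ^+ 2 * M by exact: mulr_ge0.
(* The [+ 1] here, and the one in [q], keep the denominators positive when a = 0. *)
pose t := d / (2 * (a ^+ 2 * M + 1)).
have t0 : 0 < t by rewrite divr_gt0// mulr_gt0// ltr_wpDl.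
have td : a ^+ 2 * M * t <= d / 2.
  rewrite /t mulrA ler_pdivrMr ?mulr_gt0 ?ltr_wpDl//.
  by nra.
pose q := d / (4 * (a ^+ 2 + 1) * (1 + t^-1)).
have ti0 : 0 < 1 + t^-1 by rewrite addr_gt0// invr_gt0.
have q0 : 0 < q by rewrite divr_gt0// !mulr_gt0// ltr_wpDl.
have qd : a ^+ 2 * (1 + t^-1) * q <= d / 4.
  have c0 : 0 < 4 * (a ^+ 2 + 1) * (1 + t^-1) by rewrite !mulr_gt0// ltr_wpDl.
  rewrite /q mulrA ler_pdivrMr//.
  have : 0 <= d * (1 + t^-1) by rewrite mulr_ge0// ltW.
  by move: (1 + t^-1) => w; move: (a ^+ 2) => b; lra.
pose r := Num.min 1 q.
have r0 : 0 < r by rewrite lt_min ltr01.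
have rq : r ^+ 2 <= q.
  have r1 : r <= 1 by rewrite ge_min lexx.
  have : r <= q by rewrite ge_min lexx orbT.
  by apply: le_trans; rewrite expr2 ler_piMl// ltW.
exists r => //; exists ((1 + t) * M + (1 + t^-1) * q).
  have -> : a ^+ 2 * ((1 + t) * M + (1 + t^-1) * q) =
    a ^+ 2 * M + a ^+ 2 * M * t + a ^+ 2 * (1 + t^-1) * q by ring.
  by rewrite /d in td qd d0; move: td qd; move: (a ^+ 2 * M * t) (_ * q) => u v; lra.
move=> x z xM zr; apply: le_trans (sqnormB_le x z t0) _.
apply: lerD; first by rewrite ler_wpM2l// addr_ge0// ltW.
by rewrite ler_wpM2l ?(ltW ti0)// (le_trans zr).
Qed.

Lemma test_shift K e M1 x : smooth_on setT K -> supp (e ^+ 2) K -> a ^+ 2 * M1 < 4 ->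
  (forall z, sqnorm z <= e ^+ 2 -> sqnorm (x - z) <= M1) ->
  test (fun y => K (x - y)).
Proof.
move=> sK uK aM H; split; first exact: smo_reflect.
exists M1 => // y My; apply: uK; rewrite ltNge; apply/negP => /H.
by rewrite opprB addrCA subrr addr0 leNgt My.
Qed.

Definition weak_div0 (g : 'I_2 -> R * R -> R) :=
  forall f, test f -> ip leb2 (g 0) (pd 0 f) + ip leb2 (g 1) (pd 1 f) = 0.
Definition weak_curl0 (g : 'I_2 -> R * R -> R) :=
  forall f, test f -> ip leb2 (g 0) (pd 1 f) - ip leb2 (g 1) (pd 0 f) = 0.

(* Here and below, identities between sums of derivatives are proved for
   variables and then instantiated, since unification would unfold [pd]. *)
Lemma weak_lap0 (g : 'I_2 -> R * R -> R) f i : (forall i, sqint leb2 (g i)) ->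
  weak_div0 g -> weak_curl0 g -> test f ->
  ip leb2 (g i) (pd 0 (pd 0 f)) + ip leb2 (g i) (pd 1 (pd 1 f)) = 0.
Proof.
have G0 (u v w : R) : u + w = 0 -> v - w = 0 -> u + v = 0 by lra.
have G1 (u v w : R) : w + v = 0 -> w - u = 0 -> u + v = 0 by lra.
move=> Ig Hd Hc tf.
have sw : pd 1 (pd 0 f) = pd 0 (pd 1 f).
  by apply/funext => x; rewrite (pdC openT tf.1).
have d0 := Hd _ (test_pd 0 tf); have d1 := Hd _ (test_pd 1 tf).
have c0 := Hc _ (test_pd 0 tf); have c1 := Hc _ (test_pd 1 tf).
rewrite sw in d0 c0.
by case: (I2P i) => ->; [exact: (G0 _ _ _ d0 c1)|exact: (G1 _ _ _ d1 c0)].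
Qed.

Lemma pd_reflect2 K x i y : smooth_on setT K ->
  pd i (pd i (fun y => K (x - y))) y = pd i (pd i K) (x - y).
Proof.
move=> sK.
have -> : pd i (fun y => K (x - y)) = fun y => (fun z => - pd i K z) (x - y).
  by apply/funext => z; rewrite pd_reflect.
rewrite (@pd_reflect R (fun z => - pd i K z)); last first.
  by apply: smoN; [exact: openT|exact: smo_pd].
rewrite [in LHS]/pd deriveN ?opprK//; exact: (smo_derivable i (smo_pd i sK)).
Qed.

(** Each component is weakly harmonic by [weak_lap0], and for small radii the shifted potentials
    [mpot] are test functions. The bound r depends on M but not on the point. *)
Lemma mol_const (g : 'I_2 -> R * R -> R) M : (forall i, sqint leb2 (g i)) ->
  weak_div0 g -> weak_curl0 g -> a ^+ 2 * M < 4 ->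
  exists2 r : R, 0 < r & forall i x (e e' : R), sqnorm x <= M ->
    0 < e -> e < e' -> e' < r -> mol e (g i) x = mol e' (g i) x.
Proof.
move=> Ig Hd Hc aM; have [r r0 [M1 aM1 HM]] := good_radius aM.
exists r; [exact: r0|move=> i x e e' xM e0 ee' e'r].
have lg := sqint_locint (Ig i).
have mE (t : R) : 0 < t -> mol t (g i) x = mass^-1 * convol (mker t) (g i) x.
  move=> t0; rewrite /mol /convol -RintegralZl//.
    by apply: eq_Rintegral => y _; rewrite /nmk mulrA.
  exact: (convol_integrable x (smo_continuousT (smo_mker t)) (supp_mker t0) lg).
suff H : convol (mker e) (g i) x = convol (mker e') (g i) x.
  by apply: etrans (mE _ e0) _; rewrite H; apply/esym/mE; exact: lt_trans ee'.
apply: (mker_convol_const lg _ e0 ee' e'r) => t /andP[t0 tr].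
have test_h : test (fun y => mpot t (x - y)).
  apply: (test_shift (smo_mpot t) (supp_mpot t0) aM1) => z zt; apply: HM => //.
  by apply: le_trans zt _; rewrite lerXn2r ?nnegrE ?ltW.
have := weak_lap0 i Ig Hd Hc test_h.
have Is k : sqint leb2 (pd k (pd k (fun y => mpot t (x - y)))).
  by apply: test_sqint; do 2!apply: test_pd.
rewrite /ip -RintegralD//; [|exact: sqint_mul|exact: sqint_mul].
move=> E; rewrite -[RHS]E; apply: eq_Rintegral => y _.
have G (w u v u' v' : R) : u = u' -> v = v' -> (u' + v') * w = w * u + w * v.
  by move=> -> ->; ring.
exact: (G (g i y) _ _ _ _ (pd_reflect2 x 0 y (smo_mpot t)) (pd_reflect2 x 1 y (smo_mpot t))).
Qed.

(** The derivatives fall on the kernel, and y -> [nmk e (x - y)] is a test function when e is small;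
    the reflection only changes signs. *)
Lemma mol_weak_div_curl (g : 'I_2 -> R * R -> R) M : (forall i, sqint leb2 (g i)) ->
  weak_div0 g -> weak_curl0 g -> a ^+ 2 * M < 4 ->
  exists2 r : R, 0 < r & forall x (e : R), sqnorm x <= M -> 0 < e < r ->
    pd 0 (mol e (g 0)) x + pd 1 (mol e (g 1)) x = 0 /\
    pd 1 (mol e (g 0)) x - pd 0 (mol e (g 1)) x = 0.
Proof.
have G0 (u v : R) : u + v = 0 -> - u - v = 0 by lra.
have G1 (u v : R) : u - v = 0 -> - u - - v = 0 by lra.
move=> Ig Hd Hc aM; have [r r0 [M1 aM1 HM]] := good_radius aM.
exists r; [exact: r0|move=> x e xM /andP[e0 er]].
have sK := smo_nmk e; have uK := supp_nmk e0.
have test_h : test (fun y => nmk e (x - y)).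
  apply: (test_shift sK uK aM1) => z ze; apply: HM => //.
  by apply: le_trans ze _; rewrite lerXn2r ?nnegrE ?ltW.
have E i j : pd i (mol e (g j)) x = - ip leb2 (g j) (pd i (fun y => nmk e (x - y))).
  rewrite /mol (pd_convol i sK uK (sqint_locint (Ig j))) /convol /ip.
  transitivity (\int[leb2]_y (-1 * (g j y * pd i (fun y => nmk e (x - y)) y))).
    apply: eq_Rintegral => y _; have -> := pd_reflect x i y sK.
    by rewrite mulrN mulN1r opprK mulrC.
  rewrite RintegralZl ?mulN1r//; apply: sqint_mul; first exact: Ig.
  by apply: test_sqint; exact: test_pd.
have := Hd _ test_h; have := Hc _ test_h; rewrite !E => H1 H2.
by split; [exact: (G0 _ _ H2)|exact: (G1 _ _ H1)].
Qed.

End Weyl.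

(** * Weyl's lemma for divergence free and curl free fields *)

Section WeylLemma.
Context {R : realType} (a : R).
Local Notation leb2 := (@lebesgue_measure R \x @lebesgue_measure R)%E.
Local Notation PR := (measurableTypeR R * measurableTypeR R)%type.
Implicit Types (U V : set (R * R)) (f h K : R * R -> R) (i j : 'I_2) (x y z : R * R).

Lemma ip_eq0_ae h : sqint leb2 h -> ip leb2 h h = 0 ->
  {ae leb2, forall x, h x = 0}.
Proof.
move=> Ih h0; have := ip_EFin Ih; rewrite h0 => E0.
have mh2 : measurable_fun (setT : set PR) (fun x => (h x ^+ 2)%:E).
  by apply/measurable_EFinP; apply: measurable_funX; exact: Ih.1.
have := (ae_eq_integral_abs leb2 measurableT mh2).1.
have -> : (\int[leb2]_x `|(h x ^+ 2)%:E| = 0)%E.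
  by rewrite [RHS]E0; apply: eq_integral => x _; rewrite gee0_abs// lee_fin sqr_ge0.
move=> /(_ erefl); apply: filterS => x /(_ I) [] /eqP.
by rewrite sqrf_eq0 => /eqP.
Qed.

Lemma ae_imp (P Q : R * R -> Prop) : (forall x, P x -> Q x) ->
  {ae leb2, forall x, P x} -> {ae leb2, forall x, Q x}.
Proof. by move=> PQ; exact: (@filterS _ _ (ae_filter_ringOfSetsType leb2) _ _ PQ). Qed.

(** Squared radii increasing to 4 / a^2 when a is not 0, and equal to 4 n when a = 0: one formula
    exhausts the disc in both cases. *)
Definition exh (n : nat) : R := 4 * n%:R / (n%:R * a ^+ 2 + 1).

Lemma exh_den n : 0 < n%:R * a ^+ 2 + 1 :> R.
Proof. by rewrite ltr_wpDl// mulr_ge0// sqr_ge0. Qed.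

Lemma exh_disc n : a ^+ 2 * exh n < 4.
Proof.
rewrite /exh mulrA ltr_pdivrMr ?exh_den//.
have : 0 <= n%:R * a ^+ 2 by rewrite mulr_ge0// sqr_ge0.
by move: (a ^+ 2) (n%:R) => u v; lra.
Qed.

Lemma disc_exh x : disc a x -> exists n, sqnorm x <= exh n.
Proof.
rewrite /disc/= => Dx; pose s := sqnorm x / (4 - a ^+ 2 * sqnorm x).
have d0 : 0 < 4 - a ^+ 2 * sqnorm x by rewrite subr_gt0.
exists (Num.trunc s).+1; have := ltW (truncnS_gt s); rewrite /s.
rewrite ler_pdivrMr// /exh ler_pdivlMr ?exh_den//.
by move: (_.+1%:R) (sqnorm x) (a ^+ 2) => u v w; lra.
Qed.

Lemma sqnorm_le_disc x M : a ^+ 2 * M < 4 -> sqnorm x <= M -> disc a x.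
Proof.
move=> aM xM; rewrite /disc/=; apply: le_lt_trans aM.
by rewrite ler_wpM2l// sqr_ge0.
Qed.

Lemma disc_nbd x : disc a x -> exists2 M, a ^+ 2 * M < 4 & sqnorm x < M.
Proof.
rewrite /disc/= => Dx; have d0 : 0 < 4 - a ^+ 2 * sqnorm x by rewrite subr_gt0.
have c0 : 0 < 2 * (a ^+ 2 + 1) by rewrite mulr_gt0// ltr_wpDl// sqr_ge0.
exists (sqnorm x + (4 - a ^+ 2 * sqnorm x) / (2 * (a ^+ 2 + 1))).
  rewrite mulrDr mulrA -ltrBrDl ltr_pdivrMr//.
  have := mulr_gt0 d0 (_ : 0 < a ^+ 2 + 2); rewrite ltr_wpDl ?sqr_ge0// => /(_ isT).
  by move: (sqnorm x) (a ^+ 2) => u v; lra.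
by rewrite ltrDl divr_gt0.
Qed.

Lemma ae_disc (P : R * R -> Prop) :
  (forall M, a ^+ 2 * M < 4 -> {ae leb2, forall x, sqnorm x <= M -> P x}) ->
  {ae leb2, forall x, disc a x -> P x}.
Proof.
move=> H; have Hn n := H _ (exh_disc n).
have := ae_foralln Hn.
by apply: filterS => x Hx /disc_exh[n]; exact: Hx.
Qed.

(** The value of [gam] at x is a mollification with a radius chosen for x. By [mol_const] it agrees
    on each smaller ball with the mollification of any fixed small radius, hence is smooth,
    divergence free and curl free there. As the radius tends to 0 the mollifications tend to g in
    L^2, so g = [gam] almost everywhere. *)
Theorem weyl (g : 'I_2 -> R * R -> R) : (forall i, sqint leb2 (g i)) ->
  (forall i, approximable (g i)) -> weak_div0 a g -> weak_curl0 a g ->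
  exists gam : 'I_2 -> R * R -> R, [/\ forall i, smooth_on (disc a) (gam i),
    forall x, disc a x -> pd 0 (gam 0) x + pd 1 (gam 1) x = 0 /\
                          pd 1 (gam 0) x - pd 0 (gam 1) x = 0 &
    forall i, {ae leb2, forall x, disc a x -> g i x = gam i x}].
Proof.
move=> Ig Ag Hd Hc.
have /choice[rad Hrad] : forall x, exists r : R, 0 < r /\ (disc a x ->
    forall i (e e' : R), 0 < e -> e < e' -> e' < r -> mol e (g i) x = mol e' (g i) x).
  move=> x; have [Dx|Dx] := pselect (disc a x); last first.
    exists (1 : R); split; [exact: ltr01|move=> D'; exact: False_ind _ (Dx D')].
  have [n xn] := disc_exh Dx; have [r r0 H] := mol_const Ig Hd Hc (exh_disc n).
  by exists r; split; [exact: r0|move=> _ i e e'; exact: H i x e e' xn].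
pose gam i x := mol (rad x / 2) (g i) x.
have loc M : a ^+ 2 * M < 4 -> exists2 r : R, 0 < r & forall i x (e : R),
    sqnorm x <= M -> 0 < e < r -> gam i x = mol e (g i) x.
  move=> aM; have [r r0 H] := mol_const Ig Hd Hc aM.
  exists r; [exact: r0|move=> i x e xM /andP[e0 er]].
  have Dx := sqnorm_le_disc aM xM; have [rx0 /(_ Dx) Hx] := Hrad x.
  have rx2 : 0 < rad x / 2 by rewrite divr_gt0.
  (* Equality is known for strictly ordered radii, so e and [rad x / 2] are both compared with a
     radius below each of them. *)
  pose m := Num.min e (rad x / 2) / 2.
  have m0 : 0 < m by rewrite divr_gt0// lt_min e0.
  have min0 : 0 < Num.min e (rad x / 2) by rewrite lt_min e0.
  have mm : m < Num.min e (rad x / 2) by rewrite /m; lra.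
  have me : m < e by apply: lt_le_trans mm _; rewrite ge_min lexx.
  have mr : m < rad x / 2 by apply: lt_le_trans mm _; rewrite ge_min lexx orbT.
  apply: etrans (H i x m e xM m0 me er); apply/esym; apply: (Hx i m _ m0 mr).
  by rewrite ltr_pdivrMr// ltr_pMr// ltrDl.
have oD : open (disc a) by exact: open_disc.
exists gam; split.
- move=> i; apply: smo_local => x Dx; have [M aM xM] := disc_nbd Dx.
  have [r r0 H] := loc M aM.
  exists [set y | sqnorm y < M]; split=> //.
  have r2 : 0 < r / 2 < r by rewrite divr_gt0//= ltr_pdivrMr// ltr_pMr// ltrDl.
  have sm := smo_mol (proj1 (andP r2)) (sqint_locint (Ig i)).
  have oV : open [set y : R * R | sqnorm y < M].
    rewrite (_ : [set _ | _] = sqnorm @^-1` [set t | t < M])//.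
    by apply: open_comp; [move=> y _; exact: continuous_sqnorm|exact: open_lt].
  apply: (eq_smo oV _ (sub_smo (@subsetT _ _) sm)) => y /set_mem/= yM.
  exact: (esym (H i y (r / 2) (ltW yM) r2)).
- move=> x Dx; have [M aM xM] := disc_nbd Dx.
  have [r r0 H] := loc M aM; have [r' r'0 H'] := mol_weak_div_curl Ig Hd Hc aM.
  pose e := Num.min r r' / 2.
  have mn0 : 0 < Num.min r r' by rewrite lt_min r0.
  have e0 : 0 < e by rewrite divr_gt0.
  have em : e < Num.min r r' by rewrite /e; lra.
  have er : 0 < e < r by rewrite e0 (lt_le_trans em)// ge_min lexx.
  have er' : 0 < e < r' by rewrite e0 (lt_le_trans em)// ge_min lexx orbT.
  have oV : open [set y : R * R | sqnorm y < M].
    rewrite (_ : [set _ | _] = sqnorm @^-1` [set t | t < M])//.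
    by apply: open_comp; [move=> y _; exact: continuous_sqnorm|exact: open_lt].
  have E i j : pd j (gam i) x = pd j (mol e (g i)) x.
    have HE : {in [set y | sqnorm y < M], gam i =1 mol e (g i)}.
      by move=> y /set_mem/= yM; exact: (H i y e (ltW yM) er).
    exact: (eq_on_pd j oV HE xM).
  have [H1 H2] := H' x e (ltW xM) er'.
  have GD (p q p' q' : R) : p = p' -> q = q' -> p' + q' = 0 -> p + q = 0 by move=> -> ->.
  have GB (p q p' q' : R) : p = p' -> q = q' -> p' - q' = 0 -> p - q = 0 by move=> -> ->.
  by split; [exact: GD (E _ _) (E _ _) H1|exact: GB (E _ _) (E _ _) H2].
- move=> i; apply: ae_disc => M aM; have [r r0 H] := loc M aM.
  pose S : set PR := [set y | sqnorm y <= M].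
  have mS : measurable S.
    rewrite (_ : S = ~` [set y | M < sqnorm y]); last first.
      by apply/seteqP; split=> y; rewrite /S/= => yM; [apply/negP|move/negP: yM]; rewrite -leNgt.
    by apply: measurableC; apply: open_plane_measurable; exact: open_sqnorm_gt.
  have r22 : 0 < r / 2 < r by rewrite divr_gt0//= ltr_pdivrMr// ltr_pMr// ltrDl.
  (* By [hE] below this function is the same for all small radii, so its norm is below every error
     given by [mol_cvg], hence 0. *)
  pose h x := (mol (r / 2) (g i) x - g i x) * \1_S x.
  have hE (e : R) x : 0 < e < r -> h x = (mol e (g i) x - g i x) * \1_S x.
    move=> er; rewrite /h indicE; case: (boolP (x \in S)) => [/set_mem xS|_]; last exact: etrans (mulr0 _) (esym (mulr0 _)).
    by rewrite -(H i x e xS er) -(H i x (r / 2) xS r22).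
  have r2 : 0 < r / 2 by rewrite divr_gt0.
  have mh : measurable_fun (setT : set PR) h.
    apply: measurable_funM; last exact: measurable_indic.
    by apply: measurable_funB; [exact: (sqint_mol r2 (Ig i)).1|exact: (Ig i).1].
  have hle (e : R) x : 0 < e < r -> h x ^+ 2 <= (mol e (g i) - g i) x ^+ 2.
    move=> er; rewrite (hE e x er) indicE; case: (_ \in _); rewrite ?mulr1//.
    by rewrite mulr0 expr0n sqr_ge0.
  have IB (e : R) : 0 < e -> sqint leb2 (mol e (g i) - g i).
    by move=> e0; apply: sqintB => //; exact: sqint_mol.
  have Ih : sqint leb2 h.
    apply: (sqint_dominated mh (IB _ r2)) => x; exact: hle.
  have ih0 : l2n h = 0.
    apply/eqP; rewrite eq_le l2n_ge0 andbT; apply/ler_addgt0Pr => d d0; rewrite add0r.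
    have [e0 e00 He] := mol_cvg (Ig i) (Ag i) d0.
    pose e := Num.min e0 (r / 2).
    have e_gt0 : 0 < e by rewrite lt_min e00.
    have er : 0 < e < r.
      by rewrite e_gt0 (le_lt_trans (_ : e <= r / 2))//; [rewrite ge_min lexx orbT|case/andP: r22].
    have ee0 : 0 < e <= e0 by rewrite e_gt0 ge_min lexx.
    apply: le_trans (ltW (He e ee0)); rewrite ler_sqrt ?ip_ge0//.
    by apply: ip_le => //; [exact: IB|move=> x; exact: hle].
  have := ip_eq0_ae Ih; rewrite -l2n_sqr ih0 expr0n => /(_ erefl).
  apply: ae_imp => x hx xM; move: hx.
  rewrite (hE (r / 2) x r22) indicE mem_set// mulr1 -(H i x _ xM r22) => hx; apply/esym; exact: subr0_eq hx.
Qed.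

End WeylLemma.

(** * Test functions and cutoffs *)

Section PartialDerivatives.
Context {R : realType}.
Implicit Types (U : set (R * R)) (f g : R * R -> R) (i : 'I_2) (x : R * R).

Lemma is_derive_pd U f i x : smooth_on U f -> U x ->
  is_derive x (Defs.basis i) f (pd i f x).
Proof. by move=> sf Ux; apply: DeriveDef => //; exact: smo_derivable sf Ux. Qed.

Lemma pdE f i x (d : R) : is_derive x (Defs.basis i) f d -> pd i f x = d.
Proof. by move=> H; exact: derive_val. Qed.

Lemma pdD U f g i x : smooth_on U f -> smooth_on U g -> U x ->
  pd i (fun x => f x + g x) x = pd i f x + pd i g x.
Proof.
move=> sf sg Ux; apply: pdE.
exact: (is_deriveD (is_derive_pd i sf Ux) (is_derive_pd i sg Ux)).
Qed.

Lemma pdB U f g i x : smooth_on U f -> smooth_on U g -> U x ->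
  pd i (fun x => f x - g x) x = pd i f x - pd i g x.
Proof.
move=> sf sg Ux; apply: pdE.
exact: (is_deriveB (is_derive_pd i sf Ux) (is_derive_pd i sg Ux)).
Qed.

Lemma pdN U f i x : smooth_on U f -> U x -> pd i (fun x => - f x) x = - pd i f x.
Proof. by move=> sf Ux; apply: pdE; exact: (is_deriveN (is_derive_pd i sf Ux)). Qed.

Lemma pdM U f g i x : smooth_on U f -> smooth_on U g -> U x ->
  pd i (fun x => f x * g x) x = pd i f x * g x + f x * pd i g x.
Proof.
move=> sf sg Ux; apply: pdE.
have := is_deriveM (is_derive_pd i sf Ux) (is_derive_pd i sg Ux).
by rewrite !scaleR_mul addrC [g x * _]mulrC.
Qed.

Lemma pd_cst (k : R) i x : pd i (cst k) x = 0.
Proof. by apply: pdE; exact: is_derive_cst. Qed.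

Lemma pdZ U (k : R) f i x : smooth_on U f -> U x ->
  pd i (fun x => k * f x) x = k * pd i f x.
Proof.
by move=> sf Ux; rewrite (pdM i (smo_cst U k) sf Ux) pd_cst mul0r add0r.
Qed.

End PartialDerivatives.

(** * The conformal factor and operations on test functions *)

Section TestFunctions.
Context {R : realType} (a : R).
Implicit Types (U : set (R * R)) (f g : R * R -> R) (i : 'I_2) (x : R * R).

Definition kap x : R := 1 - a ^+ 2 * sqnorm x / 4.

Lemma kap_gt0 x : disc a x -> 0 < kap x.
Proof. by rewrite /disc/= /kap subr_gt0 ltr_pdivrMr// mul1r. Qed.

Lemma kap_neq0 x : disc a x -> kap x != 0.
Proof. by move=> /kap_gt0 /lt0r_neq0. Qed.

Lemma kap_le1 x : kap x <= 1.
Proof. by rewrite /kap gerBl divr_ge0// mulr_ge0 ?sqr_ge0 ?sqnorm_ge0. Qed.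

Lemma smo_kap U : open U -> smooth_on U kap.
Proof.
move=> oU; rewrite (_ : kap = fun x => 1 - (a ^+ 2 / 4) * sqnorm x); last first.
  by apply/funext => x; rewrite /kap; congr (_ - _); ring.
by apply: smoB => //; [exact: smo_cst|apply: smoZ => //; exact: smo_sqnorm].
Qed.

Lemma pd_kap i x : pd i kap x = - (a ^+ 2 * crd i x / 2).
Proof.
rewrite (_ : kap = fun x => 1 - (a ^+ 2 / 4) * sqnorm x); last first.
  by apply/funext => y; rewrite /kap; congr (_ - _); ring.
have sq := @smo_sqnorm R setT openT.
rewrite (pdB i (smo_cst setT 1) (smoZ (a ^+ 2 / 4) openT sq) I) pd_cst (pdZ _ i sq I).
by rewrite (pdE (is_derive_sqnorm i x)); field.
Qed.

(** The plane is covered by the disc and by the exterior of the ball, on which f is 0. *)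
Lemma test_local f M : a ^+ 2 * M < 4 -> supp M f -> smooth_on (disc a) f -> test a f.
Proof.
move=> aM sM sf; split; last by exists M.
apply: smo_local => x _; have [xM|xM] := leP (sqnorm x) M.
  by exists (disc a); split=> //; exact: sqnorm_le_disc xM.
exists [set x | M < sqnorm x]; split=> //.
have f0 : {in [set x | M < sqnorm x], cst 0 =1 f}.
  by move=> y /set_mem/= yM; rewrite sM.
exact: eq_smo (@open_sqnorm_gt R M) f0 (smo_cst _ 0).
Qed.

Lemma test_smo f : test a f -> smooth_on (disc a) f.
Proof. by case=> sf _; exact: sub_smo sf. Qed.

Lemma testMr f g : test a f -> smooth_on (disc a) g -> test a (fun x => g x * f x).
Proof.
move=> tf sg; have [_ [M aM sM]] := tf; apply: (test_local aM).
  by move=> x /sM ->; rewrite mulr0.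
by apply: smoM => //; [exact: open_disc|exact: test_smo].
Qed.

Lemma testMl f g : test a f -> smooth_on (disc a) g -> test a (fun x => f x * g x).
Proof.
move=> tf sg; have := testMr tf sg; congr test.
by apply/funext => x; rewrite mulrC.
Qed.

Lemma test0 : test a (cst 0).
Proof. by split; [exact: smo_cst|exists 0; [rewrite mulr0|move=> x _]]. Qed.

Lemma testD f g : test a f -> test a g -> test a (fun x => f x + g x).
Proof.
move=> [sf [M aM sM]] [sg [N aN sN]]; split; first exact: smoD openT _ _.
exists (Num.max M N); first by case: (leP M N).
by move=> x; rewrite gt_max => /andP[/sM -> /sN ->]; rewrite addr0.
Qed.

Lemma testZ (k : R) f : test a f -> test a (fun x => k * f x).
Proof. by move=> tf; apply: testMr => //; exact: smo_cst. Qed.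

Lemma testN f : test a f -> test a (fun x => - f x).
Proof.
move=> tf; have := testZ (-1) tf; congr test.
by apply/funext => x; rewrite mulN1r.
Qed.

Lemma testB f g : test a f -> test a g -> test a (fun x => f x - g x).
Proof. by move=> tf tg; apply: testD => //; exact: testN. Qed.

Lemma test_out f x : test a f -> ~ disc a x -> f x = 0.
Proof.
move=> [_ [M aM sM]] Dx; apply: sM; rewrite ltNge; apply/negP => xM.
exact: Dx (sqnorm_le_disc aM xM).
Qed.

(** The usual quotient of flat functions: the two summands of [den] do not vanish together because M
    < N, and N is chosen between M and the boundary value. *)
Lemma test_step M : a ^+ 2 * M < 4 ->
  exists2 th, test a th & forall x, sqnorm x <= M -> th x = 1.
Proof.
move=> aM; pose N := M + (4 - a ^+ 2 * M) / (2 * (a ^+ 2 + 1)).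
have d0 : 0 < 4 - a ^+ 2 * M by rewrite subr_gt0.
have c0 : 0 < 2 * (a ^+ 2 + 1) by rewrite mulr_gt0// ltr_wpDl// sqr_ge0.
have MN : M < N by rewrite ltrDl divr_gt0.
have aN : a ^+ 2 * N < 4.
  rewrite /N mulrDr mulrA -ltrBrDl ltr_pdivrMr//.
  have := mulr_gt0 d0 (_ : 0 < a ^+ 2 + 2); rewrite ltr_wpDl ?sqr_ge0// => /(_ isT).
  by move: M (a ^+ 2) {MN N aM d0 c0} => u v; lra.
have fl_gt0 (t : R) : 0 < t -> 0 < flat 1 t.
  by move=> t0; rewrite /flat t0 hornerC mul1r expR_gt0.
pose den x := flat 1 (N - sqnorm x) + flat 1 (sqnorm x - M).
have den0 x : den x != 0.
  apply: lt0r_neq0; rewrite /den; have [xN|xN] := ltP (sqnorm x) N.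
    by rewrite ltr_pwDl ?flat_ge0// fl_gt0// subr_gt0.
  by rewrite ltr_wpDl ?flat_ge0// fl_gt0// subr_gt0 (lt_le_trans MN).
have sN : smooth_on setT (fun x : R * R => flat 1 (N - sqnorm x)).
  by apply: smo_flat openT _; apply: smoB openT (smo_cst _ _) (smo_sqnorm openT).
exists (fun x => flat 1 (N - sqnorm x) / den x).
  split; last by exists N => // x xN; rewrite flat_le0 ?mul0r// subr_le0 ltW.
  apply: (smoM openT sN); apply: smoV openT _ _ => //.
  apply: (smoD openT sN); apply: smo_flat openT _.
  exact: smoB openT (smo_sqnorm openT) (smo_cst _ _).
move=> x xM; have := den0 x; rewrite /den [flat 1 (_ - M)]flat_le0 ?subr_le0//.
by rewrite addr0 => /divff.
Qed.

End TestFunctions.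

(** * Cutoffs with small gradient for the metric *)

Section Cutoffs.
Context {R : realType} (a : R).
Implicit Types (f g : R * R -> R) (i : 'I_2) (x : R * R) (n : nat).

(* An exhaustion function whose gradient is bounded for the metric of the disc,
   by [kap_pd_tau]. *)
Definition tau x : R := ln (1 + sqnorm x) - ln (kap a x).

Lemma sqnorm1_gt0 x : 0 < 1 + sqnorm x.
Proof. by rewrite ltr_pwDl// sqnorm_ge0. Qed.

Lemma tau_ge0 x : disc a x -> 0 <= tau x.
Proof.
move=> Dx; rewrite subr_ge0 ler_ln ?posrE ?kap_gt0 ?sqnorm1_gt0//.
by apply: le_trans (kap_le1 a x) _; rewrite lerDl sqnorm_ge0.
Qed.

Lemma smo_sqnorm1 U : open U -> smooth_on U (fun x : R * R => 1 + sqnorm x).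
Proof. by move=> oU; apply: smoD oU (smo_cst _ _) (smo_sqnorm oU). Qed.

Lemma smo_tau : smooth_on (disc a) tau.
Proof.
have oD : open (disc a) by exact: open_disc.
apply: (smoB oD).
  by apply: (smo_ln oD) (smo_sqnorm1 oD) => x _; exact: sqnorm1_gt0.
by apply: (smo_ln oD) (smo_kap _ oD) => x; exact: kap_gt0.
Qed.

Lemma pd_ln U f i x : open U -> smooth_on U f -> (forall x, U x -> 0 < f x) -> U x ->
  pd i (fun x => ln (f x)) x = (f x)^-1 * pd i f x.
Proof.
move=> oU sf f0 Ux; apply: pdE.
exact: is_derive_comp (is_derive1_ln (f0 x Ux)) (smo_derivable i sf Ux).
Qed.

Lemma pd_tau i x : disc a x ->
  pd i tau x = (1 + sqnorm x)^-1 * (2 * crd i x) + (kap a x)^-1 * (a ^+ 2 * crd i x / 2).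
Proof.
move=> Dx; have oD : open (disc a) by exact: open_disc.
have l1 : forall x, disc a x -> 0 < 1 + sqnorm x by move=> y _; exact: sqnorm1_gt0.
have s1 := smo_sqnorm1 oD; have sk := smo_kap a oD.
rewrite (pdB i (smo_ln oD l1 s1) (smo_ln oD (@kap_gt0 _ a) sk) Dx).
rewrite (pd_ln i oD s1 l1 Dx) (pd_ln i oD sk (@kap_gt0 _ a) Dx) pd_kap mulrN opprK.
by rewrite (pdD i (smo_cst _ _) (smo_sqnorm oD) Dx) pd_cst add0r (pdE (is_derive_sqnorm i x)).
Qed.

Lemma crd_sqr_le i x : crd i x ^+ 2 <= sqnorm x.
Proof.
by rewrite sqnormE -!expr2; case: (I2P i) => ->; rewrite ?lerDl ?lerDr sqr_ge0.
Qed.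

(** The two terms of kap times the derivative are kap 2 x_i / (1 + |x|^2), of square at most 1, and
    a^2 x_i / 2, of square at most a^2 since a^2 |x|^2 < 4. In [tau], ln(1 + |x|^2) provides
    properness when a = 0, and - ln kap when a is not 0. *)
Lemma kap_pd_tau i x : disc a x ->
  (kap a x * pd i tau x) ^+ 2 <= 2 * (1 + a ^+ 2).
Proof.
move=> Dx; rewrite (pd_tau i Dx) mulrDr !mulrA mulfV ?kap_neq0// mul1r.
have s1 := sqnorm1_gt0 x; have xs := crd_sqr_le i x.
have k0 := kap_gt0 Dx; have k1 := kap_le1 a x.
set p := kap a x * _ * _ * _; set q := a ^+ 2 * _ / _.
have p1 : p ^+ 2 <= 1.
  rewrite /p -!mulrA exprMn -[leRHS]mulr1; apply: ler_pM; rewrite ?sqr_ge0//.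
    by rewrite expr_le1// ltW.
  rewrite exprMn exprVn ler_pdivrMl ?exprn_gt0// mulr1 exprMn.
  apply: (@le_trans _ _ (2 ^+ 2 * sqnorm x)); first by rewrite ler_wpM2l.
  by rewrite -subr_ge0 (_ : _ - _ = (1 - sqnorm x) ^+ 2) ?sqr_ge0//; ring.
have q1 : q ^+ 2 <= a ^+ 2.
  rewrite (_ : q ^+ 2 = a ^+ 2 * (a ^+ 2 * crd i x ^+ 2 / 4)); last by rewrite /q; field.
  rewrite -[leRHS]mulr1 ler_wpM2l ?sqr_ge0// ler_pdivrMr// mul1r.
  by move: Dx; rewrite /disc/= => /ltW; apply: le_trans; rewrite ler_wpM2l ?sqr_ge0.
have := sqr_ge0 (p - q); move: p q p1 (a ^+ 2) q1 => p q p1 u q1.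
rewrite sqrrB sqrrD; lra.
Qed.

(** The factor [expR 1] normalises the value exp(-1) of [flat 1] at 1. Off the disc [kap] is at most
    0 and its logarithm is meaningless, so the value 0 is imposed. *)
Definition chi n x : R :=
  if a ^+ 2 * sqnorm x < 4 then expR 1 * flat 1 (1 - n.+1%:R^-1 * tau x) else 0.

Lemma chiE n x : disc a x -> chi n x = expR 1 * flat 1 (1 - n.+1%:R^-1 * tau x).
Proof. by rewrite /disc/= /chi => ->. Qed.

Lemma chi_ge0 n x : 0 <= chi n x.
Proof. by rewrite /chi; case: ifP => // _; rewrite mulr_ge0 ?expR_ge0 ?flat_ge0. Qed.

Lemma chi_le1 n x : chi n x <= 1.
Proof.
rewrite /chi; case: ifP => // Dx.
rewrite /flat; case: ifP => [t0|]; last by rewrite mulr0.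
rewrite hornerC mul1r -expRD -[leRHS]expR0 ler_expR subr_le0 invf_ge1//.
by rewrite gerBl mulr_ge0 ?tau_ge0.
Qed.

Lemma chi_cvg x : disc a x -> chi ^~ x @ \oo --> (1 : R).
Proof.
move=> Dx; have -> : chi ^~ x = fun n => expR 1 * flat 1 (1 - n.+1%:R^-1 * tau x).
  by apply/funext => n; exact: chiE.
have E1 : expR 1 * flat 1 (1 - 0 * tau x) = 1 :> R.
  by rewrite mul0r subr0 /flat ltr01 hornerC mul1r invr1 -expRD subrr expR0.
have C1 : (fun n => 1 - n.+1%:R^-1 * tau x) @ \oo --> 1 - 0 * tau x.
  by apply: cvgB; [exact: cvg_cst|apply: cvgMr_tmp; exact: cvg_harmonic].
have [/derivable1_diffP H _] := is_derive_flat1 (1 - 0 * tau x : R).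
rewrite -[X in _ --> X]E1; apply: cvgMl_tmp.
exact: cvg_comp C1 (differentiable_continuous H).
Qed.

Lemma smo_chi n : smooth_on (disc a) (chi n).
Proof.
have oD : open (disc a) by exact: open_disc.
have E : {in disc a, (fun x => expR 1 * flat 1 (1 - n.+1%:R^-1 * tau x)) =1 chi n}.
  by move=> x /set_mem Dx; rewrite chiE.
apply: (eq_smo oD E); apply: (smoZ _ oD); apply: (smo_flat _ oD).
by apply: (smoB oD (smo_cst _ _)); apply: smoZ oD smo_tau.
Qed.

Lemma test_chi n : test a (chi n).
Proof.
pose E : R := expR n.+1%:R.
have E1 : 1 < E by rewrite -expR0 ltr_expR.
have d0 : 0 < 1 + E * a ^+ 2 / 4 by rewrite ltr_pwDl// divr_ge0// mulr_ge0 ?sqr_ge0 ?expR_ge0.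
(* The cutoff is nonzero where [tau] < n + 1, that is 1 + |x|^2 < E kap(x); solving for |x|^2 gives
   this radius. *)
apply: (@test_local _ a _ ((E - 1) / (1 + E * a ^+ 2 / 4))); last exact: smo_chi.
  rewrite mulrA ltr_pdivrMr//; have := sqr_ge0 a.
  by move: (a ^+ 2) E E1 {d0} => u v; lra.
move=> x; rewrite ltr_pdivrMr// => xM; rewrite /chi; case: ifP => // Dx.
rewrite flat_le0 ?mulr0// subr_le0 ler_pdivlMl// mulr1.
rewrite /tau lerBrDr -[_%:R]expRK -lnM ?posrE ?expR_gt0 ?kap_gt0//.
rewrite ler_ln ?posrE ?sqnorm1_gt0 ?mulr_gt0 ?expR_gt0 ?kap_gt0//.
move: xM; rewrite -/E /kap.
by move: (a ^+ 2) E (sqnorm x) {E1 d0 Dx} => u v w; lra.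
Qed.

Lemma chi_gradient : exists2 C : R, 0 <= C & forall n i x,
  (kap a x * pd i (chi n) x) ^+ 2 <= C * n.+1%:R^-1 ^+ 2.
Proof.
have [B B0 HB] := @flat_bounded R 'X^2.
exists (expR 1 ^+ 2 * B ^+ 2 * (2 * (1 + a ^+ 2))).
  by rewrite !mulr_ge0 ?sqr_ge0// addr_ge0 ?sqr_ge0.
move=> n i x; set m := n.+1%:R^-1.
have m0 : 0 <= m by rewrite invr_ge0.
have c0 : 0 <= 2 * (1 + a ^+ 2) by rewrite mulr_ge0// addr_ge0 ?sqr_ge0.
have [Dx|Dx] := pselect (disc a x); last first.
  rewrite (test_out (test_pd i (test_chi n)) Dx) mulr0 expr0n/=.
  by apply: mulr_ge0; [apply: mulr_ge0 c0; exact: mulr_ge0 (sqr_ge0 _) (sqr_ge0 _)|exact: sqr_ge0].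
have oD : open (disc a) by exact: open_disc.
have E : {in disc a, chi n =1 (fun x => expR 1 * flat 1 (1 - m * tau x))}.
  by move=> y /set_mem Dy; rewrite chiE.
have sa : smooth_on (disc a) (fun x => 1 - m * tau x).
  by apply: (smoB oD (smo_cst _ _)); apply: smoZ oD smo_tau.
rewrite (eq_on_pd i oD E Dx) (pdZ _ i (smo_flat 1 oD sa) Dx).
have -> : pd i (fun x => flat 1 (1 - m * tau x)) x =
    flat 'X^2 (1 - m * tau x) * - (m * pd i tau x).
  have -> : - (m * pd i tau x) = pd i (fun x => 1 - m * tau x) x.
    by rewrite (pdB i (smo_cst _ _) (smoZ m oD smo_tau) Dx) pd_cst sub0r (pdZ _ i smo_tau Dx).
  apply: pdE.
  exact: is_derive_comp (is_derive_flat1 _) (smo_derivable i sa Dx).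
have ht := kap_pd_tau i Dx.
have hf : flat 'X^2 (1 - m * tau x) ^+ 2 <= B ^+ 2.
  rewrite -[leLHS]real_normK ?num_real// ler_pXn2r ?nnegrE//.
  by apply: HB; rewrite gerBl mulr_ge0 ?tau_ge0.
rewrite (_ : _ ^+ 2 = (expR 1 ^+ 2 * flat 'X^2 (1 - m * tau x) ^+ 2 *
  (kap a x * pd i tau x) ^+ 2) * m ^+ 2); last by move: (pd _ _ _) => u; ring.
apply: ler_wpM2r (sqr_ge0 m) _ _ _; apply: ler_pM ht.
- exact: mulr_ge0 (sqr_ge0 _) (sqr_ge0 _).
- exact: sqr_ge0.
- exact: ler_wpM2l (sqr_ge0 _) _ _ hf.
Qed.

End Cutoffs.

(** * A vanishing theorem for an elliptic equation *)

Section StrongConvergence.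
Context {R : realType}.
Local Notation leb2 := (@lebesgue_measure R \x @lebesgue_measure R)%E.
Local Notation PR := (measurableTypeR R * measurableTypeR R)%type.
Implicit Types (f g h m : R * R -> R) (i j : 'I_2) (x y z : R * R).

Lemma ip0 h : ip leb2 0 h = 0.
Proof.
rewrite /ip (_ : (fun _ => _) = cst 0) ?Rintegral_cst ?mul0r//.
by apply/funext => x; rewrite mul0r.
Qed.

Lemma sqintZ (k : R) f : sqint leb2 f -> sqint leb2 (k *: f).
Proof. by move=> If; rewrite -[k *: f]addr0; apply: sqintDZ If (sqint0 leb2). Qed.

Lemma ipZ (k : R) f h : sqint leb2 f -> sqint leb2 h ->
  ip leb2 (k *: f) h = k * ip leb2 f h.
Proof.
move=> If Ih; have := ipDZ k If (sqint0 leb2) Ih.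
by rewrite addr0 ip0 addr0.
Qed.

Lemma ipD f g h : sqint leb2 f -> sqint leb2 g -> sqint leb2 h ->
  ip leb2 (f + g) h = ip leb2 f h + ip leb2 g h.
Proof. by move=> If Ig Ih; have := ipDZ 1 If Ig Ih; rewrite scale1r mul1r. Qed.

Lemma ipB f g h : sqint leb2 f -> sqint leb2 g -> sqint leb2 h ->
  ip leb2 (f - g) h = ip leb2 f h - ip leb2 g h.
Proof.
move=> If Ig Ih; have := ipDZ (-1) Ig If Ih.
by rewrite scaleN1r mulN1r addrC [X in _ = X]addrC.
Qed.

Lemma ipBr f g h : sqint leb2 f -> sqint leb2 g -> sqint leb2 h ->
  ip leb2 h (f - g) = ip leb2 h f - ip leb2 h g.
Proof. by move=> If Ig Ih; rewrite ipC ipB// !(ipC leb2 h). Qed.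

Lemma l2n_mul m (C : R) f : measurable_fun (setT : set PR) m -> 0 <= C ->
  (forall x, `|m x| <= C) -> sqint leb2 f ->
  sqint leb2 (fun x => m x * f x) /\ l2n (fun x => m x * f x) <= C * l2n f.
Proof.
move=> mm C0 mC If.
have IC := sqintZ C If.
have le x : (m x * f x) ^+ 2 <= (C *: f) x ^+ 2.
  rewrite !exprMn; apply: ler_wpM2r (sqr_ge0 _) _ _ _.
  rewrite -[leLHS]real_normK ?num_real// ler_pXn2r ?nnegrE//; exact: mC.
have I1 : sqint leb2 (fun x => m x * f x).
  by apply: sqint_dominated IC le; apply: measurable_funM mm If.1.
split=> //; rewrite -(ler_pXn2r (_ : 0 < 2)%N) ?nnegrE ?mulr_ge0 ?l2n_ge0//.
rewrite exprMn !l2n_sqr; apply: le_trans (ip_le I1 IC le) _.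
by rewrite ipZ// [X in C * X](ipC leb2 f) ipZ// mulrA.
Qed.

Definition l2cvg (f_ : nat -> R * R -> R) f := (fun n => l2n (f_ n - f)) @ \oo --> (0 : R).

Lemma l2cvgP (f_ : nat -> R * R -> R) f :
  (forall d : R, 0 < d -> \forall n \near \oo, l2n (f_ n - f) < d) -> l2cvg f_ f.
Proof.
move=> H; apply/cvgr0Pnorm_lt => d /H; apply: filterS => n.
by rewrite ger0_norm ?l2n_ge0.
Qed.

Lemma l2cvg_mul m (C : R) (f_ : nat -> R * R -> R) f :
  measurable_fun (setT : set PR) m -> (forall x, `|m x| <= C) ->
  (forall n, sqint leb2 (f_ n)) -> sqint leb2 f -> l2cvg f_ f ->
  l2cvg (fun n x => m x * f_ n x) (fun x => m x * f x).
Proof.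
move=> mm mC If_ If cf.
have C0 : 0 <= C by apply: le_trans (mC 0); exact: normr_ge0.
apply: (@squeeze_cvgr _ _ _ _ (cst 0) (fun n => C * l2n (f_ n - f))).
- apply: nearW => n; rewrite l2n_ge0 /=.
  have [_] := l2n_mul mm C0 mC (sqintB (If_ n) If).
  suff -> : (fun x => m x * f_ n x) - (fun x => m x * f x) =
    fun x => m x * (f_ n - f) x by [].
  by apply/funext => x; rewrite -[RHS]/(m x * (f_ n x - f x)) mulrBr.
- exact: cvg_cst.
- by rewrite -[X in _ --> X](mulr0 C); apply: cvgMl_tmp.
Qed.

Lemma l2cvg_ip (f_ g_ : nat -> R * R -> R) f g :
  (forall n, sqint leb2 (f_ n)) -> sqint leb2 f ->
  (forall n, sqint leb2 (g_ n)) -> sqint leb2 g ->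
  l2cvg f_ f -> l2cvg g_ g ->
  (fun n => ip leb2 (f_ n) (g_ n)) @ \oo --> ip leb2 f g.
Proof.
move=> If_ If Ig_ Ig cf cg; apply/subr_cvg0; apply/norm_cvg0P.
apply: (@squeeze_cvgr _ _ _ _ (cst 0) (fun n => l2n (f_ n - f) * l2n (g_ n - g) +
  (l2n (f_ n - f) * l2n g + l2n f * l2n (g_ n - g)))).
- apply: nearW => n; rewrite normr_ge0 /=.
  have If' := sqintB (If_ n) If; have Ig' := sqintB (Ig_ n) Ig.
  have E1 : ip leb2 (f_ n) (g_ n) = ip leb2 (f_ n - f) (g_ n - g) +
      (ip leb2 (f_ n - f) g + ip leb2 f (g_ n - g)) + ip leb2 f g.
    rewrite (ipB (If_ n) If Ig') (ipB (If_ n) If Ig).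
    rewrite (ipBr (Ig_ n) Ig (If_ n)) (ipBr (Ig_ n) Ig If).
    by move: (ip _ _ _) (ip _ _ _) (ip _ _ _) (ip _ _ _) => u v w t; ring.
  rewrite [X in X - _]E1 addrK.
  apply: le_trans (ler_normD _ _) _; apply: lerD; first exact: l2_cauchy_schwarz.
  by apply: le_trans (ler_normD _ _) _; apply: lerD; exact: l2_cauchy_schwarz.
- exact: cvg_cst.
- rewrite [X in _ --> X](_ : 0 = 0 * 0 + (0 * l2n g + l2n f * 0)); last by ring.
  by apply: cvgD; [exact: cvgM|apply: cvgD; [apply: cvgMr_tmp|apply: cvgMl_tmp]].
Qed.

(** The index n + 2 keeps the radii strictly below r, the range in which a mollified equation
    holds. *)
Lemma mol_l2cvg f (r : R) : 0 < r -> sqint leb2 f -> approximable f ->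
  l2cvg (fun n => mol (r / n.+2%:R) f) f.
Proof.
move=> r0 If Af; apply: l2cvgP => d d0; have [e0 e00 H] := mol_cvg If Af d0.
have : (fun n => r / n.+2%:R) @ \oo --> 0 * r.
  under eq_fun do rewrite mulrC; apply: cvgMr_tmp.
  by have := @cvg_harmonic R; rewrite -(cvg_shiftS (fun n => n.+1%:R^-1 : R)).
rewrite mul0r => /cvgr0Pnorm_lt/(_ e0 e00); apply: filterS => n.
by rewrite ger0_norm ?divr_ge0 ?ltW// => ne; apply: H; rewrite divr_gt0//= ltW.
Qed.

Lemma approximable_mul m (C : R) f : smooth_on setT m -> (forall x, `|m x| <= C) ->
  sqint leb2 f -> approximable f -> approximable (fun x => m x * f x).
Proof.
move=> sm mC If Af d d0.
have C0 : 0 <= C by apply: le_trans (mC 0); exact: normr_ge0.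
have C1 : 0 < C + 1 by rewrite ltr_wpDl.
have [phi [sphi [M sM]] H] := Af _ (divr_gt0 d0 C1).
exists (fun x => m x * phi x).
  split; first exact: smoM openT sm sphi.
  by exists M => x /sM ->; rewrite mulr0.
have mm := plane_continuous_measurable (smo_continuousT sm).
have [_] := l2n_mul mm C0 mC (sqintB If (sqint_supp (smo_continuousT sphi) sM)).
rewrite (_ : (fun x => m x * f x) - _ = fun x => m x * (f - phi) x); last first.
  by apply/funext => x; rewrite -[RHS]/(m x * (f x - phi x)) mulrBr.
move=> /le_lt_trans; apply; apply: (@le_lt_trans _ _ ((C + 1) * l2n (f - phi))).
  by rewrite ler_wpM2r ?l2n_ge0// lerDl.
by rewrite mulrC -ltr_pdivlMr.
Qed.

End StrongConvergence.

(** * Integrals of test functions and a Caccioppoli inequality *)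

Section TestIntegrals.
Context {R : realType} (a : R).
Local Notation leb2 := (@lebesgue_measure R \x @lebesgue_measure R)%E.
Implicit Types (f g h m : R * R -> R) (i j : 'I_2) (x y z : R * R).

Lemma test_integrable f : test a f -> leb2.-integrable setT (EFin \o f).
Proof. by move=> tf; have [_ [M _ sM]] := tf; exact: integrable_supp (test_continuous tf) sM. Qed.

Lemma test_intD f g : test a f -> test a g ->
  \int[leb2]_x (f x + g x) = \int[leb2]_x f x + \int[leb2]_x g x.
Proof.
by move=> tf tg; rewrite RintegralD//; exact: test_integrable.
Qed.

Lemma test_intZ (k : R) f : test a f -> \int[leb2]_x (k * f x) = k * \int[leb2]_x f x.
Proof. by move=> tf; rewrite RintegralZl//; exact: test_integrable. Qed.

Lemma test_int_le f g : test a f -> test a g -> (forall x, f x <= g x) ->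
  \int[leb2]_x f x <= \int[leb2]_x g x.
Proof.
by move=> tf tg fg; apply: le_Rintegral => //; exact: test_integrable.
Qed.

Lemma test_int_pd i f : test a f -> \int[leb2]_x pd i f x = 0.
Proof.
move=> tf; have [sf [M _ sM]] := tf; apply: integral_pd0 sM.
  by move=> x; exact: smo_derivable sf I.
exact: test_continuous (test_pd i tf).
Qed.

Lemma test_mul f g : test a f -> test a g -> test a (fun x => f x * g x).
Proof. by move=> tf tg; apply: testMl tf (test_smo tg). Qed.

Lemma test_lap f : test a f -> test a (lap f).
Proof. by move=> tf; apply: testD; do 2 apply: test_pd. Qed.

(** The divergence of c^2 f grad f has integral 0. Adding it to |f grad c|^2 and subtracting c^2 f
    (lap f) leaves |c grad f + f grad c|^2 >= 0. *)
Lemma caccioppoli c f : test a c -> smooth_on setT f ->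
  ip leb2 (fun x => c x * f x) (fun x => c x * lap f x) <=
  ip leb2 (fun x => pd 0 c x * f x) (fun x => pd 0 c x * f x) +
  ip leb2 (fun x => pd 1 c x * f x) (fun x => pd 1 c x * f x).
Proof.
move=> tc sf; have sfD : smooth_on (disc a) f by apply: sub_smo sf.
have sl : smooth_on (disc a) (lap f) by apply: sub_smo (smo_lap sf).
pose X i x := c x * (c x * (f x * pd i f x)).
have spf i : smooth_on setT (fun x => f x * pd i f x) by apply: smoM openT sf (smo_pd i sf).
have scf i : smooth_on setT (fun x => c x * (f x * pd i f x)) by apply: smoM openT tc.1 (spf i).
have tX i : test a (X i).
  by apply: (test_mul tc); apply: (testMl tc); apply: sub_smo (spf i).
have pX i x : pd i (X i) x = pd i c x * (c x * (f x * pd i f x)) +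
    c x * (pd i c x * (f x * pd i f x) + c x * (pd i f x * pd i f x + f x * pd i (pd i f) x)).
  by rewrite (pdM i tc.1 (scf i) I) (pdM i tc.1 (spf i) I) (pdM i sf (smo_pd i sf) I).
have tg i : test a (fun x => (pd i c x * f x) * (pd i c x * f x)).
  by apply: test_mul; apply: (testMl (test_pd i tc) sfD).
have tL : test a (fun x => (c x * f x) * (c x * lap f x)).
  by apply: test_mul; [exact: testMl tc sfD|exact: testMl tc sl].
have tXX := testD (test_pd 0 (tX 0)) (test_pd 1 (tX 1)).
have tgg := testD (tg 0) (tg 1).
apply: le_trans (test_int_le tL (testD tXX tgg) _) _.
  move=> x; have := pX 0 x; have := pX 1 x => -> ->.
  rewrite -subr_ge0; move: (pd 0 c x) (pd 1 c x) (pd 0 f x) (pd 1 f x) => c0 c1 f0 f1.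
  rewrite /lap; move: (pd 0 _ x) (pd 1 _ x) => l0 l1.
  rewrite [X in 0 <= X](_ : _ = (c x * f0 + f x * c0) ^+ 2 + (c x * f1 + f x * c1) ^+ 2).
    by rewrite addr_ge0 ?sqr_ge0.
  by ring.
rewrite (test_intD tXX tgg) (test_intD (test_pd 0 (tX 0)) (test_pd 1 (tX 1))).
have G (u v w t : R) : u = 0 -> v = 0 -> w = t -> u + v + w <= t.
  by move=> -> -> ->; rewrite addr0 add0r.
exact: G (test_int_pd 0 (tX 0)) (test_int_pd 1 (tX 1)) (test_intD (tg 0) (tg 1)).
Qed.

End TestIntegrals.

(** * Vanishing of square integrable solutions *)

Section EllipticVanishing.
Context {R : realType} (a : R).
Local Notation leb2 := (@lebesgue_measure R \x @lebesgue_measure R)%E.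
Local Notation PR := (measurableTypeR R * measurableTypeR R)%type.
Implicit Types (f g h m Q : R * R -> R) (i j : 'I_2) (x y z : R * R).

Lemma test_measurable f : test a f -> measurable_fun (setT : set PR) f.
Proof. by move=> tf; exact: plane_continuous_measurable (test_continuous tf). Qed.

Lemma test_bounded f : test a f -> exists2 C : R, 0 <= C & forall x, `|f x| <= C.
Proof. by move=> tf; have [_ [M _ sM]] := tf; exact: supp_bounded (test_continuous tf) sM. Qed.

Lemma sqint_testM m Q : test a m -> sqint leb2 Q -> sqint leb2 (fun x => m x * Q x).
Proof.
by move=> tm IQ; have [C C0 mC] := test_bounded tm; exact: (l2n_mul (test_measurable tm) C0 mC IQ).1.
Qed.

Lemma approximable_testM m Q : test a m -> sqint leb2 Q -> approximable Q ->
  approximable (fun x => m x * Q x).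
Proof.
move=> tm IQ AQ; have [C C0 mC] := test_bounded tm.
exact: approximable_mul tm.1 mC IQ AQ.
Qed.

Lemma l2cvg_testM m (f_ : nat -> R * R -> R) f : test a m ->
  (forall n, sqint leb2 (f_ n)) -> sqint leb2 f -> l2cvg f_ f ->
  l2cvg (fun n x => m x * f_ n x) (fun x => m x * f x).
Proof.
move=> tm If_ If cf; have [C C0 mC] := test_bounded tm.
exact: l2cvg_mul (test_measurable tm) mC If_ If cf.
Qed.

Lemma smo_kapV : smooth_on (disc a) (fun x => (kap a x)^-1).
Proof.
have oD : open (disc a) by exact: open_disc.
by apply: (smoV oD) (smo_kap a oD); exact: kap_neq0.
Qed.

(* Weak form of [c * q / kap ^+ 2 = lap q] for [q = kap * Q]. *)
Definition weak_elliptic (c : R) Q := forall f, test a f ->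
  ip leb2 Q (fun x => c * ((kap a x)^-1 * f x) - kap a x * lap f x) = 0.

(** The equation says that the Laplacian of kap Q is c Q / kap, so the two products are mollified
    separately and no commutator appears. The step function [th] makes both products square
    integrable on the plane; it equals 1 wherever the kernel reaches. *)
Lemma mol_elliptic (c : R) Q M : sqint leb2 Q -> weak_elliptic c Q -> a ^+ 2 * M < 4 ->
  exists2 r : R, 0 < r & exists2 th, test a th /\ (forall x, sqnorm x <= M -> th x = 1) &
    forall (e : R) x, 0 < e < r -> sqnorm x <= M ->
      lap (mol e (fun y => (kap a y * th y) * Q y)) x =
      mol e (fun y => (c * ((kap a y)^-1 * th y)) * Q y) x.
Proof.
move=> IQ HQ aM; have [r r0 [M1' aM1' HM']] := good_radius aM.
have oD : open (disc a) by exact: open_disc.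
(* The maximum makes [th] equal to 1 both at the points x considered and on the supports of the
   kernels centred there. *)
pose M1 := Num.max M M1'.
have aM1 : a ^+ 2 * M1 < 4 by rewrite /M1; case: (leP M M1').
have HM x z : sqnorm x <= M -> sqnorm z <= r ^+ 2 -> sqnorm (x - z) <= M1.
  by move=> xM zr; rewrite le_max (HM' x z xM zr) orbT.
have [th tth th1] := test_step aM1; exists r; first exact: r0.
exists th; first by split=> // x xM; apply: th1; rewrite le_max xM.
move=> e x /andP[e0 er] xM.
have tk : test a (fun y => kap a y * th y) by apply: testMr tth (smo_kap a oD).
have tv : test a (fun y => c * ((kap a y)^-1 * th y)).
  by apply: testZ; apply: testMr tth smo_kapV.
set F := fun y => kap a y * th y * Q y; set G := fun y => c * _ * Q y.
have IF : sqint leb2 F by exact: sqint_testM tk IQ.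
have IG : sqint leb2 G by exact: sqint_testM tv IQ.
have lF := sqint_locint IF.
pose psi y := nmk e (x - y).
have spsi : supp M1 psi.
  move=> y My; apply: (supp_nmk e0); rewrite ltNge; apply/negP => ye.
  have yr : sqnorm (x - y) <= r ^+ 2.
    by apply: le_trans ye _; rewrite lerXn2r ?nnegrE ?ltW.
  by have := HM x (x - y) xM yr; rewrite opprB addrCA subrr addr0 leNgt My.
have tpsi : test a psi.
  by split; [exact: smo_reflect (smo_nmk e)|exists M1].
have sK := smo_nmk e; have uK := supp_nmk e0.
have E1 i : pd i (pd i (mol e F)) x = ip leb2 (pd i (pd i psi)) F.
  rewrite /mol (pd_convol i sK uK lF) (pd_convol i (smo_pd i sK) (supp_pd i uK) lF).
  apply: eq_Rintegral => y _.
  have Gm (u v w : R) : u = v -> v * w = u * w by move=> ->.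
  exact: Gm (F y) (pd_reflect2 x i y sK).
have Ipp i : sqint leb2 (pd i (pd i psi)) by exact: test_sqint (test_pd i (test_pd i tpsi)).
have E2 : lap (mol e F) x = ip leb2 Q (fun y => kap a y * lap psi y).
  have G2 (u v u' v' w : R) : u = u' -> v = v' -> u' + v' = w -> u + v = w by move=> -> -> ->.
  apply: G2 (E1 0) (E1 1) _; rewrite -(ipD (Ipp 0) (Ipp 1) IF).
  apply: eq_Rintegral => y _; rewrite -[LHS]/(lap psi y * F y) /F.
  have [yM|yM] := leP (sqnorm y) M1.
    by rewrite (th1 y yM); move: (lap psi y) => u; ring.
  by rewrite (supp_lap spsi yM) !(mul0r, mulr0).
have E3 : mol e G x = ip leb2 Q (fun y => c * ((kap a y)^-1 * psi y)).
  apply: eq_Rintegral => y _; rewrite -[LHS]/(psi y * G y) /G.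
  have [yM|yM] := leP (sqnorm y) M1.
    by rewrite (th1 y yM); move: (psi y) => u; ring.
  by rewrite (spsi y yM) !(mul0r, mulr0).
rewrite E2 E3; have := HQ _ tpsi.
have I1 : sqint leb2 (fun y => c * ((kap a y)^-1 * psi y)).
  by apply: (@test_sqint _ a); apply: testZ; apply: testMr tpsi smo_kapV.
have I2 : sqint leb2 (fun y => kap a y * lap psi y).
  by apply: (@test_sqint _ a); apply: testMr (test_lap tpsi) (smo_kap a oD).
have := ipBr I1 I2 IQ => -> /subr0_eq -> //.
Qed.

(** Caccioppoli's inequality is applied to the mollification of kap Q, whose Laplacian on the
    support of the cutoff is the mollification of c Q / kap. The radius then tends to 0 with n
    fixed, and each of the two directions contributes at most C |Q|^2. *)
Lemma chi_energy (c : R) Q n (C : R) : sqint leb2 Q -> approximable Q ->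
  weak_elliptic c Q -> 0 <= C ->
  (forall i x, (kap a x * pd i (chi a n) x) ^+ 2 <= C) ->
  c * ip leb2 (fun x => chi a n x * Q x) (fun x => chi a n x * Q x) <=
  2 * C * ip leb2 Q Q.
Proof.
move=> IQ AQ HQ C0 HC; have tc := test_chi a n; have [sc [M aM sM]] := tc.
have oD : open (disc a) by exact: open_disc.
have [r r0 [th [tth th1] Hr]] := mol_elliptic IQ HQ aM.
have tk : test a (fun y => kap a y * th y) by apply: testMr tth (smo_kap a oD).
have tv : test a (fun y => c * ((kap a y)^-1 * th y)).
  by apply: testZ; apply: testMr tth smo_kapV.
pose F y := kap a y * th y * Q y; pose G y := c * ((kap a y)^-1 * th y) * Q y.
have IF : sqint leb2 F by exact: sqint_testM tk IQ.
have IG : sqint leb2 G by exact: sqint_testM tv IQ.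
have AF : approximable F by exact: approximable_testM tk IQ AQ.
have AG : approximable G by exact: approximable_testM tv IQ AQ.
pose e (k : nat) : R := r / k.+2%:R.
have e0 k : 0 < e k by rewrite divr_gt0.
have er k : 0 < e k < r by rewrite e0 /= ltr_pdivrMr// ltr_pMr// ltr1n.
have cF : l2cvg (fun k => mol (e k) F) F by exact: mol_l2cvg.
have cG : l2cvg (fun k => mol (e k) G) G by exact: mol_l2cvg.
have ImF k : sqint leb2 (mol (e k) F) by exact: sqint_mol (e0 k) IF.
have ImG k : sqint leb2 (mol (e k) G) by exact: sqint_mol (e0 k) IG.
have td i := test_pd i tc.
have L1 := l2cvg_ip (fun k => sqint_testM tc (ImF k)) (sqint_testM tc IF)
  (fun k => sqint_testM tc (ImG k)) (sqint_testM tc IG)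
  (l2cvg_testM tc ImF IF cF) (l2cvg_testM tc ImG IG cG).
have L2 i := l2cvg_ip (fun k => sqint_testM (td i) (ImF k)) (sqint_testM (td i) IF)
  (fun k => sqint_testM (td i) (ImF k)) (sqint_testM (td i) IF)
  (l2cvg_testM (td i) ImF IF cF) (l2cvg_testM (td i) ImF IF cF).
have le_k k : ip leb2 (fun x => chi a n x * mol (e k) F x) (fun x => chi a n x * mol (e k) G x) <=
    ip leb2 (fun x => pd 0 (chi a n) x * mol (e k) F x) (fun x => pd 0 (chi a n) x * mol (e k) F x) +
    ip leb2 (fun x => pd 1 (chi a n) x * mol (e k) F x) (fun x => pd 1 (chi a n) x * mol (e k) F x).
  apply: le_trans (caccioppoli tc (smo_mol (e0 k) (sqint_locint IF))).
  rewrite le_eqVlt; apply/orP; left; apply/eqP; apply: eq_Rintegral => x _.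
  have [xM|xM] := leP (sqnorm x) M; last first.
    have G0 (u v w t : R) : u = 0 -> (u * v) * (u * w) = (u * v) * (u * t).
      by move=> ->; rewrite !mul0r.
    exact: G0 (sM x xM).
  have Gm (u v w t : R) : w = t -> u * (v * t) = u * (v * w) by move=> ->.
  exact: Gm (Hr (e k) x (er k) xM).
have := ler_cvg_to L1 (cvgD (L2 0) (L2 1)) (nearW _ le_k).
(* Where the cutoff is nonzero, the product of F = kap Q and G = c Q / kap is c Q^2. *)
have -> : ip leb2 (fun x => chi a n x * F x) (fun x => chi a n x * G x) =
    c * ip leb2 (fun x => chi a n x * Q x) (fun x => chi a n x * Q x).
  have IcQ := sqint_testM tc IQ; rewrite -(ipZ c IcQ IcQ).
  apply: eq_Rintegral => x _; rewrite -[RHS]/(c * (chi a n x * Q x) * (chi a n x * Q x)).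
  have [xM|xM] := leP (sqnorm x) M; last by rewrite (sM x xM) !(mul0r, mulr0).
  rewrite /F /G (th1 x xM); have := kap_neq0 (sqnorm_le_disc aM xM).
  by move: (kap a x) => k k0; field.
move=> /(_ _ _ _) /le_trans; apply; rewrite mulrDl mul1r mulrDl.
have I2 i : ip leb2 (fun x => pd i (chi a n) x * F x) (fun x => pd i (chi a n) x * F x) <=
    C * ip leb2 Q Q.
  have IZ := sqintZ (Num.sqrt C) IQ.
  have -> : C * ip leb2 Q Q = ip leb2 (Num.sqrt C *: Q) (Num.sqrt C *: Q).
    by rewrite (ipZ _ IQ IZ) ipC (ipZ _ IQ IQ) mulrA -expr2 sqr_sqrtr.
  apply: (ip_le (sqint_testM (td i) IF) IZ).
  move=> x; rewrite -[X in _ <= X ^+ 2]/(Num.sqrt C * Q x) [leRHS]exprMn sqr_sqrtr//.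
  have [xM|xM] := leP (sqnorm x) M; last first.
    by rewrite (supp_pd i sM xM) mul0r expr0n/= mulr_ge0// sqr_ge0.
  rewrite /F (th1 x xM) mulr1.
  have G3 (u v w : R) : (v * u) ^+ 2 <= C -> (u * (v * w)) ^+ 2 <= C * w ^+ 2.
    by move=> H; rewrite mulrA [u * v]mulrC exprMn ler_wpM2r ?sqr_ge0.
  exact: G3 (HC i x).
exact: lerD (I2 0) (I2 1).
Qed.

(** The energies of [chi a n] times Q are bounded by a constant over (n + 1)^2, and these functions
    tend pointwise to Q on the disc; Fatou's lemma concludes. *)
Theorem elliptic_vanishing (c : R) Q : 0 < c -> sqint leb2 Q -> approximable Q ->
  weak_elliptic c Q -> {ae leb2, forall x, disc a x -> Q x = 0}.
Proof.
move=> c0 IQ AQ HQ; have [C C0 HC] := chi_gradient a.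
pose h x := \1_(disc a) x * Q x.
have mD : measurable (disc a : set PR) by apply: open_plane_measurable; exact: open_disc.
have mh : measurable_fun (setT : set PR) h.
  by apply: measurable_funM IQ.1; exact: measurable_indic.
have Ih : sqint leb2 h.
  apply: (sqint_dominated mh IQ) => x; rewrite /h indicE; case: (_ \in _); rewrite ?mul1r//.
  by rewrite mul0r expr0n sqr_ge0.
have I n : sqint leb2 (fun x => chi a n x * Q x) by exact: sqint_testM (test_chi a n) IQ.
have hcvg x : (fun n => chi a n x * Q x) @ \oo --> h x.
  rewrite /h indicE; apply: cvgMr_tmp; case: (boolP (x \in _)) => [/set_mem Dx|Dx].
    exact: chi_cvg Dx.
  rewrite (_ : chi a ^~ x = cst 0); first exact: cvg_cst.
  apply/funext => n; apply: test_out (test_chi a n) _ => Dx'.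
  by move/negP: Dx; apply; exact: mem_set.
have bound n : ip leb2 (fun x => chi a n x * Q x) (fun x => chi a n x * Q x) <=
    (c^-1 * (2 * C * ip leb2 Q Q)) * n.+1%:R^-1 ^+ 2.
  rewrite -mulrA ler_pdivlMl//.
  apply: le_trans (chi_energy IQ AQ HQ _ (HC n)) _; first by rewrite mulr_ge0 ?sqr_ge0.
  by rewrite le_eqVlt; apply/orP; left; apply/eqP; ring.
have bcvg : (fun n => (c^-1 * (2 * C * ip leb2 Q Q)) * n.+1%:R^-1 ^+ 2) @ \oo --> (0 : R).
  rewrite -[X in _ --> X](mulr0 (c^-1 * (2 * C * ip leb2 Q Q))).
  apply: cvgMl_tmp; rewrite -[X in _ --> X](expr0n R 2).
  by under eq_fun do rewrite expr2; rewrite expr2; apply: cvgM; exact: cvg_harmonic.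
have h0 : ip leb2 h h = 0.
  apply/eqP; rewrite eq_le ip_ge0 andbT; apply/ler_addgt0Pr => d d0; rewrite add0r.
  rewrite -lee_fin (ip_EFin Ih).
  apply: (fatou_sqr (fun n => (I n).1) hcvg).
  move/cvgr0Pnorm_lt: bcvg => /(_ _ d0); apply: filterS => n nd.
  rewrite -(ip_EFin (I n)) lee_fin; apply: le_trans (bound n) _.
  by apply: ltW; apply: le_lt_trans nd; exact: ler_norm.
apply: ae_imp (ip_eq0_ae Ih h0) => x hx Dx; move: hx.
by rewrite /h indicE mem_set// mul1r.
Qed.

End EllipticVanishing.

(** * Bochner's formula *)

Section DiscGeometry.
Context {R : realType} (a : R).
Local Notation leb2 := (@lebesgue_measure R \x @lebesgue_measure R)%E.
Local Notation PR := (measurableTypeR R * measurableTypeR R)%type.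
Implicit Types (f g h m : R * R -> R) (i j : 'I_2) (x y z : R * R).
Implicit Types (u v w : 'I_2 -> R * R -> R).

(** Values outside the disc being arbitrary, extension by 0 turns integrals over the disc into
    integrals over the plane and compactly supported forms into test functions. *)
Definition zext f : R * R -> R := f \_ (disc a).
Definition zext1 u i : R * R -> R := zext (u i).

Lemma zextE f x : disc a x -> zext f x = f x.
Proof. by move=> Dx; rewrite /zext patchE mem_set. Qed.

Lemma zext_out f x : ~ disc a x -> zext f x = 0.
Proof. by move=> Dx; rewrite /zext patchE memNset. Qed.

Lemma zext_eq f : {in disc a, zext f =1 f}.
Proof. by move=> y /set_mem; exact: zextE. Qed.

Lemma measurable_disc : measurable (disc a : set PR).
Proof. by apply: open_plane_measurable; exact: open_disc. Qed.

Lemma measurable_zext f : measurable_fun (setT : set PR) (zext f) <->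
  measurable_fun (disc a : set PR) f.
Proof. by split=> H; apply/(measurable_restrictT f measurable_disc). Qed.

Lemma metricE x : metric a x = ((kap a x)^-1 ^+ 2)%:M.
Proof. by []. Qed.

Lemma cometricE x : cometric a x = (kap a x ^+ 2)%:M.
Proof. by rewrite /cometric metricE invmx_scalar exprVn invrK. Qed.

Lemma volE x : disc a x -> vol a x = (kap a x)^-1 ^+ 2.
Proof.
move=> Dx; rewrite /vol metricE det_scalar sqrtr_sqr ger0_norm//.
by rewrite sqr_ge0.
Qed.

Lemma cometric_diag i j x : cometric a x i j = kap a x ^+ 2 * (i == j)%:R.
Proof. by rewrite cometricE mxE mulr_natr. Qed.

Lemma sum2 (F : 'I_2 -> R) : \sum_(i < 2) F i = F 0 + F 1.
Proof.
rewrite big_ord_recl big_ord1; congr (F _ + F _); exact: val_inj.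
Qed.

Lemma contract1E u v x : contract1 a u v x = kap a x ^+ 2 * (u 0 x * v 0 x + u 1 x * v 1 x).
Proof.
rewrite /contract1 !sum2 !cometric_diag/=.
by move: (u 0 x) (u 1 x) (v 0 x) (v 1 x) => p q r s; ring.
Qed.

Lemma kap_vol x : disc a x -> kap a x ^+ 2 * vol a x = 1.
Proof. by move=> Dx; rewrite volE// exprVn mulfV// expf_neq0// kap_neq0. Qed.

Lemma contract1_vol u v x : disc a x ->
  contract1 a u v x * vol a x = u 0 x * v 0 x + u 1 x * v 1 x.
Proof.
by move=> Dx; rewrite contract1E mulrAC kap_vol// mul1r.
Qed.

Lemma integral0E f g : (forall x, disc a x -> f x * vol a x = g x) ->
  integral0 a f = \int[leb2]_x zext g x.
Proof.
move=> fg; rewrite /integral0 Rintegral_mkcond; apply: eq_Rintegral => x _.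
have [Dx|Dx] := pselect (disc a x); last by rewrite zext_out// patchE memNset.
by rewrite zextE// patchE mem_set// fg.
Qed.

Lemma zext_mulD u v x : zext (fun x => u 0 x * v 0 x + u 1 x * v 1 x) x =
  zext (u 0) x * zext (v 0) x + zext (u 1) x * zext (v 1) x.
Proof.
have [Dx|Dx] := pselect (disc a x); first by rewrite !zextE.
by rewrite !zext_out// !mul0r addr0.
Qed.

Lemma L2P u : L2 a u <-> forall i, sqint leb2 (zext1 u i).
Proof.
split=> [[mu Iu] i|Iu].
  have mc k : measurable_fun (setT : set PR) (zext (u k)) by apply/measurable_zext; exact: mu.
  split; first exact: mc.
  have I2 : leb2.-integrable setT (EFin \o (fun x => zext (u 0) x * zext (u 0) x + zext (u 1) x * zext (u 1) x)).
    move/(integrable_mkcond _ measurable_disc): Iu; apply: eq_integrable => // x _.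
    have [Dx|Dx] := pselect (disc a x); last first.
      by rewrite patchE memNset//= !zext_out// mul0r addr0.
    by rewrite patchE mem_set//= contract1_vol// !zextE.
  apply: le_integrable I2 => //.
    by apply/measurable_EFinP; apply: measurable_funX; exact: mc.
  move=> x _ /=; rewrite lee_fin !ger0_norm ?sqr_ge0//; last first.
    by rewrite addr_ge0// -expr2 sqr_ge0.
  by rewrite -!expr2 /zext1; case: (I2P i) => ->; rewrite ?lerDl ?lerDr sqr_ge0.
split=> [i|]; first by apply/measurable_zext; exact: (Iu i).1.
apply/(integrable_mkcond _ measurable_disc).
have := integrable_add (sqint_mul (Iu 0) (Iu 0)) (sqint_mul (Iu 1) (Iu 1)).
apply: eq_integrable => // x _.
have [Dx|Dx] := pselect (disc a x); last first.
  by rewrite patchE memNset//= /zext1 !zext_out// mul0r addr0.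
by rewrite patchE mem_set//= contract1_vol// /zext1 !zextE.
Qed.

Definition ip1 u v : R := ip leb2 (u 0) (v 0) + ip leb2 (u 1) (v 1).

Lemma inner1E u v : (forall i, sqint leb2 (zext1 u i)) -> (forall i, sqint leb2 (zext1 v i)) ->
  inner1 a u v = ip1 (zext1 u) (zext1 v).
Proof.
move=> Iu Iv; rewrite /inner1 (integral0E (contract1_vol u v)).
rewrite /ip1 /ip -RintegralD//; [|exact: sqint_mul|exact: sqint_mul].
by apply: eq_Rintegral => x _; exact: zext_mulD.
Qed.

Lemma pd_zext f i x : disc a x -> pd i (zext f) x = pd i f x.
Proof. have oD : open (disc a) by exact: open_disc.
by move=> Dx; exact: (eq_on_pd i oD (@zext_eq f) Dx). Qed.

Lemma compact_in_disc K : compact K -> K `<=` disc a ->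
  exists2 M : R, a ^+ 2 * M < 4 & forall x, K x -> sqnorm x <= M.
Proof.
move=> cK KD; have [->|K0] := eqVneq K set0.
  by exists 0; [rewrite mulr0|move=> x []].
have cs : {within K, continuous (@sqnorm R)}.
  by apply: continuous_subspaceT; exact: continuous_sqnorm.
have /set0P K1 := K0; have [c cK' mc] := compact_EVT_max K1 cK cs.
exists (sqnorm c); first exact: KD (set_mem cK').
by move=> x Kx; apply: mc; exact: mem_set.
Qed.

Lemma compact_ball M : compact [set x : R * R | sqnorm x <= M].
Proof.
have cl : closed [set x : R * R | sqnorm x <= M].
  rewrite (_ : [set _ | _] = sqnorm @^-1` [set t : R | t <= M])//.
  by apply: preimage_closed; [move=> x _; exact: continuous_sqnorm|exact: closed_le].
have := compact_closedI (@compact_box R (M + 1)) cl; rewrite setIidr//.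
by move=> x; exact: box_supp.
Qed.

Lemma zext_is_test f : smooth a f -> compactly_supported a f -> test a (zext f).
Proof.
move=> /smoothE sf [K [cK KD K0]]; have [M aM KM] := compact_in_disc cK KD.
apply: (test_local aM).
  move=> x xM; have [Dx|Dx] := pselect (disc a x); last by rewrite zext_out.
  by rewrite zextE// K0// => /KM; rewrite leNgt xM.
apply: (@eq_smo _ _ f); [exact: open_disc| |exact: sf].
by move=> x /set_mem Dx; rewrite zextE.
Qed.

Lemma test_smooth f : test a f -> smooth a f /\ compactly_supported a f.
Proof.
move=> tf; split; first by apply/smoothE; exact: test_smo.
have [_ [M aM sM]] := tf; exists [set x | sqnorm x <= M]; split.
- exact: compact_ball.
- by move=> x; exact: sqnorm_le_disc.
- by move=> x _ /= /negP; rewrite -ltNge; exact: sM.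
Qed.

Lemma zext_test f : test a f -> zext f = f.
Proof.
move=> tf; apply/funext => x; have [Dx|Dx] := pselect (disc a x); first exact: zextE.
by rewrite zext_out// (test_out tf Dx).
Qed.

End DiscGeometry.

(** * The connection in the chart and the integrated Bochner formula *)

Section Bochner.
Context {R : realType} (a : R).
Local Notation leb2 := (@lebesgue_measure R \x @lebesgue_measure R)%E.
Implicit Types (f g h m : R * R -> R) (i j k : 'I_2) (x y z : R * R).
Implicit Types (u v w : 'I_2 -> R * R -> R).

Lemma pd_metric i j l x : disc a x ->
  pd i (fun y => metric a y j l) x =
  (kap a x)^-1 ^+ 3 * (a ^+ 2 * crd i x) * (j == l)%:R.
Proof.
move=> Dx; have oD : open (disc a) by exact: open_disc.
have sV := smo_kapV a.
have -> : (fun y => metric a y j l) =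
    fun y => (j == l)%:R * ((kap a y)^-1 * (kap a y)^-1).
  by apply/funext => y; rewrite metricE mxE -expr2 mulr_natl.
rewrite (pdZ _ i (smoM oD sV sV) Dx) (pdM i sV sV Dx).
(* Obtained by differentiating kap times its inverse, which is 1 on the disc. *)
have -> : pd i (fun y => (kap a y)^-1) x = (kap a x)^-1 ^+ 2 * (a ^+ 2 * crd i x / 2).
  have k0 := kap_neq0 Dx.
  have E1 : {in disc a, (fun y => kap a y * (kap a y)^-1) =1 cst 1}.
    by move=> y /set_mem Dy; rewrite mulfV// kap_neq0.
  have := eq_on_pd i oD E1 Dx; rewrite pd_cst (pdM i (smo_kap a oD) sV Dx) pd_kap => E2.
  apply: (mulfI k0); move: (pd _ _ _) E2 => d E2; rewrite -[LHS](addKr (- (a ^+ 2 * crd i x / 2) / kap a x)) E2.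
  by field.
by case: (j == l); rewrite ?mul0r ?mulr0 ?mul1r ?mulr1//; field; exact: kap_neq0.
Qed.

(** This is the formula for a conformal metric exp(2 phi) with phi = - ln kap, whose derivatives are
    a^2 x_i / (2 kap). *)
Lemma christoffelE k i j x : disc a x ->
  kap a x * christoffel a k i j x = a ^+ 2 / 2 *
  (crd i x * (j == k)%:R + crd j x * (i == k)%:R - crd k x * (i == j)%:R).
Proof.
move=> Dx; rewrite /christoffel sum2 !cometric_diag !(pd_metric _ _ _ Dx).
have k0 := kap_neq0 Dx.
by case: (I2P k) => ->; case: (I2P i) => ->; case: (I2P j) => -> /=; field.
Qed.

Lemma nablaE u i j x : disc a x -> kap a x * nabla a u i j x =
  kap a x * pd i (u j) x - a ^+ 2 / 2 *
  (crd i x * u j x + crd j x * u i x - (i == j)%:R * (crd 0 x * u 0 x + crd 1 x * u 1 x)).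
Proof.
move=> Dx; have := christoffelE 0 i j Dx; have := christoffelE 1 i j Dx.
rewrite /nabla sum2; move: (pd i (u j) x) (christoffel _ _ _ _ _) (christoffel _ _ _ _ _).
move=> p c0 c1 E1 E0; rewrite [LHS](_ : _ = kap a x * p -
  (kap a x * c0 * u 0 x + kap a x * c1 * u 1 x)); last by ring.
rewrite E0 E1.
by case: (I2P i) => ->; case: (I2P j) => -> /=; ring.
Qed.

Lemma contract2_vol S x : disc a x -> contract2 a S S x * vol a x =
  ((kap a x * S 0 0 x) ^+ 2 + (kap a x * S 0 1 x) ^+ 2) +
  ((kap a x * S 1 0 x) ^+ 2 + (kap a x * S 1 1 x) ^+ 2).
Proof.
move=> Dx; rewrite /contract2 !sum2 !cometric_diag/= volE//.
have k0 := kap_neq0 Dx.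
by move: (S 0 0 x) (S 0 1 x) (S 1 0 x) (S 1 1 x) => p q r s; field.
Qed.

Definition div1 u x := pd 0 (u 0) x + pd 1 (u 1) x.

(** By [nablaE] this is kap times the covariant derivative, but written without any division: it
    makes sense on the whole plane and is a test function when u is. *)
Definition cnab u i j x := kap a x * pd i (u j) x - a ^+ 2 / 2 *
  (crd i x * u j x + crd j x * u i x - (i == j)%:R * (crd 0 x * u 0 x + crd 1 x * u 1 x)).

Definition test1 u := forall i, test a (u i).

Lemma test_kap f : test a f -> test a (fun x => kap a x * f x).
Proof. by move=> tf; apply: testMr tf (smo_kap a (@open_disc _ a)). Qed.

Lemma test_crd i f : test a f -> test a (fun x => crd i x * f x).
Proof. by move=> tf; apply: testMr tf _; apply: smo_crd; exact: open_disc. Qed.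

Lemma test_cnab u i j : test1 u -> test a (cnab u i j).
Proof.
move=> tu; apply: testB; first exact: test_kap (test_pd i (tu j)).
apply: testZ; apply: testB; first by apply: testD; exact: test_crd (tu _).
by apply: testZ; apply: testD; exact: test_crd (tu _).
Qed.

(* [crd i x * a ^+ 2 / 2] is minus the gradient of [kap a]: the divergence of
   this field turns the full gradient of a 1-form into its exterior derivative
   and its codifferential, the Ricci curvature producing [a ^+ 2 * |w|^2]. *)
Definition bochner_field w i x : R := let j := 1 - i in
  kap a x * (kap a x * (w j x * pd j (w i) x - w i x * pd j (w j) x)) -
  kap a x * (a ^+ 2 / 2 * (crd i x * (w 0 x * w 0 x + w 1 x * w 1 x))).

Lemma test_bochner_field w i : test1 w -> test a (bochner_field w i).
Proof.
move=> tw; apply: testB; apply: test_kap.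
  by apply: test_kap; apply: testB; apply: test_mul; [exact: tw|exact: test_pd (tw _)|exact: tw|exact: test_pd (tw _)].
by apply: testZ; apply: test_crd; apply: testD; apply: test_mul; exact: tw.
Qed.

Lemma pd_bochner_field w i x : test1 w -> let j := 1 - i in
  pd i (bochner_field w i) x =
  - (a ^+ 2 * crd i x / 2) * (kap a x * (w j x * pd j (w i) x - w i x * pd j (w j) x)) +
  kap a x * (- (a ^+ 2 * crd i x / 2) * (w j x * pd j (w i) x - w i x * pd j (w j) x) +
   kap a x * ((pd i (w j) x * pd j (w i) x + w j x * pd i (pd j (w i)) x) -
              (pd i (w i) x * pd j (w j) x + w i x * pd i (pd j (w j)) x))) -
  (- (a ^+ 2 * crd i x / 2) * (a ^+ 2 / 2 * (crd i x * (w 0 x * w 0 x + w 1 x * w 1 x))) +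
   kap a x * (a ^+ 2 / 2 * ((w 0 x * w 0 x + w 1 x * w 1 x) + crd i x *
     ((pd i (w 0) x * w 0 x + w 0 x * pd i (w 0) x) +
      (pd i (w 1) x * w 1 x + w 1 x * pd i (w 1) x))))).
Proof.
move=> tw j.
have sk : smooth_on setT (kap a) by exact: smo_kap openT.
have sc : smooth_on setT (@crd R i) by exact: smo_crd openT.
have sw k : smooth_on setT (w k) := (tw k).1.
have sp k l : smooth_on setT (pd k (w l)) := smo_pd k (sw l).
have sA k l k' : smooth_on setT (fun x => w k x * pd l (w k') x) := smoM openT (sw k) (sp l k').
have sB : smooth_on setT (fun x => w j x * pd j (w i) x - w i x * pd j (w j) x) := smoB openT (sA j j i) (sA i j j).
have sC : smooth_on setT (fun x => kap a x * (w j x * pd j (w i) x - w i x * pd j (w j) x)) := smoM openT sk sB.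
have sN k : smooth_on setT (fun x => w k x * w k x) := smoM openT (sw k) (sw k).
have sNN : smooth_on setT (fun x => w 0 x * w 0 x + w 1 x * w 1 x) := smoD openT (sN 0) (sN 1).
have sD : smooth_on setT (fun x => crd i x * (w 0 x * w 0 x + w 1 x * w 1 x)) := smoM openT sc sNN.
have sE := smoZ (a ^+ 2 / 2) openT sD.
rewrite /bochner_field (pdB i (smoM openT sk sC) (smoM openT sk sE) I).
rewrite (pdM i sk sC I) (pdM i sk sB I) (pdM i sk sE I) pd_kap.
rewrite (pdB i (sA j j i) (sA i j j) I) (pdM i (sw j) (sp j i) I) (pdM i (sw i) (sp j j) I).
rewrite (pdZ _ i sD I) (pdM i sc sNN I) pd_crd eqxx mul1r.
by rewrite (pdD i (sN 0) (sN 1) I) (pdM i (sw 0) (sw 0) I) (pdM i (sw 1) (sw 1) I).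
Qed.

(** Here k is [kap], c is a^2, pij is the derivative of u_j along i, and q00, q01 are the mixed
    second derivatives of u_0 and u_1, which cancel between the two divergence terms. The hypothesis
    is the definition of [kap]. *)
Lemma bochner_algebra (k c x0 x1 u0 u1 p00 p01 p10 p11 q00 q01 : R) :
  4 * (1 - k) = c * (x0 * x0 + x1 * x1) ->
  ((k * p00 - c / 2 * (x0 * u0 + x0 * u0 - 1 * (x0 * u0 + x1 * u1))) ^+ 2 +
   (k * p01 - c / 2 * (x0 * u1 + x1 * u0 - 0 * (x0 * u0 + x1 * u1))) ^+ 2) +
  ((k * p10 - c / 2 * (x1 * u0 + x0 * u1 - 0 * (x0 * u0 + x1 * u1))) ^+ 2 +
   (k * p11 - c / 2 * (x1 * u1 + x1 * u1 - 1 * (x0 * u0 + x1 * u1))) ^+ 2) =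
  ((k * (p01 - p10)) * (k * (p01 - p10)) + (k * (p00 + p11)) * (k * (p00 + p11))) +
  (c * (u0 * u0 + u1 * u1) +
  ((- (c * x0 / 2) * (k * (u1 * p10 - u0 * p11)) +
    k * (- (c * x0 / 2) * (u1 * p10 - u0 * p11) +
     k * ((p01 * p10 + u1 * q00) - (p00 * p11 + u0 * q01))) -
    (- (c * x0 / 2) * (c / 2 * (x0 * (u0 * u0 + u1 * u1))) +
     k * (c / 2 * ((u0 * u0 + u1 * u1) + x0 * ((p00 * u0 + u0 * p00) + (p01 * u1 + u1 * p01)))))) +
   (- (c * x1 / 2) * (k * (u0 * p01 - u1 * p00)) +
    k * (- (c * x1 / 2) * (u0 * p01 - u1 * p00) +
     k * ((p10 * p01 + u0 * q01) - (p11 * p00 + u1 * q00))) -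
    (- (c * x1 / 2) * (c / 2 * (x1 * (u0 * u0 + u1 * u1))) +
     k * (c / 2 * ((u0 * u0 + u1 * u1) + x1 * ((p10 * u0 + u0 * p10) + (p11 * u1 + u1 * p11)))))))).
Proof.
move=> H; have -> : k = 1 - c * (x0 * x0 + x1 * x1) / 4 by lra.
by field.
Qed.

Definition kcurl w x := kap a x * d1 w x.
Definition kdiv w x := kap a x * div1 w x.

Lemma test_kcurl w : test1 w -> test a (kcurl w).
Proof. by move=> tw; apply: test_kap; apply: testB; exact: test_pd (tw _). Qed.

Lemma test_kdiv w : test1 w -> test a (kdiv w).
Proof. by move=> tw; apply: test_kap; apply: testD; exact: test_pd (tw _). Qed.

(** By [inner_H1E] its quadratic form is the squared H^1 norm of a compactly supported form. Since
    only curl and divergence occur besides u itself, orthogonality to coexact forms becomes a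
    condition on the curl alone. *)
Definition hform u v : R :=
  (1 + a ^+ 2) * ip1 u v + (ip leb2 (kcurl u) (kcurl v) + ip leb2 (kdiv u) (kdiv v)).

Lemma cnab_bochner w x : test1 w ->
  (cnab w 0 0 x ^+ 2 + cnab w 0 1 x ^+ 2) + (cnab w 1 0 x ^+ 2 + cnab w 1 1 x ^+ 2) =
  (kcurl w x * kcurl w x + kdiv w x * kdiv w x) +
  (a ^+ 2 * (w 0 x * w 0 x + w 1 x * w 1 x) +
   (pd 0 (bochner_field w 0) x + pd 1 (bochner_field w 1) x)).
Proof.
move=> tw; have sw k : smooth_on setT (w k) := (tw k).1.
have := pd_bochner_field 0 x tw; have := pd_bochner_field 1 x tw.
rewrite subr0 subrr /= => E1 E0.
have G (l A B p q p' q' : R) : p = p' -> q = q' -> l = A + (B + (p' + q')) -> l = A + (B + (p + q)).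
  by move=> -> ->.
apply: (G _ _ _ _ _ _ _ E0 E1).
rewrite (pdC openT (sw 0) I) (pdC openT (sw 1) I).
rewrite /cnab /kcurl /kdiv /div1 /d1 /=; apply: bochner_algebra.
by rewrite /kap sqnormE; field.
Qed.

Lemma bochner w : test1 w ->
  \int[leb2]_x ((cnab w 0 0 x ^+ 2 + cnab w 0 1 x ^+ 2) +
    (cnab w 1 0 x ^+ 2 + cnab w 1 1 x ^+ 2)) =
  a ^+ 2 * ip1 w w + (ip leb2 (kcurl w) (kcurl w) + ip leb2 (kdiv w) (kdiv w)).
Proof.
move=> tw.
have tX i := test_bochner_field i tw.
have tc := test_mul (test_kcurl tw) (test_kcurl tw).
have td := test_mul (test_kdiv tw) (test_kdiv tw).
have tn i := test_mul (tw i) (tw i).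
have tN := testD (tn 0) (tn 1).
have tXX := testD (test_pd 0 (tX 0)) (test_pd 1 (tX 1)).
have -> : \int[leb2]_x ((cnab w 0 0 x ^+ 2 + cnab w 0 1 x ^+ 2) +
    (cnab w 1 0 x ^+ 2 + cnab w 1 1 x ^+ 2)) = \int[leb2]_x (
  (kcurl w x * kcurl w x + kdiv w x * kdiv w x) +
  (a ^+ 2 * (w 0 x * w 0 x + w 1 x * w 1 x) +
   (pd 0 (bochner_field w 0) x + pd 1 (bochner_field w 1) x))).
  by apply: eq_Rintegral => x _; exact: cnab_bochner.
rewrite (test_intD (testD tc td) (testD (testZ (a ^+ 2) tN) tXX)) (test_intD tc td).
rewrite (test_intD (testZ (a ^+ 2) tN) tXX) (test_intZ (a ^+ 2) tN) (test_intD (tn 0) (tn 1)).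
rewrite (test_intD (test_pd 0 (tX 0)) (test_pd 1 (tX 1))).
have G (u v p q : R) : p = 0 -> q = 0 -> u + (v + (p + q)) = v + u.
  by move=> -> ->; rewrite !addr0 addrC.
exact: G (test_int_pd 0 (tX 0)) (test_int_pd 1 (tX 1)).
Qed.

Lemma Lambda1c_zext u : Lambda1c a u -> test1 (zext1 a u).
Proof. by move=> Lu i; have [] := Lu i; exact: zext_is_test. Qed.

Lemma inner_H1E u : Lambda1c a u -> inner_H1 a u u = hform (zext1 a u) (zext1 a u).
Proof.
move=> Lu; have tw := Lambda1c_zext Lu; set w := zext1 a u in tw *.
rewrite /inner_H1 /inner2 (integral0E (fun x => @contract2_vol (nabla a u) x)).
rewrite (@inner1E _ a u u); [|move=> i; exact: test_sqint (tw i)|move=> i; exact: test_sqint (tw i)].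
suff -> : \int[leb2]_x zext a (fun x => ((kap a x * nabla a u 0 0 x) ^+ 2 +
     (kap a x * nabla a u 0 1 x) ^+ 2) + ((kap a x * nabla a u 1 0 x) ^+ 2 +
     (kap a x * nabla a u 1 1 x) ^+ 2)) x =
    a ^+ 2 * ip1 w w + (ip leb2 (kcurl w) (kcurl w) + ip leb2 (kdiv w) (kdiv w)).
  by rewrite /hform addrA mulrDl mul1r.
rewrite -(bochner tw); apply: eq_Rintegral => x _.
have [Dx|Dx] := pselect (disc a x).
  have E i j : kap a x * nabla a u i j x = cnab w i j x.
    rewrite (nablaE _ _ _ Dx) /cnab /w /zext1 !zextE//.
    have G (k p q r : R) : p = q -> k * p - r = k * q - r by move=> ->.
    exact: G (esym (pd_zext (u j) i Dx)).
  rewrite (zextE _ Dx) (E 0 0) (E 0 1) (E 1 0) (E 1 1); reflexivity.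
by rewrite zext_out// !(test_out (test_cnab _ _ tw) Dx) expr0n/= !addr0.
Qed.

Lemma Lambda1c_sub u v : Lambda1c a u -> Lambda1c a v -> Lambda1c a (sub1 u v).
Proof.
move=> Lu Lv i; have [/smoothE su [K [cK KD K0]]] := Lu i.
have [/smoothE sv [K' [cK' KD' K0']]] := Lv i; split.
  by apply/smoothE; apply: smoB => //; exact: open_disc.
exists (K `|` K'); split; first exact: compactU.
- by move=> x [/KD|/KD'].
- move=> x Dx nK; rewrite /sub1 K0// ?K0' ?subr0// => Kx; apply: nK; [right|left]; exact: Kx.
Qed.

Lemma zext1_sub u v i x : zext1 a (sub1 u v) i x = zext1 a u i x - zext1 a v i x.
Proof.
have [Dx|Dx] := pselect (disc a x); first by rewrite /zext1 !zextE.
by rewrite /zext1 !zext_out// subrr.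
Qed.

End Bochner.

(** * Stream functions *)

Section Primitive.
Context {R : realType}.
Local Notation leb := (@lebesgue_measure R).
Implicit Types (f g : R * R -> R) (i : 'I_2) (x z : R * R).

(* The primitive of [g] along the first axis vanishing near [-oo], written with
   a fixed domain of integration so that it commutes with all derivatives. *)
Definition halfline (s : R) : R := \1_(`[0, +oo[%classic : set R) s.
Definition prim g x : R := \int[leb]_s (halfline s * g (x - (s, 0))).

Lemma halflineE s : halfline s = (0 <= s)%R%:R.
Proof. by rewrite /halfline indicE mem_setE in_itv/= andbT. Qed.

Lemma shift_supp M g N x (s : R) : supp M g -> box N x -> N + (M + 1) < s ->
  g (x - (s, 0)) = 0.
Proof.
move=> sg /box_norm[x1 _] Ns; apply: sg; apply: (@abs_supp _ _ _ 0).
rewrite /crd/=; move: x1; rewrite ler_norml => /andP[_ x1].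
by rewrite -normrN opprB; apply: le_trans (ler_norm _); lra.
Qed.

Lemma prim_dominated M g N x (C : R) (s : R) : (forall z, `|g z| <= C) -> supp M g ->
  box N x -> `|halfline s * g (x - (s, 0))| <= C * \1_(`[0, N + (M + 1)]%classic : set R) s.
Proof.
move=> gC sg Nx; have C0 : 0 <= C := le_trans (normr_ge0 _) (gC 0).
rewrite normrM halflineE indicE mem_setE in_itv/=.
have [s0|s0] := leP 0 s; last by rewrite normr0 mul0r mulr_ge0.
have [sL|sL] := leP s (N + (M + 1)); first by rewrite normr1 mul1r mulr1.
by rewrite (shift_supp sg Nx sL) normr0 !mulr0.
Qed.

Lemma integrable_itv_cst (C : R) (L : R) :
  leb.-integrable setT (EFin \o (fun s : R => C * \1_(`[0, L]%classic : set R) s)).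
Proof. by apply: integrable_scale; exact: integrable_indic_itv. Qed.

Lemma continuous_shift0 g x : continuous g -> continuous (fun s : R => g (x - (s, 0))).
Proof.
move=> cg s; have H := @continuous_slice0 _ _ x.2 cg.
rewrite (_ : (fun s => _) = (fun t => g (t, x.2)) \o (fun s => x.1 - s)).
  apply: continuous_comp; last exact: H.
  by apply: cvgB; [exact: cvg_cst|exact: cvg_id].
by apply/funext => t /=; congr g; rewrite [LHS]surjective_pairing/= subr0.
Qed.

Lemma prim_integrable g M x : continuous g -> supp M g ->
  leb.-integrable setT (EFin \o (fun s => halfline s * g (x - (s, 0)))).
Proof.
move=> cg sg; have [C C0 gC] := supp_bounded cg sg; have [N N0 Nx] := box_cover x.
apply: le_integrable (integrable_itv_cst C (N + (M + 1))) => //.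
  apply/measurable_EFinP; apply: measurable_funM; first exact: measurable_indic.
  by apply: continuous_measurable_fun; exact: continuous_shift0.
move=> s _; rewrite lee_fin; apply: le_trans (prim_dominated s gC sg Nx) _.
exact: ler_norm.
Qed.

Lemma prim_bounded g M N : continuous g -> supp M g ->
  exists C, forall x, box N x -> `|prim g x| <= C.
Proof.
move=> cg sg; have [C C0 gC] := supp_bounded cg sg.
exists (\int[leb]_s (C * \1_(`[0, N + (M + 1)]%classic : set R) s)) => x Nx.
apply: le_trans (le_normr_Rintegral measurableT (prim_integrable x cg sg)) _.
apply: le_Rintegral => //; first exact: integrable_norm (prim_integrable x cg sg).
  exact: integrable_itv_cst.
by move=> s _; exact: prim_dominated s gC sg Nx.
Qed.

Lemma is_derive_prim g M i x : smooth_on setT g -> supp M g ->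
  is_derive x (Defs.basis i) (prim g) (prim (pd i g) x).
Proof.
move=> sg sug; have cg := smo_continuousT sg; have [N N0 Nx] := box_cover x.
have sudg := supp_pd i sug; have cdg := smo_continuousT (smo_pd i sg).
have [C C0 dgC] := supp_bounded cdg sudg.
pose F (h : R) (s : R) := halfline s * g ((h *: Defs.basis i + x) - (s, 0)).
have I01 : `]-1, 1[%classic (0 : R) by rewrite /= in_itv/= ltrN10 ltr01.
have dF (h : R) s : is_derive h 1 (F^~ s) (halfline s * pd i g ((h *: Defs.basis i + x) - (s, 0))).
  have Dl := is_derive_line i (x - (s, 0)) h sg.
  have Dm := is_deriveM (is_derive_cst (halfline s) h 1) Dl.
  have -> : F^~ s = cst (halfline s) * (fun t : R => g (t *: Defs.basis i + (x - (s, 0)))).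
    by apply/funext => t; rewrite /F -line_shift.
  apply: is_derive_eq Dm _.
  by rewrite scaler0 addr0 line_shift scaleR_mul.
have intF (h : R) : `]-1, 1[%classic h -> leb.-integrable setT (EFin \o F h).
  by move=> _; exact: prim_integrable cg sug.
have derF (h : R) s : `]-1, 1[%classic h -> setT s -> derivable (F^~ s) h 1.
  by move=> _ _; case: (dF h s).
have bndF (h : R) s : `]-1, 1[%classic h -> setT s ->
    `|partial1of2 F h s| <= C * \1_(`[0, N + 1 + (M + 1)]%classic : set R) s.
  rewrite /= in_itv/= -ltr_norml => h1 _; rewrite partial1of2E.
  case: (dF h s) => _ ->; exact: prim_dominated dgC sudg (box_line i Nx h1).
have G0 s : 0 <= C * \1_(`[0, N + 1 + (M + 1)]%classic : set R) s by rewrite mulr_ge0.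
have IG := integrable_itv_cst C (N + 1 + (M + 1)).
have E : (fun h => prim g (h *: Defs.basis i + x)) = (fun h => \int[leb]_(s in setT) F h s) by [].
apply: DeriveDef.
  apply/derivable_line; rewrite E.
  exact: (derivable_under_integral measurableT I01 intF derF G0 IG bndF).
rewrite derive_line E.
rewrite (differentiation_under_integral measurableT I01 intF derF G0 IG bndF).
apply: eq_Rintegral => s _; rewrite partial1of2E.
by case: (dF 0 s) => _ ->; rewrite scale0r add0r.
Qed.

Lemma pd_prim g M i : smooth_on setT g -> supp M g -> pd i (prim g) = prim (pd i g).
Proof. by move=> sg sug; apply/funext => x; apply: pdE; exact: is_derive_prim sg sug. Qed.

Lemma continuous_prim g M : smooth_on setT g -> supp M g -> continuous (prim g).
Proof.
move=> sg sug; apply: continuous_of_bounded_pd => i.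
  by move=> x; case: (is_derive_prim i x sg sug).
move=> N; rewrite (pd_prim i sg sug).
exact: prim_bounded (smo_continuousT (smo_pd i sg)) (supp_pd i sug).
Qed.

Lemma smo_prim g M : smooth_on setT g -> supp M g -> smooth_on setT (prim g).
Proof.
move=> sg sug n; elim: n g sg sug => [|n IH] g sg sug.
  by split=> // x _; exact: (continuous_prim sg sug).
split=> [x _|i]; first exact: (continuous_prim sg sug).
split=> [x _|]; first by case: (is_derive_prim i x sg sug).
by rewrite (pd_prim i sg sug); apply: IH; [exact: smo_pd|exact: supp_pd].
Qed.

Lemma prim_pd0 g M x : smooth_on setT g -> supp M g -> prim (pd 0 g) x = g x.
Proof.
move=> sg sug; have cg := smo_continuousT sg; have [N N0 Nx] := box_cover x.
have sudg := supp_pd 0 sug; have cdg := smo_continuousT (smo_pd 0 sg).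
pose L := `|N + (M + 1)| + 1; have L0 : 0 < L by rewrite ltr_wpDl.
have NL : N + (M + 1) < L by apply: le_lt_trans (ler_norm _) _; rewrite ltrDl.
pose G (s : R) := - g (x - (s, 0)).
have DG (s : R) : is_derive s 1 G (pd 0 g (x - (s, 0))).
  have [y1 y2] : (x - (s, 0)).1 = x.1 - s /\ (x - (s, 0)).2 = x.2 by split=> //=; rewrite subr0.
  have D0 := is_derive_slice0 (smo_derivable 0 sg (I : setT (x.1 - s, x.2))).
  have xE (t : R) : x - (t, 0) = (x.1 - t, x.2).
    by rewrite [LHS]surjective_pairing/= subr0.
  rewrite xE; have -> : G = - ((fun t : R => g (t, x.2)) \o (fun t => x.1 - t)).
    by apply/funext => t; rewrite /G xE.
  have D1 : is_derive s 1 (fun t : R => x.1 - t) (- 1).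
    have := is_deriveB (is_derive_cst x.1 s 1) (is_derive_id s (1 : R)).
    by rewrite sub0r.
  have := is_deriveN (@is_derive1_comp _ (fun t : R => g (t, x.2)) (fun t => x.1 - t) s _ _ D0 D1).
  by rewrite mulrN1 opprK.
have EL : prim (pd 0 g) x = \int[leb]_(s in `[0, L]) pd 0 g (x - (s, 0)).
  rewrite Rintegral_mkcond; apply: eq_Rintegral => s _.
  rewrite patchE mem_setE in_itv/= halflineE.
  have [s0|s0] := leP 0 s; last by rewrite mul0r.
  have [sL|sL] := leP s L; rewrite mul1r//.
  exact: shift_supp sudg Nx (lt_trans NL sL).
have cG : continuous G.
  by move=> t; apply/differentiable_continuous/derivable1_diffP; case: (DG t).
rewrite EL /Rintegral (@continuous_FTC2 _ (fun s => pd 0 g (x - (s, 0))) G _ _ L0).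
- rewrite -EFinB /= /G (shift_supp sug Nx NL) oppr0 sub0r opprK.
  by congr g; rewrite [LHS]surjective_pairing/= !subr0 -surjective_pairing.
- by apply: continuous_subspaceT; exact: continuous_shift0.
- split=> [t _||]; first by case: (DG t).
    by apply: cvg_at_right_filter; exact: cG.
  by apply: cvg_at_left_filter; exact: cG.
- by move=> t _; rewrite derive1E; case: (DG t).
Qed.

(** From a point with x_1 <= 0 the integration moves further to the left, away from the ball. *)
Lemma prim_left0 g M x : supp M g -> x.1 <= 0 -> M < sqnorm x -> prim g x = 0.
Proof.
move=> sug x0 xM; rewrite /prim (_ : (fun _ => _) = cst 0) ?Rintegral_cst ?mul0r//.
apply/funext => s; rewrite halflineE; have [s0|s0] := leP 0 s; last by rewrite mul0r.
rewrite sug ?mulr0//; apply: lt_le_trans xM _.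
by rewrite /sqnorm/= subr0 lerD2r; nra.
Qed.

Lemma prim_far0 g M x : supp M g -> M < x.2 ^+ 2 -> prim g x = 0.
Proof.
move=> sug xM; rewrite /prim (_ : (fun _ => _) = cst 0) ?Rintegral_cst ?mul0r//.
apply/funext => s; rewrite sug ?mulr0//; apply: lt_le_trans xM _.
by rewrite /sqnorm/= subr0 lerDr sqr_ge0.
Qed.

End Primitive.

(** * Compactly supported stream functions *)

Section CompactPoincare.
Context {R : realType} (a : R).
Implicit Types (f g : R * R -> R) (i j : 'I_2) (x y z : R * R).
Implicit Types (u v w : 'I_2 -> R * R -> R).

Definition rot_grad f i x : R := if i == 0 then pd 1 f x else - pd 0 f x.

Lemma test_rot_grad f : test a f -> test1 a (rot_grad f).
Proof.
by move=> tf i; case: (I2P i) => ->; [exact: test_pd tf|apply: testN; exact: test_pd tf].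
Qed.

Lemma div_rot_grad f x : test a f -> div1 (rot_grad f) x = 0.
Proof.
move=> tf; have sf := tf.1.
have G (p q p' q' : R) : p = p' -> q = - q' -> p' = q' -> p + q = 0.
  by move=> -> -> ->; rewrite subrr.
exact: (G _ _ _ _ erefl (pdN 1 (smo_pd 0 sf) I) (pdC openT sf I)).
Qed.

Lemma constant_up f (s t T : R) : smooth_on setT f -> s < T ->
  (forall r, s <= r <= T -> pd 1 f (t, r) = 0) -> f (t, s) = f (t, T).
Proof.
move=> sf sT f0; have D r := is_derive_slice1 (smo_derivable 1 sf (I : setT (t, r))).
have [c cb E] := mvt_exists sT (fun r _ => D r).
have cb' : s <= c <= T by case/andP: cb => c1 c2; rewrite !ltW.
have G (p q d l : R) : q - p = d * l -> d = 0 -> p = q.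
  by move=> + d0; rewrite d0 mul0r => /subr0_eq.
exact: G E (f0 c cb').
Qed.

(** The primitive of - w_1 along the first axis has first derivative - w_1, and second derivative
    w_0 because div w = 0. It vanishes outside the same ball as w: to the left and for x_2^2 > M by
    construction, and to the right because it is constant along vertical rays that avoid the ball,
    where w_0 = 0. *)
Theorem compact_poincare w : test1 a w -> (forall x, div1 w x = 0) ->
  exists2 f, test a f & rot_grad f = w.
Proof.
move=> tw w0; have [s0 [M0 aM0 sM0]] := tw 0; have [s1 [M1 aM1 sM1]] := tw 1.
pose M := Num.max M0 M1.
have aM : a ^+ 2 * M < 4 by rewrite /M; case: (leP M0 M1).
have sM i : supp M (w i).
  by move=> x; rewrite gt_max => /andP[x0 x1]; case: (I2P i) => ->; [exact: sM0|exact: sM1].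
have sw i : smooth_on setT (w i) := (tw i).1.
pose f x := - prim (w 1) x.
have sp : smooth_on setT (prim (w 1)) := smo_prim (sw 1) (sM 1).
have sf : smooth_on setT f := smoN openT sp.
have f1 x : pd 0 f x = - w 1 x.
  apply: etrans (pdN 0 sp I) _; rewrite (pd_prim 0 (sw 1) (sM 1)); congr (- _).
  exact: prim_pd0 (sw 1) (sM 1).
have E2 : pd 1 (w 1) = fun x => - pd 0 (w 0) x.
  apply/funext => x; have G (p q : R) : p + q = 0 -> q = - p by move/addr0_eq.
  exact: G (w0 x).
have f2 x : pd 1 f x = w 0 x.
  apply: etrans (pdN 1 sp I) _; rewrite (pd_prim 1 (sw 1) (sM 1)) E2.
  have -> : prim (fun x => - pd 0 (w 0) x) x = - prim (pd 0 (w 0)) x.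
    rewrite /prim -mulN1r -RintegralZl//.
      by apply: eq_Rintegral => s _; move: (pd _ _ _) => p; ring.
    exact: prim_integrable (smo_continuousT (smo_pd 0 (sw 0))) (supp_pd 0 (sM 0)).
  by rewrite opprK; exact: prim_pd0 (sw 0) (sM 0).
have far x : M < x.2 ^+ 2 -> f x = 0.
  by move=> xM; rewrite /f (prim_far0 (sM 1) xM) oppr0.
have fM : supp M f.
  move=> x xM; have [x0|x0] := leP x.1 0.
    by rewrite /f (prim_left0 (sM 1) x0 xM) oppr0.
  have out r : x.2 ^+ 2 <= r ^+ 2 -> pd 1 f (x.1, r) = 0.
    move=> xr; apply: etrans (f2 _) _; apply: (sM 0); apply: lt_le_trans xM _.
    by rewrite /sqnorm/= lerD2l.
  have MM := ler_norm M; have MM0 := normr_ge0 M.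
  (* The ray goes up when x_2 >= 0 and down otherwise, so that |x_2| increases along it until x_2^2
     > M. *)
  rewrite [x]surjective_pairing; have [y0|y0] := leP 0 x.2.
    have lt : x.2 < x.2 + `|M| + 1 by rewrite -addrA ltrDl ltr_wpDl.
    rewrite (constant_up sf lt) => [|r /andP[r1 r2]]; last by apply: out; nra.
    by apply: far => /=; move: (x.2) (`|M|) {out xM lt} y0 MM MM0 => p q; nra.
  have lt : x.2 - `|M| - 1 < x.2 by rewrite -addrA gtrDl -opprD oppr_lt0 ltr_wpDl.
  rewrite -(constant_up sf lt) => [|r /andP[r1 r2]]; last by apply: out; nra.
  by apply: far => /=; move: (x.2) (`|M|) {out xM lt} y0 MM MM0 => p q; nra.
exists f; first by split=> //; exists M.
apply/funext => i; apply/funext => x; rewrite /rot_grad.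
case: (I2P i) => -> /=; first exact: f2.
by apply: etrans (congr1 -%R (f1 x)) _; rewrite opprK.
Qed.

End CompactPoincare.

(** * Divergence free and coexact forms in terms of stream functions *)

Section DivergenceFreeForms.
Context {R : realType} (a : R).
Implicit Types (f g : R * R -> R) (i j : 'I_2) (x y z : R * R).
Implicit Types (u v w : 'I_2 -> R * R -> R).

Lemma star1E0 u x : disc a x -> star1 a u 0 x = - u 1 x.
Proof.
move=> Dx; rewrite /star1/= sum2 !cometric_diag/= mulr0 mul0r add0r mulr1.
by rewrite mulrA [vol a x * _]mulrC kap_vol// mul1r.
Qed.

Lemma star1E1 u x : disc a x -> star1 a u 1 x = u 0 x.
Proof.
move=> Dx; rewrite /star1/= sum2 !cometric_diag/= mulr0 mul0r addr0 mulr1.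
by rewrite mulrA [vol a x * _]mulrC kap_vol// mul1r.
Qed.

Lemma codiff1E u x : (forall i, smooth_on (disc a) (u i)) -> disc a x ->
  codiff1 a u x = - (div1 u x / vol a x).
Proof.
move=> su Dx; rewrite /codiff1 /star2; congr (- (_ / _)).
have oD : open (disc a) by exact: open_disc.
have e1 : {in disc a, star1 a u 1 =1 u 0} by move=> y /set_mem Dy; exact: star1E1.
have e0 : {in disc a, star1 a u 0 =1 fun x => - u 1 x} by move=> y /set_mem Dy; exact: star1E0.
have G (p q p' q' r : R) : p = p' -> q = r -> r = - q' -> p - q = p' + q'.
  by move=> -> -> ->; rewrite opprK.
exact: G (eq_on_pd 0 oD e1 Dx) (eq_on_pd 1 oD e0 Dx) (pdN 1 (su 1) Dx).
Qed.

Lemma codiff2E g i x : disc a x -> codiff2 a g i x = rot_grad (star2 a g) i x.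
Proof.
move=> Dx; rewrite /codiff2; case: (I2P i) => ->; last by rewrite star1E1.
by rewrite star1E0// opprK.
Qed.

Lemma vol_neq0 x : disc a x -> vol a x != 0.
Proof. by move=> Dx; rewrite volE// expf_neq0// invr_neq0// kap_neq0. Qed.

Lemma smo_vol : smooth_on (disc a) (vol a).
Proof.
have oD : open (disc a) by exact: open_disc.
have E : {in disc a, (fun x => (kap a x)^-1 * (kap a x)^-1) =1 vol a}.
  by move=> x /set_mem Dx; rewrite volE// expr2.
exact: eq_smo oD E (smoM oD (smo_kapV a) (smo_kapV a)).
Qed.

Lemma Lambda1c_test1 u w : test1 a w -> (forall i x, disc a x -> u i x = w i x) -> Lambda1c a u.
Proof.
move=> tw uw i; have [/smoothE sw [K [cK KD K0]]] := test_smooth (tw i).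
have oD : open (disc a) by exact: open_disc.
split; first by apply/smoothE; apply: (eq_smo oD _ sw) => x /set_mem Dx; rewrite uw.
by exists K; split=> // x Dx nK; rewrite uw// K0.
Qed.

Lemma zext1_eq u w : test1 a w -> (forall i x, disc a x -> u i x = w i x) -> zext1 a u = w.
Proof.
move=> tw uw; apply/funext => i; apply/funext => x.
have [Dx|Dx] := pselect (disc a x); first by rewrite /zext1 zextE// uw.
by rewrite /zext1 zext_out// (test_out (tw i) Dx).
Qed.

Lemma Lambda1csigma_potential u : Lambda1csigma a u ->
  exists2 f, test a f & rot_grad f = zext1 a u.
Proof.
move=> [Lu u0]; have tw := Lambda1c_zext Lu; apply: (compact_poincare tw) => x.
have [Dx|Dx] := pselect (disc a x); last first.
  have G (p q : R) : p = 0 -> q = 0 -> p + q = 0 by move=> -> ->; rewrite addr0.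
  exact: G (test_out (test_pd 0 (tw 0)) Dx) (test_out (test_pd 1 (tw 1)) Dx).
have su i : smooth_on (disc a) (u i) by apply/smoothE; have [] := Lu i.
have E : div1 u x = 0.
  have := u0 x Dx; rewrite (codiff1E su Dx) => /eqP.
  by rewrite oppr_eq0 mulf_eq0 invr_eq0 (negbTE (vol_neq0 Dx)) orbF => /eqP.
have G (p q p' q' : R) : p = p' -> q = q' -> p' + q' = 0 -> p + q = 0 by move=> -> ->.
exact: G (pd_zext (u 0) 0 Dx) (pd_zext (u 1) 1 Dx) E.
Qed.

Lemma codiff_Lambda2c_potential u : codiff_Lambda2c a u ->
  exists2 f, test a f & rot_grad f = zext1 a u.
Proof.
move=> [g [/smoothE sg cg] <-].
have oD : open (disc a) by exact: open_disc.
have ss : smooth_on (disc a) (star2 a g).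
  by apply: (smoM oD sg); apply: (smoV oD _ smo_vol); exact: vol_neq0.
have cs : compactly_supported a (star2 a g).
  by have [K [cK KD K0]] := cg; exists K; split=> // x Dx nK; rewrite /star2 K0// mul0r.
have tf : test a (zext a (star2 a g)) by apply: zext_is_test cs; exact/smoothE.
exists (zext a (star2 a g)); first exact: tf.
apply/esym; apply: zext1_eq; first exact: test_rot_grad.
move=> i x Dx; rewrite codiff2E// /rot_grad; case: (I2P i) => -> /=.
  exact: esym (pd_zext _ 1 Dx).
by congr (- _); exact: esym (pd_zext _ 0 Dx).
Qed.

(** The 2-form with density f vol has Hodge star f. One form u serves both closures, whose
    generating sets thus have the same zero extensions. *)
Lemma potential_codiff f : test a f ->
  exists2 u, codiff_Lambda2c a u /\ Lambda1csigma a u & rot_grad f = zext1 a u.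
Proof.
move=> tf; have oD : open (disc a) by exact: open_disc.
have [/smoothE sf [K [cK KD K0]]] := test_smooth tf.
pose g x := f x * vol a x.
have Lg : Lambda2c a g.
  split; first by apply/smoothE; exact: smoM oD sf smo_vol.
  by exists K; split=> // x Dx nK; rewrite /g K0// mul0r.
have sE : {in disc a, star2 a g =1 f}.
  by move=> x /set_mem Dx; rewrite /star2 /g mulfK// vol_neq0.
have tr := test_rot_grad tf.
have cE i x : disc a x -> codiff2 a g i x = rot_grad f i x.
  move=> Dx; rewrite codiff2E// /rot_grad; case: (I2P i) => -> /=.
    exact: (eq_on_pd 1 oD sE Dx).
  by congr (- _); exact: (eq_on_pd 0 oD sE Dx).
exists (codiff2 a g); last by rewrite (zext1_eq tr cE).
have Lc := Lambda1c_test1 tr cE; split; first by exists g.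
split; first exact: Lc.
have su i : smooth_on (disc a) (codiff2 a g i) by apply/smoothE; have [] := Lc i.
move=> x Dx; rewrite (codiff1E su Dx).
have E : div1 (codiff2 a g) x = 0.
  have e i : {in disc a, codiff2 a g i =1 rot_grad f i}.
    by move=> y /set_mem; exact: cE.
  have G (p q p' q' : R) : p = p' -> q = q' -> p' + q' = 0 -> p + q = 0 by move=> -> ->.
  exact: G (eq_on_pd 0 oD (e 0) Dx) (eq_on_pd 1 oD (e 1) Dx) (div_rot_grad x tf).
by rewrite E mul0r oppr0.
Qed.

End DivergenceFreeForms.

(** * The decomposition *)

Section H1Form.
Context {R : realType} (a : R).
Local Notation leb2 := (@lebesgue_measure R \x @lebesgue_measure R)%E.
Local Notation form := ('I_2 -> R * R -> R).
Implicit Types (f g : R * R -> R) (i j : 'I_2) (x y z : R * R).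
Implicit Types (u v w : form).

Lemma test1_0 : test1 a (0 : form).
Proof. by move=> i; exact: test0. Qed.

Lemma test1_DZ (k : R) u v : test1 a u -> test1 a v -> test1 a (k *: u + v).
Proof. by move=> tu tv i; apply: testD (tv i); exact: testZ (tu i). Qed.

Lemma pdDZ (k : R) f g i x : smooth_on setT f -> smooth_on setT g ->
  pd i (k *: f + g) x = k * pd i f x + pd i g x.
Proof.
move=> sf sg; apply: etrans (pdD i (smoZ k openT sf) sg I) _.
by congr (_ + _); exact: (pdZ k i sf I).
Qed.

Lemma kcurlDZ (k : R) u v : test1 a u -> test1 a v ->
  kcurl a (k *: u + v) = k *: kcurl a u + kcurl a v.
Proof.
move=> tu tv; apply/funext => x.
have G (c p q p0 p1 q0 q1 : R) : p = k * p0 + p1 -> q = k * q0 + q1 ->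
    c * (p - q) = k * (c * (p0 - q0)) + c * (p1 - q1).
  by move=> -> ->; ring.
exact: G (pdDZ k 0 x (tu 1).1 (tv 1).1) (pdDZ k 1 x (tu 0).1 (tv 0).1).
Qed.

Lemma kdivDZ (k : R) u v : test1 a u -> test1 a v ->
  kdiv a (k *: u + v) = k *: kdiv a u + kdiv a v.
Proof.
move=> tu tv; apply/funext => x.
have G (c p q p0 p1 q0 q1 : R) : p = k * p0 + p1 -> q = k * q0 + q1 ->
    c * (p + q) = k * (c * (p0 + q0)) + c * (p1 + q1).
  by move=> -> ->; ring.
exact: G (pdDZ k 0 x (tu 0).1 (tv 0).1) (pdDZ k 1 x (tu 1).1 (tv 1).1).
Qed.

Lemma test1_sqint u i : test1 a u -> sqint leb2 (u i).
Proof. by move=> tu; exact: test_sqint (tu i). Qed.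

Lemma hformC u v : hform a u v = hform a v u.
Proof. by rewrite /hform /ip1 (ipC leb2 (u 0)) (ipC leb2 (u 1)) (ipC leb2 (kcurl a u)) (ipC leb2 (kdiv a u)). Qed.

Lemma hformDZ (k : R) u v w : test1 a u -> test1 a v -> test1 a w ->
  hform a (k *: u + v) w = k * hform a u w + hform a v w.
Proof.
move=> tu tv tw; rewrite /hform (kcurlDZ k tu tv) (kdivDZ k tu tv).
have Ic (z : form) : test1 a z -> sqint leb2 (kcurl a z) by move=> tz; exact: test_sqint (test_kcurl tz).
have Id (z : form) : test1 a z -> sqint leb2 (kdiv a z) by move=> tz; exact: test_sqint (test_kdiv tz).
rewrite (ipDZ k (Ic _ tu) (Ic _ tv) (Ic _ tw)) (ipDZ k (Id _ tu) (Id _ tv) (Id _ tw)).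
rewrite /ip1.
have E i : ip leb2 ((k *: u + v) i) (w i) = k * ip leb2 (u i) (w i) + ip leb2 (v i) (w i).
  exact: (ipDZ k (test1_sqint i tu) (test1_sqint i tv) (test1_sqint i tw)).
rewrite (E 0) (E 1).
have G (c p q r s p' q' r' s' : R) :
  c * ((k * p + p') + (k * q + q')) + ((k * r + r') + (k * s + s')) =
  k * (c * (p + q) + (r + s)) + (c * (p' + q') + (r' + s')) by ring.
exact: G.
Qed.

Lemma hform_ge0 u : test1 a u -> 0 <= hform a u u.
Proof.
by move=> _; rewrite addr_ge0 ?mulr_ge0 ?addr_ge0 ?ip_ge0 ?sqr_ge0.
Qed.

Definition potential w := exists2 f, test a f & rot_grad f = w.

Lemma potential0 : potential (0 : form).
Proof.
exists (cst 0); first exact: test0.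
apply/funext => i; apply/funext => x; rewrite /rot_grad.
by case: (I2P i) => -> /=; rewrite pd_cst// oppr0.
Qed.

Lemma potential_test1 w : potential w -> test1 a w.
Proof. by move=> [f tf <-]; exact: test_rot_grad. Qed.

Lemma potentialDZ (k : R) u v : potential u -> potential v -> potential (k *: u + v).
Proof.
move=> [f tf <-] [g tg <-]; exists (k *: f + g); first by apply: testD tg; exact: testZ tf.
apply/funext => i; apply/funext => x; have E j := pdDZ k j x tf.1 tg.1.
rewrite -[RHS]/(k * rot_grad f i x + rot_grad g i x) /rot_grad.
case: (I2P i) => -> /=; first exact: E.
by apply: etrans (congr1 -%R (E 0)) _; rewrite opprD mulrN.
Qed.

Definition hcauchy (w : nat -> form) := scauchy (hform a) w.

Lemma H1norm_zext u v : Lambda1c a u -> Lambda1c a v ->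
  H1norm a (sub1 u v) = snorm (hform a) (zext1 a u - zext1 a v).
Proof.
move=> Lu Lv; rewrite /H1norm /snorm (inner_H1E (Lambda1c_sub Lu Lv)).
have -> // : zext1 a (sub1 u v) = zext1 a u - zext1 a v.
by apply/funext => i; apply/funext => x; exact: zext1_sub.
Qed.

Lemma L2norm_zext u v : (forall i, sqint leb2 (zext1 a u i)) ->
  (forall i, sqint leb2 (zext1 a v i)) ->
  L2norm a (sub1 u v) ^+ 2 = l2n (zext1 a u 0 - zext1 a v 0) ^+ 2 + l2n (zext1 a u 1 - zext1 a v 1) ^+ 2.
Proof.
move=> Iu Iv; have E i : zext1 a (sub1 u v) i = zext1 a u i - zext1 a v i.
  by apply/funext => x; exact: zext1_sub.
have Is i : sqint leb2 (zext1 a (sub1 u v) i) by rewrite E; exact: sqintB.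
rewrite /L2norm (inner1E Is Is) sqr_sqrtr ?addr_ge0 ?ip_ge0//.
by rewrite /ip1 !E -!l2n_sqr.
Qed.

Lemma L2norm_cvg (s : nat -> form) u : (forall n i, sqint leb2 (zext1 a (s n) i)) ->
  (forall i, sqint leb2 (zext1 a u i)) ->
  (L2norm a (sub1 (s n) u) @[n --> \oo] --> (0 : R)) <->
  (forall i, l2cvg (fun n => zext1 a (s n) i) (zext1 a u i)).
Proof.
move=> Is Iu; split=> [H i|H].
  apply: (@squeeze_cvgr _ _ _ _ (cst 0) (fun n => L2norm a (sub1 (s n) u))) H.
    apply: nearW => n; rewrite l2n_ge0/= -(ler_pXn2r (_ : 0 < 2)%N) ?nnegrE ?l2n_ge0 ?sqrtr_ge0//.
    by rewrite (L2norm_zext (Is n) Iu); case: (I2P i) => ->; rewrite ?lerDl ?lerDr sqr_ge0.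
  exact: cvg_cst.
apply: (@squeeze_cvgr _ _ _ _ (cst 0) (fun n => l2n (zext1 a (s n) 0 - zext1 a u 0) +
    l2n (zext1 a (s n) 1 - zext1 a u 1))).
- apply: nearW => n; rewrite sqrtr_ge0/= -(ler_pXn2r (_ : 0 < 2)%N) ?nnegrE ?addr_ge0 ?l2n_ge0 ?sqrtr_ge0//.
  rewrite (L2norm_zext (Is n) Iu) sqrrD -addrA lerD2l lerDr mulrn_wge0// mulr_ge0//; exact: l2n_ge0.
- exact: cvg_cst.
- by rewrite -[X in _ --> X](addr0 0); apply: cvgD; exact: H.
Qed.

Lemma H1_closureP (A : set form) u : A `<=` Lambda1c a ->
  H1_closure a A u <-> (forall i, sqint leb2 (zext1 a u i)) /\
  exists s : nat -> form, [/\ forall n, A (s n), hcauchy (fun n => zext1 a (s n)) &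
    forall i, l2cvg (fun n => zext1 a (s n) i) (zext1 a u i)].
Proof.
move=> AL; split=> [[/L2P Iu [s [As Cs Ls]]]|[Iu [s [As Cs Ls]]]].
  have Is n i : sqint leb2 (zext1 a (s n) i) := test1_sqint i (Lambda1c_zext (AL _ (As n))).
  split=> //; exists s; split=> //; last exact/(L2norm_cvg Is Iu).
  move=> e /Cs[N HN]; exists N => m n Nm Nn; have := HN m n Nm Nn.
  by rewrite (H1norm_zext (AL _ (As m)) (AL _ (As n))).
have Is n i : sqint leb2 (zext1 a (s n) i) := test1_sqint i (Lambda1c_zext (AL _ (As n))).
split; first exact/L2P.
exists s; split=> //; last exact/(L2norm_cvg Is Iu).
move=> e /Cs[N HN]; exists N => m n Nm Nn; have := HN m n Nm Nn.
by rewrite (H1norm_zext (AL _ (As m)) (AL _ (As n))).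
Qed.

(** Common description of the two closures of the theorem, both generating sets having the rotated
    gradients of test functions as zero extensions. *)
Definition potential_closure u := (forall i, sqint leb2 (zext1 a u i)) /\
  exists w : nat -> form, [/\ forall n, potential (w n), hcauchy w &
    forall i, l2cvg (fun n => w n i) (zext1 a u i)].

Lemma closure_potentialP (A : set form) u : A `<=` Lambda1c a ->
  (forall v, A v -> potential (zext1 a v)) ->
  (forall w, potential w -> exists2 v, A v & w = zext1 a v) ->
  H1_closure a A u <-> potential_closure u.
Proof.
move=> AL AP PA; split=> [/(H1_closureP _ AL)[Iu [s [As Cs Ls]]]|[Iu [w [Pw Cw Lw]]]].
  by split=> //; exists (fun n => zext1 a (s n)); split=> // n; exact: AP.
have /choice[s Hs] : forall n, exists v, A v /\ w n = zext1 a v.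
  by move=> n; have [v Av E] := PA _ (Pw n); exists v.
have ws : w = (fun n => zext1 a (s n)) by apply/funext => n; exact: (Hs n).2.
apply/(H1_closureP _ AL); split=> //; exists s; split.
- by move=> n; exact: (Hs n).1.
- by rewrite -ws.
- by move: Lw; rewrite ws.
Qed.

Lemma closure_csigmaP u : H1_closure a (Lambda1csigma a) u <-> potential_closure u.
Proof.
apply: closure_potentialP => [v []//|v|w [f tf <-]]; first exact: Lambda1csigma_potential.
by have [v [_ Lv] E] := potential_codiff tf; exists v.
Qed.

Lemma closure_codiffP u : H1_closure a (codiff_Lambda2c a) u <-> potential_closure u.
Proof.
apply: closure_potentialP => [v /codiff_Lambda2c_potential[f tf E]|v|w [f tf <-]].
- apply: (Lambda1c_test1 (test_rot_grad tf)) => i x Dx.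
  by rewrite E /zext1 zextE.
- exact: codiff_Lambda2c_potential.
- by have [v [Lv _] E] := potential_codiff tf; exists v.
Qed.

Lemma H1P u : H1 a u <-> (forall i, sqint leb2 (zext1 a u i)) /\
  exists w : nat -> form, [/\ forall n, test1 a (w n), hcauchy w &
    forall i, l2cvg (fun n => w n i) (zext1 a u i)].
Proof.
split=> [/(H1_closureP _ (fun _ => id))[Iu [s [As Cs Ls]]]|[Iu [w [tw Cw Lw]]]].
  by split=> //; exists (fun n => zext1 a (s n)); split=> // n; exact: Lambda1c_zext.
apply/(H1_closureP _ (fun _ => id)); split=> //.
have wE n : zext1 a (w n) = w n by exact: zext1_eq.
have wE' : (fun n => zext1 a (w n)) = w by apply/funext => n; exact: wE.
exists w; split.
- by move=> n; exact: (Lambda1c_test1 (tw n)).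
- by rewrite wE'.
- by move=> i; under eq_fun do rewrite wE; exact: Lw.
Qed.

End H1Form.

(** * Limits in L^2 and pairings with gradients *)

Section WeakLimits.
Context {R : realType} (a : R).
Local Notation leb2 := (@lebesgue_measure R \x @lebesgue_measure R)%E.
Local Notation PR := (measurableTypeR R * measurableTypeR R)%type.
Local Notation form := ('I_2 -> R * R -> R).
Implicit Types (f g h : R * R -> R) (i j : 'I_2) (x y z : R * R).
Implicit Types (u v w : form).

Lemma l2cvg_ip0 (f_ : nat -> R * R -> R) f :
  (fun n => ip leb2 (f_ n - f) (f_ n - f)) @ \oo --> (0 : R) -> l2cvg f_ f.
Proof.
move=> H; rewrite /l2cvg -[X in _ --> X]sqrtr0.
exact: cvg_comp H (@sqrt_continuous R 0).
Qed.

Lemma approximable_lim (f_ : nat -> R * R -> R) f : (forall n, test a (f_ n)) ->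
  l2cvg f_ f -> approximable f.
Proof.
move=> tf cf d d0; have /cvgr0Pnorm_lt/(_ d d0)[N _ /(_ N (leqnn N)) H] := cf.
have [sf [M aM sM]] := tf N; exists (f_ N); first by split=> //; exists M.
by rewrite l2n_distC; apply: le_lt_trans H; exact: ler_norm.
Qed.

Lemma l2cvgB (f_ g_ : nat -> R * R -> R) f g :
  (forall n, sqint leb2 (f_ n)) -> sqint leb2 f ->
  (forall n, sqint leb2 (g_ n)) -> sqint leb2 g ->
  l2cvg f_ f -> l2cvg g_ g -> l2cvg (fun n => f_ n - g_ n) (f - g).
Proof.
move=> If_ If Ig_ Ig cf cg.
apply: (@squeeze_cvgr _ _ _ _ (cst 0) (fun n => l2n (f_ n - f) + l2n (g - g_ n))).
- apply: nearW => n; rewrite l2n_ge0 /=.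
  have -> : f_ n - g_ n - (f - g) = (f_ n - f) + (g - g_ n).
    apply/funext => x; rewrite -[LHS]/(f_ n x - g_ n x - (f x - g x)).
    by rewrite -[RHS]/(f_ n x - f x + (g x - g_ n x)); ring.
  by apply: l2nD; exact: sqintB.
- exact: cvg_cst.
- rewrite -[X in _ --> X](addr0 0); apply: cvgD cf _.
  by under eq_fun do rewrite l2n_distC.
Qed.

Lemma l2cvgD (f_ g_ : nat -> R * R -> R) f g :
  (forall n, sqint leb2 (f_ n)) -> sqint leb2 f ->
  (forall n, sqint leb2 (g_ n)) -> sqint leb2 g ->
  l2cvg f_ f -> l2cvg g_ g -> l2cvg (fun n => f_ n + g_ n) (f + g).
Proof.
move=> If_ If Ig_ Ig cf cg.
apply: (@squeeze_cvgr _ _ _ _ (cst 0) (fun n => l2n (f_ n - f) + l2n (g_ n - g))).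
- apply: nearW => n; rewrite l2n_ge0 /= opprD addrACA.
  by apply: l2nD; exact: sqintB.
- exact: cvg_cst.
- by rewrite -[X in _ --> X](addr0 0); exact: cvgD cf cg.
Qed.

Lemma ip_ae f g h : sqint leb2 f -> sqint leb2 g -> sqint leb2 h ->
  {ae leb2, forall x, f x = g x} -> ip leb2 f h = ip leb2 g h.
Proof.
move=> If Ig Ih fg; rewrite /ip /Rintegral; congr fine.
apply: ae_eq_integral => //.
- by apply/measurable_EFinP; apply: measurable_funM; [exact: If.1|exact: Ih.1].
- by apply/measurable_EFinP; apply: measurable_funM; [exact: Ig.1|exact: Ih.1].
- by apply: ae_imp fg => x E _; rewrite E.
Qed.

Lemma l2n_ae f g : sqint leb2 f -> sqint leb2 g ->
  {ae leb2, forall x, f x = g x} -> l2n (f - g) = 0.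
Proof.
move=> If Ig fg; have I := sqintB If Ig.
rewrite /l2n /snorm (@ip_ae _ 0 _ I (sqint0 leb2) I) ?ip0 ?sqrtr0//.
by apply: ae_imp fg => x E; rewrite -[LHS]/(f x - g x) E subrr.
Qed.

Lemma l2cvg_ae (f_ : nat -> R * R -> R) f g : (forall n, sqint leb2 (f_ n)) ->
  sqint leb2 f -> sqint leb2 g -> {ae leb2, forall x, f x = g x} ->
  l2cvg f_ f -> l2cvg f_ g.
Proof.
move=> If_ If Ig fg; apply: (@squeeze_cvgr _ _ _ _ (cst 0)); last exact: cvg_cst.
apply: nearW => n; rewrite l2n_ge0/=; apply: le_trans (l2n_dist (If_ n) If Ig) _.
by rewrite (l2n_ae If Ig fg) addr0.
Qed.

Lemma zext_indic f : zext a f = fun x => \1_(disc a) x * f x.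
Proof.
apply/funext => x; rewrite indicE; have [Dx|Dx] := pselect (disc a x).
  by rewrite zextE// mem_set// mul1r.
by rewrite zext_out// memNset// mul0r.
Qed.

Lemma indic_disc_le1 x : `|\1_(disc a) x : R| <= 1.
Proof. by rewrite indicE; case: (_ \in _); rewrite ?normr1 ?normr0. Qed.

Lemma measurable_indic_disc : measurable_fun (setT : set PR) (\1_(disc a) : R * R -> R).
Proof. by apply: measurable_indic; exact: measurable_disc. Qed.

Lemma sqint_zext f : sqint leb2 f -> sqint leb2 (zext a f).
Proof.
move=> If; rewrite zext_indic.
exact: (l2n_mul measurable_indic_disc ler01 indic_disc_le1 If).1.
Qed.

Lemma l2cvg_zext (f_ : nat -> R * R -> R) f : (forall n, test a (f_ n)) ->
  sqint leb2 f -> l2cvg f_ f -> l2cvg f_ (zext a f).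
Proof.
move=> tf If cf; have If_ n : sqint leb2 (f_ n) := test_sqint (tf n).
have := l2cvg_mul measurable_indic_disc indic_disc_le1 If_ If cf.
rewrite zext_indic (_ : (fun n x => _) = f_)//; apply/funext => n.
by rewrite -zext_indic zext_test.
Qed.

Lemma parts f g i : test a f -> test a g -> ip leb2 f (pd i g) = - ip leb2 (pd i f) g.
Proof.
move=> tf tg; have t1 := test_mul (test_pd i tf) tg; have t2 := test_mul tf (test_pd i tg).
have G (p q : R) : p + q = 0 -> q = - p by move/addr0_eq.
apply: G; rewrite -(test_intD t1 t2).
apply: etrans (test_int_pd i (test_mul tf tg)).
by apply: eq_Rintegral => x _; exact: esym (pdM i tf.1 tg.1 I).
Qed.

Definition grad f : form := fun i => pd i f.

Lemma test_kapV f : test a f -> test a (fun x => (kap a x)^-1 * f x).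
Proof. by move=> tf; exact: testMr tf (smo_kapV a). Qed.

Lemma ip_kap f g : test a f -> test a g ->
  ip leb2 (fun x => kap a x * f x) (fun x => (kap a x)^-1 * g x) = ip leb2 f g.
Proof.
move=> tf tg; apply: eq_Rintegral => x _.
have [Dx|Dx] := pselect (disc a x).
  rewrite mulrACA mulfV ?mul1r//; exact: kap_neq0.
by rewrite (test_out tg Dx) !mulr0.
Qed.

(** After integration by parts, the factors kap and 1 / kap are inserted so that only [kcurl]
    occurs: it is this rescaled curl that the H^1 norm controls in L^2. *)
Lemma ip1_rot_grad w f : test1 a w -> test a f ->
  ip1 w (rot_grad f) = ip leb2 (kcurl a w) (fun x => (kap a x)^-1 * f x).
Proof.
move=> tw tf; have tp i j := test_pd i (tw j).
rewrite (ip_kap (testB (tp 0 1) (tp 1 0)) tf).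
rewrite (ipB (test_sqint (tp 0 1)) (test_sqint (tp 1 0)) (test_sqint tf)).
have E : ip leb2 (w 1) (rot_grad f 1) = - ip leb2 (w 1) (pd 0 f).
  have -> : rot_grad f 1 = -1 *: pd 0 f.
    by apply/funext => x; rewrite -[RHS]/(-1 * pd 0 f x) mulN1r.
  by rewrite ipC (ipZ _ (test_sqint (test_pd 0 tf)) (test_sqint (tw 1))) mulN1r ipC.
have G (p q r s t : R) : t = - r -> r = - p -> s = - q -> s + t = p - q.
  by move=> -> -> ->; rewrite opprK addrC.
exact: G E (parts 0 (tw 1) tf) (parts 1 (tw 0) tf).
Qed.

Lemma ip1_grad w f : test1 a w -> test a f ->
  ip1 w (grad f) = - ip leb2 (kdiv a w) (fun x => (kap a x)^-1 * f x).
Proof.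
move=> tw tf; have tp i j := test_pd i (tw j).
rewrite (ip_kap (testD (tp 0 0) (tp 1 1)) tf).
rewrite (ipD (test_sqint (tp 0 0)) (test_sqint (tp 1 1)) (test_sqint tf)).
have G (p q r s : R) : r = - p -> s = - q -> r + s = - (p + q).
  by move=> -> ->; rewrite opprD.
exact: G (parts 0 (tw 0) tf) (parts 1 (tw 1) tf).
Qed.

Lemma ip1_potential_grad w f : potential a w -> test a f -> ip1 w (grad f) = 0.
Proof.
move=> [g tg <-] tf; rewrite (ip1_grad (test_rot_grad tg) tf).
have -> : kdiv a (rot_grad g) = 0; last by rewrite ip0 oppr0.
by apply/funext => x; rewrite /kdiv (div_rot_grad x tg) mulr0.
Qed.

(** A rotated gradient has divergence 0 and curl - lap f, so the divergence term drops out; what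
    remains is the operator of [weak_elliptic] with c = 1 + a^2. *)
Lemma hform_rot_grad w f : test1 a w -> test a f -> hform a w (rot_grad f) =
  ip leb2 (kcurl a w) (fun x => (1 + a ^+ 2) * ((kap a x)^-1 * f x) - kap a x * lap f x).
Proof.
move=> tw tf; rewrite /hform (ip1_rot_grad tw tf).
have Ik := test_sqint (test_kcurl tw); have tv := test_kapV tf.
have tl : test a (fun x => kap a x * lap f x) by apply: test_kap; exact: test_lap.
have -> : ip leb2 (kdiv a w) (kdiv a (rot_grad f)) = 0.
  have -> : kdiv a (rot_grad f) = 0; last by rewrite ipC ip0.
  by apply/funext => x; rewrite /kdiv (div_rot_grad x tf) mulr0.
have -> : kcurl a (rot_grad f) = -1 *: (fun x => kap a x * lap f x).
  apply/funext => x; rewrite -[RHS]/(-1 * (kap a x * lap f x)) mulN1r.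
  have G (k p q p' : R) : p' = - p -> k * (p' - q) = - (k * (p + q)).
    by move=> ->; ring.
  exact: G (pdN 0 (smo_pd 0 tf.1) I).
rewrite addr0 (ipC leb2 (kcurl a w)) -(ipZ _ (test_sqint tv) Ik) (ipC leb2 (kcurl a w)).
rewrite -(ipD (sqintZ _ (test_sqint tv)) (sqintZ (-1) (test_sqint tl)) Ik) ipC.
congr ip; apply/funext => x; rewrite -[LHS]/(_ * _ + -1 * (kap a x * lap f x)).
by rewrite mulN1r.
Qed.

End WeakLimits.

(** * Weak divergence, harmonic fields and limits of Cauchy sequences *)

Section Decomposition.
Context {R : realType} (a : R).
Local Notation leb2 := (@lebesgue_measure R \x @lebesgue_measure R)%E.
Local Notation PR := (measurableTypeR R * measurableTypeR R)%type.
Local Notation form := ('I_2 -> R * R -> R).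
Implicit Types (f g h : R * R -> R) (i j : 'I_2) (x y z : R * R).
Implicit Types (u v w : form).

Lemma l2cvg_cst f : l2cvg (fun=> f) f.
Proof.
rewrite /l2cvg; under eq_fun do rewrite subrr.
by rewrite /l2n /snorm ip0 sqrtr0; exact: cvg_cst.
Qed.

Lemma ip1_lim (w_ : nat -> form) w v : (forall n i, sqint leb2 (w_ n i)) ->
  (forall i, sqint leb2 (w i)) -> (forall i, sqint leb2 (v i)) ->
  (forall i, l2cvg (fun n => w_ n i) (w i)) ->
  (fun n => ip1 (w_ n) v) @ \oo --> ip1 w v.
Proof.
move=> Iw_ Iw Iv cw; apply: cvgD.
  exact: (l2cvg_ip (fun n => Iw_ n 0) (Iw 0) (fun=> Iv 0) (Iv 0) (cw 0) (l2cvg_cst _)).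
exact: (l2cvg_ip (fun n => Iw_ n 1) (Iw 1) (fun=> Iv 1) (Iv 1) (cw 1) (l2cvg_cst _)).
Qed.

Lemma zext1_grad f : smooth a f -> compactly_supported a f ->
  zext1 a (d0 f) = grad (zext a f).
Proof.
move=> sf cf; have tf := zext_is_test sf cf.
apply: zext1_eq => [i|i x Dx]; first exact: test_pd tf.
exact: esym (pd_zext f i Dx).
Qed.

Lemma weak_codiff1P u : (forall i, sqint leb2 (zext1 a u i)) ->
  weak_codiff1 a u (fun=> 0) <-> weak_div0 a (zext1 a u).
Proof.
move=> Iu.
have z0 (f : R * R -> R) : integral0 a (fun x => 0 * f x) = 0.
  rewrite (@integral0E _ a _ (cst 0)); last by move=> x _; rewrite !mul0r.
  rewrite (_ : zext a (cst 0) = cst 0) ?Rintegral_cst ?mul0r//.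
  exact: (zext_test (test0 a)).
have E f : smooth a f -> compactly_supported a f ->
    inner1 a u (d0 f) = ip1 (zext1 a u) (grad (zext a f)).
  move=> sf cf; rewrite -(zext1_grad sf cf); apply: inner1E => // i.
  by rewrite (zext1_grad sf cf); exact: test_sqint (test_pd i (zext_is_test sf cf)).
split=> H f.
  move=> tf; have [sf cf] := test_smooth tf; have := H f (conj sf cf).
  by rewrite z0 (E f sf cf) (zext_test tf).
by move=> [sf cf]; rewrite z0 (E f sf cf); exact: H (zext_is_test sf cf).
Qed.

Lemma smo_chi_cvg f x : (fun n => chi a n x * f x) @ \oo --> zext a f x.
Proof.
have [Dx|Dx] := pselect (disc a x).
  rewrite zextE// -[X in _ --> X]mul1r; apply: cvgMr_tmp; exact: chi_cvg.
rewrite zext_out// (_ : (fun _ => _) = cst 0); first exact: cvg_cst.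
by apply/funext => n; rewrite (test_out (test_chi a n) Dx) mul0r.
Qed.

Lemma test_chiM n f : smooth_on (disc a) f -> test a (fun x => chi a n x * f x).
Proof. by move=> sf; exact: testMl (test_chi a n) sf. Qed.

(** The extension may be discontinuous across the boundary circle, but it is the pointwise limit of
    its products with the cutoffs, which are test functions. *)
Lemma measurable_zext_smo f : smooth_on (disc a) f -> measurable_fun (setT : set PR) (zext a f).
Proof.
move=> sf; apply: (@measurable_fun_cvg _ PR R setT (fun n x => chi a n x * f x)).
  by move=> n; exact: test_measurable (test_chiM n sf).
by move=> x _; exact: smo_chi_cvg.
Qed.

Lemma sqint_ae f g : measurable_fun (setT : set PR) f -> sqint leb2 g ->
  {ae leb2, forall x, f x = g x} -> sqint leb2 f.
Proof.
move=> mf Ig fg; split=> //.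
have mf2 : measurable_fun (setT : set PR) (fun x => (f x ^+ 2)%:E).
  by apply/measurable_EFinP; exact: measurable_funX.
have [mg2 Ig2] := integrableP _ _ _ Ig.2.
apply/integrableP; split=> //; apply: le_lt_trans Ig2.
have -> // : (\int[leb2]_x `|(f x ^+ 2)%:E| = \int[leb2]_x `|(g x ^+ 2)%:E|)%E.
apply: ae_eq_integral => //.
- by apply: measurableT_comp.
- by apply: measurableT_comp.
- by apply: ae_imp fg => x E _; rewrite E.
Qed.

Lemma pd0_on U f i x : open U -> {in U, f =1 cst 0} -> U x -> pd i f x = 0.
Proof. by move=> oU f0 Ux; rewrite (eq_on_pd i oU f0 Ux) pd_cst. Qed.

Lemma div_curl_harmonic u : (forall i, smooth_on (disc a) (u i)) ->
  (forall x, disc a x -> pd 0 (u 0) x + pd 1 (u 1) x = 0 /\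
                         pd 1 (u 0) x - pd 0 (u 1) x = 0) ->
  forall i x, disc a x -> hodge_laplacian1 a u i x = 0.
Proof.
move=> su H i x Dx; have oD : open (disc a) by exact: open_disc.
have e1 : {in disc a, codiff1 a u =1 cst 0}.
  move=> y /set_mem Dy; rewrite (codiff1E su Dy).
  by rewrite (_ : div1 u y = 0) ?mul0r ?oppr0//; exact: (H y Dy).1.
have e2 : {in disc a, star2 a (d1 u) =1 cst 0}.
  move=> y /set_mem Dy; rewrite /star2 (_ : d1 u y = 0) ?mul0r//.
  have G (p q : R) : p - q = 0 -> q - p = 0 by move/subr0_eq->; rewrite subrr.
  exact: G (H y Dy).2.
have G (p q : R) : p = 0 -> q = 0 -> p + q = 0 by move=> -> ->; rewrite addr0.
apply: G; first exact: (pd0_on i oD e1 Dx).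
rewrite codiff2E// /rot_grad; case: (I2P i) => -> /=.
  exact: (pd0_on 1 oD e2 Dx).
have G1 (p : R) : p = 0 -> - p = 0 by move=> ->; rewrite oppr0.
exact: G1 (pd0_on 0 oD e2 Dx).
Qed.

Lemma hform_ge_ip w : test1 a w -> ip1 w w <= hform a w w.
Proof.
move=> tw; rewrite /hform mulrDl mul1r -addrA lerDl.
have n1 : 0 <= ip1 w w by rewrite addr_ge0 ?ip_ge0.
exact: addr_ge0 (mulr_ge0 (sqr_ge0 a) n1) (addr_ge0 (ip_ge0 _ _) (ip_ge0 _ _)).
Qed.

Lemma hform_ge_kcurl w : ip leb2 (kcurl a w) (kcurl a w) <= hform a w w.
Proof.
have n1 : 0 <= ip1 w w by rewrite addr_ge0 ?ip_ge0.
rewrite /hform addrCA lerDl; apply: addr_ge0 (ip_ge0 _ _).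
by apply: mulr_ge0 n1; rewrite addr_ge0 ?sqr_ge0.
Qed.

Lemma test1_sub u v : test1 a u -> test1 a v -> test1 a (u - v).
Proof. by move=> tu tv i; exact: testB (tu i) (tv i). Qed.

Lemma kcurlB u v : test1 a u -> test1 a v -> kcurl a (u - v) = kcurl a u - kcurl a v.
Proof.
move=> tu tv; have := kcurlDZ (-1) tv tu.
by rewrite !scaleN1r addrC [X in _ = X]addrC.
Qed.

(** Used with F a component and with F the rescaled curl: both are additive, with L^2 norm dominated
    by the H^1 norm. *)
Lemma hcauchy_bound (w_ : nat -> form) (F : form -> R * R -> R) :
  (forall n, test1 a (w_ n)) -> hcauchy a w_ ->
  (forall m n, F (w_ m) - F (w_ n) = F (w_ m - w_ n)) ->
  (forall w, test1 a w -> ip leb2 (F w) (F w) <= hform a w w) ->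
  (forall n, sqint leb2 (F (w_ n))) ->
  exists2 f, sqint leb2 f & l2cvg (fun n => F (w_ n)) f.
Proof.
move=> tw cw FB Fle IF.
have [|f If cf] := riesz_fischer IF; last by exists f => //; exact: l2cvg_ip0.
move=> e e0; have e1 : 0 < Num.sqrt e by rewrite sqrtr_gt0.
have [N HN] := cw _ e1.
exists N => m n Nm Nn; rewrite FB; have := HN m n Nm Nn.
rewrite /snorm ltr_sqrt// => /(le_lt_trans _); apply.
exact: Fle (test1_sub (tw m) (tw n)).
Qed.

End Decomposition.

(** * Existence of the decomposition *)

Section VtildeDecomposition.
Context {R : realType} (a : R).
Local Notation leb2 := (@lebesgue_measure R \x @lebesgue_measure R)%E.
Local Notation form := ('I_2 -> R * R -> R).
Implicit Types (f g h : R * R -> R) (i j : 'I_2) (x y z : R * R).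
Implicit Types (u v w : form).

Lemma ip1_rot u f : (forall i, sqint leb2 (u i)) -> test a f ->
  ip1 u (rot_grad f) = ip leb2 (u 0) (pd 1 f) - ip leb2 (u 1) (pd 0 f).
Proof.
move=> Iu tf; rewrite /ip1; congr (_ + _).
have -> : rot_grad f 1 = -1 *: pd 0 f.
  by apply/funext => x; rewrite -[RHS]/(-1 * pd 0 f x) mulN1r.
by rewrite ipC (ipZ _ (test_sqint (test_pd 0 tf)) (Iu 1)) mulN1r ipC.
Qed.

Lemma ip1B u v w : (forall i, sqint leb2 (u i)) -> (forall i, sqint leb2 (v i)) ->
  (forall i, sqint leb2 (w i)) -> ip1 (u - v) w = ip1 u w - ip1 v w.
Proof.
move=> Iu Iv Iw; have E i : ip leb2 ((u - v) i) (w i) = ip leb2 (u i) (w i) - ip leb2 (v i) (w i).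
  exact: ipB (Iu i) (Iv i) (Iw i).
by rewrite /ip1 (E 0) (E 1) opprD addrACA.
Qed.

Lemma ip_zext_l f g : test a g -> ip leb2 (zext a f) g = ip leb2 f g.
Proof.
move=> tg; apply: eq_Rintegral => x _; have [Dx|Dx] := pselect (disc a x).
  by rewrite zextE.
by rewrite (test_out tg Dx) !mulr0.
Qed.

Lemma ip1_sq_comp w i : ip leb2 (w i) (w i) <= ip1 w w.
Proof.
have h k : 0 <= ip leb2 (w k) (w k) by exact: ip_ge0.
by case: (I2P i) => ->; rewrite ?lerDl ?lerDr; exact: h.
Qed.

Lemma scale_cvg0 (c : R) : (fun n : nat => n.+1%:R^-1 * c) @ \oo --> (0 : R).
Proof.
rewrite -[X in _ --> X](mul0r c); apply: cvgMr_tmp; exact: cvg_harmonic.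
Qed.

Theorem vtilde_decomposition u : Vtilde a u ->
  exists2 gam, L2_harmonic1 a gam & potential_closure a (sub1 u gam).
Proof.
move=> [/H1P[Iu [s [ts Cs Ls]]] /(weak_codiff1P Iu) Hd].
set z := zext1 a u in Iu Ls Hd.
have hC v w (_ : test1 a v) (_ : test1 a w) : hform a v w = hform a w v := hformC a v w.
have DZ k v w : test1 a v -> test1 a w -> test1 a (k *: v + w) := @test1_DZ _ a k v w.
have BDZ k v w t : test1 a v -> test1 a w -> test1 a t ->
  hform a (k *: v + w) t = k * hform a v t + hform a w t := @hformDZ _ a k v w t.
have Bge v : test1 a v -> 0 <= hform a v v := @hform_ge0 _ a v.
have pS v : potential a v -> test1 a v := @potential_test1 _ a v.
have pDZ k v w : potential a v -> potential a w -> potential a (k *: v + w) := @potentialDZ _ a k v w.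
have e0 n : 0 < n.+1%:R^-1 :> R by rewrite invr_gt0.
have /choice[p Hp] : forall n, exists q, potential a q /\
    forall w, potential a w -> `|hform a (s n - q) w| <= n.+1%:R^-1 * snorm (hform a) w.
  move=> n; have [q Pq Hq] := almost_projection DZ hC BDZ Bge (potential0 a) pS pDZ (ts n) (e0 n).
  by exists q.
have tp n : test1 a (p n) := pS _ (Hp n).1.
pose sig n := s n - p n.
have tsig n : test1 a (sig n) := test1_sub (ts n) (tp n).
have Csig : hcauchy a sig.
  apply: (almost_projection_cauchy (@test1_0 _ a) DZ hC BDZ Bge pS pDZ ts
    (fun n => (Hp n).1) (fun n => (Hp n).2) (fun n => ltW (e0 n)) _ Cs).
  exact: cvg_harmonic.
have Cp : hcauchy a p.
  have := scauchyB (@test1_0 _ a) DZ hC BDZ Bge ts tsig Cs Csig.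
  by rewrite (_ : (fun n => s n - sig n) = p)//; apply/funext => n; rewrite /sig subKr.
have Isig n i := test1_sqint i (tsig n).
have /choice[g0 Hg0] : forall i, exists g, sqint leb2 g /\ l2cvg (fun n => sig n i) g.
  move=> i; have [|w tw|g Ig cg] := hcauchy_bound (F := fun w => w i) tsig Csig _ _ (fun n => Isig n i).
  - by [].
  - exact: le_trans (ip1_sq_comp w i) (hform_ge_ip tw).
  - by exists g.
(* The limit is cut to the disc so that it can be compared, on the whole plane, with the zero
   extension of the smooth representative found below. *)
pose g : form := fun i => zext a (g0 i).
have Ig i : sqint leb2 (g i) := sqint_zext a (Hg0 i).1.
have cg i : l2cvg (fun n => sig n i) (g i) :=
  l2cvg_zext (fun n => tsig n i) (Hg0 i).1 (Hg0 i).2.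
have Ag i : approximable (g i) := approximable_lim (fun n => tsig n i) (cg i).
have tk n : test a (kcurl a (sig n)) := test_kcurl (tsig n).
have [Q IQ cQ] : exists2 Q, sqint leb2 Q & l2cvg (fun n => kcurl a (sig n)) Q.
  apply: (hcauchy_bound tsig Csig) => [m n|w tw|n].
  - by rewrite (kcurlB (tsig m) (tsig n)).
  - exact: hform_ge_kcurl.
  - exact: test_sqint (tk n).
have AQ : approximable Q := approximable_lim tk cQ.
have limQ h : sqint leb2 h -> (fun n => ip leb2 (kcurl a (sig n)) h) @ \oo --> ip leb2 Q h.
  by move=> Ih; exact: (l2cvg_ip (fun n => test_sqint (tk n)) IQ (fun=> Ih) Ih cQ (l2cvg_cst h)).
(* By [hform_rot_grad] the tested curl of s_n - p_n is its H^1 product with a coexact test form, at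
   most 1 / (n + 1) times a fixed norm. *)
have HQ : weak_elliptic a (1 + a ^+ 2) Q.
  move=> f tf.
  have tv : test a (fun x => (1 + a ^+ 2) * ((kap a x)^-1 * f x) - kap a x * lap f x).
    by apply: testB; [apply: testZ; exact: test_kapV|apply: test_kap; exact: test_lap].
  have L1 := limQ _ (test_sqint tv).
  have L2 : (fun n => ip leb2 (kcurl a (sig n))
      (fun x => (1 + a ^+ 2) * ((kap a x)^-1 * f x) - kap a x * lap f x)) @ \oo --> (0 : R).
    apply/norm_cvg0P; apply: (@squeeze_cvgr _ _ _ _ (cst 0)
      (fun n => n.+1%:R^-1 * snorm (hform a) (rot_grad f))).
    - apply: nearW => n; rewrite normr_ge0 -(hform_rot_grad (tsig n) tf) /=.
      by apply: (Hp n).2; exists f.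
    - exact: cvg_cst.
    - exact: scale_cvg0.
  exact: (cvg_unique (@norm_hausdorff _ _) L1 L2).
have c0 : 0 < 1 + a ^+ 2 by rewrite ltr_pwDl// sqr_ge0.
have Q0 := elliptic_vanishing c0 IQ AQ HQ.
have Irg f i : test a f -> sqint leb2 (rot_grad f i) by move=> tf; exact: test_sqint (test_rot_grad tf i).
have Igr f i : test a f -> sqint leb2 (grad f i) by move=> tf; exact: test_sqint (test_pd i tf).
(* The pairing with a rotated gradient is that of the rescaled curl with f / kap; its limit is the
   pairing of Q, which vanishes almost everywhere on the disc. *)
have Hc' : weak_curl0 a g.
  move=> f tf; rewrite -(ip1_rot Ig tf).
  have L1 := ip1_lim Isig Ig (fun i => Irg f i tf) cg.
  have L2 : (fun n => ip1 (sig n) (rot_grad f)) @ \oo --> (0 : R).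
    under eq_fun => n do rewrite (ip1_rot_grad (tsig n) tf).
    rewrite (_ : 0 = ip leb2 Q (fun x => (kap a x)^-1 * f x)); last first.
      rewrite -(ip_zext_l Q (test_kapV tf)).
      rewrite (@ip_ae _ _ 0 _ (sqint_zext a IQ) (sqint0 leb2) (test_sqint (test_kapV tf))) ?ip0//.
      apply: ae_imp Q0 => x Qx; have [Dx|Dx] := pselect (disc a x).
        by rewrite zextE// Qx.
      by rewrite zext_out.
    exact: limQ (test_sqint (test_kapV tf)).
  exact: (cvg_unique (@norm_hausdorff _ _) L1 L2).
(* The p_n are divergence free, so s_n - p_n has the same pairings with gradients as s_n, whose
   limits are those of u. *)
have Hd' : weak_div0 a g.
  move=> f tf; have L1 := ip1_lim Isig Ig (fun i => Igr f i tf) cg.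
  have L2 := ip1_lim (fun n i => test1_sqint i (ts n)) Iu (fun i => Igr f i tf) Ls.
  have E : (fun n => ip1 (sig n) (grad f)) = (fun n => ip1 (s n) (grad f)).
    apply/funext => n; rewrite (ip1B (fun i => test1_sqint i (ts n)) (fun i => test1_sqint i (tp n))
      (fun i => Igr f i tf)) (ip1_potential_grad (Hp n).1 tf) subr0//.
  rewrite E in L1; have := cvg_unique (@norm_hausdorff _ _) L1 L2.
  by move=> /(_ _) H; apply: etrans H _; exact: Hd.
have [gam [sgam Hgam gE]] := weyl Ig Ag Hd' Hc'.
have zgE i : {ae leb2, forall x, g i x = zext a (gam i) x}.
  apply: ae_imp (gE i) => x gx; have [Dx|Dx] := pselect (disc a x).
    by rewrite gx// zextE.
  by rewrite /g !zext_out.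
have Igam i : sqint leb2 (zext1 a gam i).
  apply: (sqint_ae (measurable_zext_smo (sgam i)) (Ig i)).
  by apply: ae_imp (zgE i) => x ->.
exists gam.
  split; first exact/L2P.
  exists gam; split.
  - by move=> i; apply/smoothE; exact: sgam.
  - exact: div_curl_harmonic.
  - by move=> i; apply: aeW.
have zE i : zext1 a (sub1 u gam) i = z i - zext1 a gam i.
  by apply/funext => x; exact: zext1_sub.
split=> [i|]; first by rewrite zE; exact: sqintB (Iu i) (Igam i).
exists p; split; [by move=> n; exact: (Hp n).1|exact: Cp|move=> i].
rewrite zE.
have Is n := test1_sqint i (ts n).
(* The p_n form a Cauchy sequence of coexact test forms, and in L^2 they converge to u - gam. *)
have -> : (fun n => p n i) = (fun n => s n i - sig n i).
  by apply/funext => n; rewrite /sig -[RHS]/((s n - (s n - p n)) i) subKr.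
have cgam : l2cvg (fun n => sig n i) (zext1 a gam i).
  exact: l2cvg_ae (fun n => Isig n i) (Ig i) (Igam i) (zgE i) (cg i).
exact: l2cvgB Is (Iu i) (fun n => Isig n i) (Igam i) (Ls i) cgam.
Qed.

End VtildeDecomposition.

(** * Cutting off an L^2 harmonic form *)

Section CutoffHarmonic.
Context {R : realType} (a : R).
Local Notation leb2 := (@lebesgue_measure R \x @lebesgue_measure R)%E.
Local Notation PR := (measurableTypeR R * measurableTypeR R)%type.
Local Notation form := ('I_2 -> R * R -> R).
Implicit Types (f g h : R * R -> R) (i j : 'I_2) (x y z : R * R).
Implicit Types (u v w : form).

Lemma sub1_sqr_le1 (c : R) : 0 <= c -> c <= 1 -> (c - 1) ^+ 2 <= 1.
Proof. by move=> c0 c1; nra. Qed.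

Lemma chi_l2cvg f : sqint leb2 (zext a f) ->
  l2cvg (fun n x => chi a n x * zext a f x) (zext a f).
Proof.
set g := zext a f => Ig; apply: l2cvg_ip0.
have gcvg x : (fun n => chi a n x * g x) @ \oo --> g x.
  have := @smo_chi_cvg _ a g x; rewrite (_ : zext a g x = g x)//.
  have [Dx|Dx] := pselect (disc a x); first by rewrite zextE.
  by rewrite /g !zext_out.
have IB n : sqint leb2 ((fun x => chi a n x * g x) - g).
  exact: (sqintB (sqint_testM (test_chi a n) Ig) Ig).
have le n x : (((fun x => chi a n x * g x) - g) x) ^+ 2 <= g x ^+ 2.
  rewrite -[X in X ^+ 2 <= _]/(chi a n x * g x - g x).
  have -> : chi a n x * g x - g x = (chi a n x - 1) * g x by rewrite mulrBl mul1r.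
  rewrite exprMn.
  by rewrite ler_piMl ?sqr_ge0// sub1_sqr_le1 ?chi_ge0 ?chi_le1.
have mE n : measurable_fun (setT : set PR) (fun x => ((((fun x => chi a n x * g x) - g) x) ^+ 2)%:E).
  by apply/measurable_EFinP; apply: measurable_funX; exact: (IB n).1.
have [] := @dominated_convergence _ PR R leb2 setT measurableT
  (fun n x => ((((fun x => chi a n x * g x) - g) x) ^+ 2)%:E) (cst 0%E)
  (fun x => (g x ^+ 2)%:E) mE (measurable_cst _) _ Ig.2 _.
- apply: aeW => x _; apply: cvg_EFin; first exact: nearW.
  rewrite -[X in _ --> X](expr0n R 2); under eq_fun => n do rewrite /= expr2; rewrite expr2.
  have H : (fun n => chi a n x * g x - g x) @ \oo --> (0 : R) by apply/subr_cvg0; exact: gcvg.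
  exact: (cvgM H H).
- by apply: aeW => x n _; rewrite gee0_abs ?lee_fin ?sqr_ge0//; exact: le.
move=> _ _; rewrite integral_cst// mul0e => H.
have -> : (fun n => ip leb2 ((fun x => chi a n x * g x) - g) ((fun x => chi a n x * g x) - g)) =
    fine \o (fun n => (\int[leb2]_x ((((fun x => chi a n x * g x) - g) x) ^+ 2)%:E)%E).
  by apply/funext => n /=; rewrite -(ip_EFin (IB n)).
exact: fine_cvg H.
Qed.

(** Here c, c0, c1 are the cutoff and its derivatives, pij is the derivative of g_j along i, and P0,
    P1, C0, C1 are the derivatives of P = k^2 (p00 + p11) and C = k^2 (p01 - p10). The
    Cauchy-Riemann hypotheses cancel the second order terms P0 g0 + C0 g1 + P1 g1 - C1 g0. *)
Lemma cutoff_algebra (k c c0 c1 g0 g1 p00 p01 p10 p11 P0 P1 C0 C1 : R) :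
  P0 = C1 -> P1 = - C0 ->
  (k * ((c0 * g0 + c * p00) + (c1 * g1 + c * p11))) * (k * ((c0 * g0 + c * p00) + (c1 * g1 + c * p11))) +
  (k * ((c0 * g1 + c * p01) - (c1 * g0 + c * p10))) * (k * ((c0 * g1 + c * p01) - (c1 * g0 + c * p10))) =
  ((c0 * (c * (k ^+ 2 * (p00 + p11) * g0 + k ^+ 2 * (p01 - p10) * g1)) +
    c * (c0 * (k ^+ 2 * (p00 + p11) * g0 + k ^+ 2 * (p01 - p10) * g1) +
     c * ((P0 * g0 + k ^+ 2 * (p00 + p11) * p00) + (C0 * g1 + k ^+ 2 * (p01 - p10) * p01)))) +
   (c1 * (c * (k ^+ 2 * (p00 + p11) * g1 - k ^+ 2 * (p01 - p10) * g0)) +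
    c * (c1 * (k ^+ 2 * (p00 + p11) * g1 - k ^+ 2 * (p01 - p10) * g0) +
     c * ((P1 * g1 + k ^+ 2 * (p00 + p11) * p11) - (C1 * g0 + k ^+ 2 * (p01 - p10) * p10))))) +
  (((k * c0 * g0) * (k * c0 * g0) + (k * c0 * g1) * (k * c0 * g1)) +
   ((k * c1 * g0) * (k * c1 * g0) + (k * c1 * g1) * (k * c1 * g1))).
Proof. by move=> -> ->; ring. Qed.

Definition cutoff u n : form := fun i x => chi a n x * u i x.

Lemma test1_cutoff u n : (forall i, smooth_on (disc a) (u i)) -> test1 a (cutoff u n).
Proof. by move=> su i; exact: test_chiM (su i). Qed.

Lemma smo_div1 u : (forall i, smooth_on (disc a) (u i)) -> smooth_on (disc a) (div1 u).
Proof. by move=> su; apply: smoD; [exact: open_disc|exact: smo_pd|exact: smo_pd]. Qed.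

Lemma smo_d1 u : (forall i, smooth_on (disc a) (u i)) -> smooth_on (disc a) (d1 u).
Proof. by move=> su; apply: smoB; [exact: open_disc|exact: smo_pd|exact: smo_pd]. Qed.

(** The codifferential of u is - P and the star of its differential is C, so the Hodge Laplacian is
    - grad P plus the rotated gradient of C. *)
Lemma harmonic_cauchy_riemann u : (forall i, smooth_on (disc a) (u i)) ->
  (forall i x, disc a x -> hodge_laplacian1 a u i x = 0) ->
  let P x := kap a x ^+ 2 * div1 u x in let C x := kap a x ^+ 2 * d1 u x in
  forall x, disc a x -> pd 0 P x = pd 1 C x /\ pd 1 P x = - pd 0 C x.
Proof.
move=> su Hu P C x Dx; have oD : open (disc a) by exact: open_disc.
have sk2 : smooth_on (disc a) (fun x => kap a x ^+ 2) by apply: smoX oD (smo_kap a oD).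
have sP : smooth_on (disc a) P := smoM oD sk2 (smo_div1 su).
have vV y : disc a y -> (vol a y)^-1 = kap a y ^+ 2.
  by move=> Dy; rewrite volE// exprVn invrK.
have e1 : {in disc a, codiff1 a u =1 fun x => - P x}.
  by move=> y /set_mem Dy; rewrite (codiff1E su Dy) vV// mulrC.
have e2 : {in disc a, star2 a (d1 u) =1 C}.
  by move=> y /set_mem Dy; rewrite /star2 vV// mulrC.
have E1 i : pd i (codiff1 a u) x = - pd i P x.
  exact: etrans (eq_on_pd i oD e1 Dx) (pdN i sP Dx).
have E2 i : pd i (star2 a (d1 u)) x = pd i C x := eq_on_pd i oD e2 Dx.
have H0 : - pd 0 P x + pd 1 C x = 0.
  have G (p q q' r : R) : r + q = 0 -> r = - p -> q = q' -> - p + q' = 0.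
    by move=> + E E'; rewrite E E'.
  apply: (G _ _ _ _ (Hu 0 x Dx) (E1 0)).
  by rewrite codiff2E//; exact: (E2 1).
have H1 : - pd 1 P x - pd 0 C x = 0.
  have G (p q r t : R) : r + q = 0 -> r = - p -> q = - t -> - p - t = 0.
    by move=> + E E'; rewrite E E'.
  apply: (G _ _ _ _ (Hu 1 x Dx) (E1 1)).
  by rewrite codiff2E//; exact: (congr1 -%R (E2 0)).
have G1 (p q : R) : - p + q = 0 -> p = q by move/addr0_eq; rewrite opprK.
have G2 (p q : R) : - p - q = 0 -> p = - q by move/addr0_eq; rewrite opprK.
by split; [exact: G1 H0|exact: G2 H1].
Qed.

(* By [harmonic_cauchy_riemann] the cross terms form a divergence, which makes
   this an identity without remainder. *)
Lemma cutoff_energy u n : (forall i, smooth_on (disc a) (u i)) ->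
  (forall i x, disc a x -> hodge_laplacian1 a u i x = 0) ->
  let T i j x := kap a x * pd i (chi a n) x * zext1 a u j x in
  ip leb2 (kdiv a (cutoff u n)) (kdiv a (cutoff u n)) +
  ip leb2 (kcurl a (cutoff u n)) (kcurl a (cutoff u n)) =
  (ip leb2 (T 0 0) (T 0 0) + ip leb2 (T 0 1) (T 0 1)) +
  (ip leb2 (T 1 0) (T 1 0) + ip leb2 (T 1 1) (T 1 1)).
Proof.
move=> su Hu T; have oD : open (disc a) by exact: open_disc.
have tw := test1_cutoff n su; have sk := smo_kap a oD.
have sc : smooth_on (disc a) (chi a n) := smo_chi a n.
have td i := test_pd i (test_chi a n).
pose T' i j x := kap a x * pd i (chi a n) x * u j x.
have tT i j : test a (T' i j) by apply: testMl (su j); exact: test_kap (td i).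
have TE i j : T i j = T' i j.
  apply/funext => x; rewrite /T /T'; have [Dx|Dx] := pselect (disc a x).
    by rewrite /zext1 zextE.
  by rewrite (test_out (td i) Dx) !(mulr0, mul0r).
rewrite !TE.
pose P x := kap a x ^+ 2 * div1 u x; pose C x := kap a x ^+ 2 * d1 u x.
have sk2 : smooth_on (disc a) (fun x => kap a x ^+ 2) by apply: smoX oD sk.
have sP : smooth_on (disc a) P := smoM oD sk2 (smo_div1 su).
have sC : smooth_on (disc a) C := smoM oD sk2 (smo_d1 su).
pose Z0 x := P x * u 0 x + C x * u 1 x; pose Z1 x := P x * u 1 x - C x * u 0 x.
have sPu j : smooth_on (disc a) (fun x => P x * u j x) := smoM oD sP (su j).
have sCu j : smooth_on (disc a) (fun x => C x * u j x) := smoM oD sC (su j).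
have sZ0 : smooth_on (disc a) Z0 := smoD oD (sPu 0) (sCu 1).
have sZ1 : smooth_on (disc a) Z1 := smoB oD (sPu 1) (sCu 0).
pose Y (Z : R * R -> R) x := chi a n x * (chi a n x * Z x).
have tY Z : smooth_on (disc a) Z -> test a (Y Z).
  by move=> sZ; apply: test_mul (test_chi a n) _; exact: test_chiM.
have pY i Z x : smooth_on (disc a) Z -> disc a x -> pd i (Y Z) x =
    pd i (chi a n) x * (chi a n x * Z x) +
    chi a n x * (pd i (chi a n) x * Z x + chi a n x * pd i Z x).
  by move=> sZ Dx; rewrite (pdM i sc (smoM oD sc sZ) Dx) (pdM i sc sZ Dx).
have tTT i j := test_mul (tT i j) (tT i j).
have tk := test_mul (test_kdiv tw) (test_kdiv tw).
have tc := test_mul (test_kcurl tw) (test_kcurl tw).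
have t0 := test_pd 0 (tY _ sZ0); have t1 := test_pd 1 (tY _ sZ1).
have tTa := testD (tTT 0 0) (tTT 0 1); have tTb := testD (tTT 1 0) (tTT 1 1).
have E : \int[leb2]_x (kdiv a (cutoff u n) x * kdiv a (cutoff u n) x +
      kcurl a (cutoff u n) x * kcurl a (cutoff u n) x) =
    \int[leb2]_x ((pd 0 (Y Z0) x + pd 1 (Y Z1) x) +
      ((T' 0 0 x * T' 0 0 x + T' 0 1 x * T' 0 1 x) +
       (T' 1 0 x * T' 1 0 x + T' 1 1 x * T' 1 1 x))).
  apply: eq_Rintegral => x _; have [Dx|Dx] := pselect (disc a x); last first.
    rewrite (test_out (test_kdiv tw) Dx) (test_out (test_kcurl tw) Dx) (test_out t0 Dx) (test_out t1 Dx).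
    by rewrite !(test_out (tT _ _) Dx) !mul0r !addr0.
  have [R0 R1] := harmonic_cauchy_riemann su Hu Dx.
  have pc i j : pd i (cutoff u n j) x = pd i (chi a n) x * u j x + chi a n x * pd i (u j) x.
    exact: (pdM i sc (su j) Dx).
  have pZ0 : pd 0 Z0 x = (pd 0 P x * u 0 x + P x * pd 0 (u 0) x) + (pd 0 C x * u 1 x + C x * pd 0 (u 1) x).
    by rewrite (pdD 0 (sPu 0) (sCu 1) Dx) (pdM 0 sP (su 0) Dx) (pdM 0 sC (su 1) Dx).
  have pZ1 : pd 1 Z1 x = (pd 1 P x * u 1 x + P x * pd 1 (u 1) x) - (pd 1 C x * u 0 x + C x * pd 1 (u 0) x).
    by rewrite (pdB 1 (sPu 1) (sCu 0) Dx) (pdM 1 sP (su 1) Dx) (pdM 1 sC (su 0) Dx).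
  rewrite (pY 0 _ _ sZ0 Dx) (pY 1 _ _ sZ1 Dx) pZ0 pZ1 /kdiv /kcurl /div1 {1 2}/d1.
  rewrite (pc 0 0) (pc 1 1) (pc 0 1) (pc 1 0).
  exact: cutoff_algebra R0 R1.
rewrite /ip -(test_intD tk tc) E (test_intD (testD t0 t1) (testD tTa tTb)) (test_intD t0 t1).
have G (p q r s t r' t' : R) : p = 0 -> q = 0 -> r = s + t -> s = r' -> t = t' ->
    p + q + r = r' + t'.
  by move=> -> -> -> -> ->; rewrite !add0r.
exact: (G _ _ _ _ _ _ _ (test_int_pd 0 (tY _ sZ0)) (test_int_pd 1 (tY _ sZ1))
  (test_intD tTa tTb) (test_intD (tTT 0 0) (tTT 0 1)) (test_intD (tTT 1 0) (tTT 1 1))).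
Qed.

End CutoffHarmonic.

(** * Harmonic forms belong to V, and the sum is direct *)

Section DirectSum.
Context {R : realType} (a : R).
Local Notation leb2 := (@lebesgue_measure R \x @lebesgue_measure R)%E.
Local Notation PR := (measurableTypeR R * measurableTypeR R)%type.
Local Notation form := ('I_2 -> R * R -> R).
Implicit Types (f g h : R * R -> R) (i j : 'I_2) (x y z : R * R).
Implicit Types (u v w : form).

Lemma ip_mul_le (m : R * R -> R) f (C : R) : measurable_fun (setT : set PR) m -> 0 <= C ->
  (forall x, m x ^+ 2 <= C) -> sqint leb2 f ->
  ip leb2 (fun x => m x * f x) (fun x => m x * f x) <= C * ip leb2 f f.
Proof.
move=> mm C0 mC If; have mC' x : `|m x| <= Num.sqrt C.
  by rewrite -(sqrtr_sqr (m x)) ler_sqrt.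
have [_] := l2n_mul mm (sqrtr_ge0 C) mC' If.
rewrite -(ler_pXn2r (_ : 0 < 2)%N) ?nnegrE ?mulr_ge0 ?l2n_ge0 ?sqrtr_ge0//.
by rewrite exprMn (sqr_sqrtr C0) !l2n_sqr.
Qed.

Lemma cutoff_bound u : (forall i, smooth_on (disc a) (u i)) ->
  (forall i x, disc a x -> hodge_laplacian1 a u i x = 0) ->
  (forall i, sqint leb2 (zext1 a u i)) ->
  exists K : R, forall n, ip leb2 (kdiv a (cutoff a u n)) (kdiv a (cutoff a u n)) +
    ip leb2 (kcurl a (cutoff a u n)) (kcurl a (cutoff a u n)) <= n.+1%:R^-1 * K.
Proof.
move=> su Hu Iu; have [C C0 HC] := chi_gradient a.
exists (2 * C * ip1 (zext1 a u) (zext1 a u)) => n; rewrite (cutoff_energy n su Hu).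
have m0 : 0 <= n.+1%:R^-1 :> R by rewrite invr_ge0.
have m1 : n.+1%:R^-1 <= 1 :> R by rewrite invf_le1// ler1n.
have B i j : ip leb2 (fun x => kap a x * pd i (chi a n) x * zext1 a u j x)
    (fun x => kap a x * pd i (chi a n) x * zext1 a u j x) <=
    (n.+1%:R^-1 * C) * ip leb2 (zext1 a u j) (zext1 a u j).
  apply: (ip_mul_le _ _ _ (Iu j)).
  - exact: test_measurable (test_kap (test_pd i (test_chi a n))).
  - exact: mulr_ge0.
  (* The gradient bound has (n + 1)^-2; it is weakened to (n + 1)^-1, which still tends to 0. *)
  - move=> x; apply: le_trans (HC n i x) _; rewrite mulrC.
    by apply: ler_wpM2r C0 _ _ _; rewrite expr2 ler_piMl.
have G (m p0 p1 q0 q1 z0 z1 : R) : p0 <= m * C * z0 -> p1 <= m * C * z1 ->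
  q0 <= m * C * z0 -> q1 <= m * C * z1 -> (p0 + p1) + (q0 + q1) <= m * (2 * C * (z0 + z1)).
  by move=> *; lra.
exact: G (B 0 0) (B 0 1) (B 1 0) (B 1 1).
Qed.

(** One sequence serves two purposes: it shows that u belongs to H^1, and its vanishing limits of
    curl and divergence make u weakly closed and coclosed. *)
Lemma harmonic_cutoff u : L2_harmonic1 a u -> (forall i, sqint leb2 (zext1 a u i)) /\
  exists w : nat -> form, [/\ forall n, test1 a (w n),
    forall i, l2cvg (fun n => w n i) (zext1 a u i),
    l2cvg (fun n => kdiv a (w n)) 0 & l2cvg (fun n => kcurl a (w n)) 0].
Proof.
move=> [/L2P Iu [gam [sgam Hgam ugam]]].
have su i : smooth_on (disc a) (gam i) by apply/smoothE; exact: sgam.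
have zE i : {ae leb2, forall x, zext1 a gam i x = zext1 a u i x}.
  apply: ae_imp (ugam i) => x ux; rewrite /zext1; have [Dx|Dx] := pselect (disc a x).
    by rewrite !zextE// ux.
  by rewrite !zext_out.
have Ig i : sqint leb2 (zext1 a gam i).
  exact: sqint_ae (measurable_zext_smo (su i)) (Iu i) (zE i).
have tw n := test1_cutoff n su.
split=> //; exists (cutoff a gam); split=> // [i||].
- apply: (l2cvg_ae (fun n => test1_sqint i (tw n)) (Ig i) (Iu i) (zE i)).
  have := chi_l2cvg (Ig i); rewrite (_ : (fun n x => _) = fun n => cutoff a gam n i)//.
  apply/funext => n; apply/funext => x; rewrite /cutoff.
  have [Dx|Dx] := pselect (disc a x); first by rewrite zextE.
  by rewrite (test_out (test_chi a n) Dx) !mul0r.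
all: have [K HK] := cutoff_bound su Hgam Ig; apply: l2cvg_ip0.
all: apply: (@squeeze_cvgr _ _ _ _ (cst 0) (fun n => n.+1%:R^-1 * K));
  [|exact: cvg_cst|exact: scale_cvg0].
all: apply: nearW => n; rewrite subr0 ip_ge0/=; apply: le_trans (HK n).
  by rewrite lerDl ip_ge0.
by rewrite lerDr ip_ge0.
Qed.

Lemma hcauchy_l2 (w_ : nat -> form) w : (forall n, test1 a (w_ n)) ->
  (forall i, sqint leb2 (w i)) -> (forall i, l2cvg (fun n => w_ n i) (w i)) ->
  l2cvg (fun n => kdiv a (w_ n)) 0 -> l2cvg (fun n => kcurl a (w_ n)) 0 -> hcauchy a w_.
Proof.
move=> tw Iw cw cd cc e e0.
pose c := 1 + a ^+ 2; have c1 : 1 <= c by rewrite lerDl sqr_ge0.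
(* If all distances to the limits are below d, each of the four squared differences is at most 4
   d^2, and the form is at most 8 (c + 1) d^2 < 16 (c + 1)^2 d^2 = e^2. *)
pose d := e / (4 * (c + 1)); have c2 : 0 < 4 * (c + 1) by lra.
have d0 : 0 < d by rewrite divr_gt0.
have near_ (f_ : nat -> R * R -> R) f : l2cvg f_ f ->
    exists N, forall n, (N <= n)%N -> l2n (f_ n - f) < d.
  move=> /cvgr0Pnorm_lt/(_ d d0)[N _ HN]; exists N => n Nn.
  by apply: le_lt_trans (HN n Nn); exact: ler_norm.
have [N0 H0] := near_ _ _ (cw 0); have [N1 H1] := near_ _ _ (cw 1).
have [N2 H2] := near_ _ _ cd; have [N3 H3] := near_ _ _ cc.
exists (maxn (maxn N0 N1) (maxn N2 N3)) => m n; rewrite !geq_max.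
move=> /andP[/andP[m0 m1] /andP[m2 m3]] /andP[/andP[n0 n1] /andP[n2 n3]].
have tri (f_ : nat -> R * R -> R) f : (forall n, sqint leb2 (f_ n)) -> sqint leb2 f ->
    l2n (f_ m - f) < d -> l2n (f_ n - f) < d ->
    ip leb2 (f_ m - f_ n) (f_ m - f_ n) <= 4 * d ^+ 2.
  move=> If_ If hm hn; rewrite -l2n_sqr.
  have le : l2n (f_ m - f_ n) <= 2 * d.
    apply: le_trans (l2n_dist (If_ m) If (If_ n)) _; rewrite [X in _ + X]l2n_distC.
    by move: hm hn; lra.
  apply: (@le_trans _ _ ((2 * d) ^+ 2)); last by rewrite exprMn -natrX.
  rewrite ler_pXn2r ?nnegrE//; first exact: l2n_ge0.
  by apply: mulr_ge0 (ltW d0).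
have Ik n' := test_sqint (test_kdiv (tw n')); have Ic n' := test_sqint (test_kcurl (tw n')).
have t0 := tri _ _ (fun n => test1_sqint 0 (tw n)) (Iw 0) (H0 m m0) (H0 n n0).
have t1 := tri _ _ (fun n => test1_sqint 1 (tw n)) (Iw 1) (H1 m m1) (H1 n n1).
have t2 := tri _ _ Ik (sqint0 leb2) (H2 m m2) (H2 n n2).
have t3 := tri _ _ Ic (sqint0 leb2) (H3 m m3) (H3 n n3).
rewrite -kcurlB// in t3.
have kdivB : kdiv a (w_ m - w_ n) = kdiv a (w_ m) - kdiv a (w_ n).
  by have := kdivDZ (-1) (tw n) (tw m); rewrite !scaleN1r addrC [X in _ = X]addrC.
rewrite -kdivB in t2.
rewrite /snorm -(ltr_pXn2r (_ : 0 < 2)%N) ?nnegrE ?sqrtr_ge0 ?ltW//.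
rewrite sqr_sqrtr; last exact: hform_ge0 (test1_sub (tw m) (tw n)).
rewrite /hform /ip1 -/c.
have -> : e ^+ 2 = 16 * (c + 1) ^+ 2 * d ^+ 2.
  by rewrite /d; field; apply: lt0r_neq0; lra.
have d2 : 0 < d ^+ 2 by rewrite exprn_gt0.
have G (A B C D s : R) : A <= 4 * s -> B <= 4 * s -> C <= 4 * s -> D <= 4 * s -> 0 < s ->
  c * (A + B) + (C + D) < 16 * (c + 1) ^+ 2 * s.
  by move=> hA hB hC hD s0; nra.
exact: G t0 t1 t3 t2 d2.
Qed.

Lemma l2cvg0_ip (f_ : nat -> R * R -> R) h : (forall n, sqint leb2 (f_ n)) ->
  sqint leb2 h -> l2cvg f_ 0 -> (fun n => ip leb2 (f_ n) h) @ \oo --> (0 : R).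
Proof.
move=> If_ Ih cf; rewrite -(ip0 h).
exact: (l2cvg_ip If_ (sqint0 leb2) (fun=> Ih) Ih cf (l2cvg_cst h)).
Qed.

(** An L^2 harmonic form on a complete manifold is closed and coclosed; here both facts come in weak
    form, by passing to the limit in the cut-off forms. *)
Lemma harmonic_weak u : L2_harmonic1 a u ->
  (forall f, test a f -> ip1 (zext1 a u) (grad f) = 0) /\
  (forall f, test a f -> ip1 (zext1 a u) (rot_grad f) = 0).
Proof.
move=> /harmonic_cutoff[Iu [w [tw cw cd cc]]].
have Iw n i := test1_sqint i (tw n).
split=> f tf; have Iv := test_sqint (test_kapV tf).
  have L1 := ip1_lim Iw Iu (fun i => test_sqint (test_pd i tf)) cw.
  have L2 : (fun n => ip1 (w n) (grad f)) @ \oo --> (0 : R).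
    under eq_fun => n do rewrite (ip1_grad (tw n) tf).
    rewrite -oppr0; apply: cvgN.
    exact: l2cvg0_ip (fun n => test_sqint (test_kdiv (tw n))) Iv cd.
  exact: (cvg_unique (@norm_hausdorff _ _) L1 L2).
have L1 := ip1_lim Iw Iu (fun i => test_sqint (test_rot_grad tf i)) cw.
have L2 : (fun n => ip1 (w n) (rot_grad f)) @ \oo --> (0 : R).
  under eq_fun => n do rewrite (ip1_rot_grad (tw n) tf).
  exact: l2cvg0_ip (fun n => test_sqint (test_kcurl (tw n))) Iv cc.
exact: (cvg_unique (@norm_hausdorff _ _) L1 L2).
Qed.

Lemma harmonic_Vtilde u : L2_harmonic1 a u -> Vtilde a u.
Proof.
move=> Hu; have [Iu [w [tw cw cd cc]]] := harmonic_cutoff Hu; split.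
  by apply/H1P; split=> //; exists w; split=> //; exact: hcauchy_l2 tw Iu cw cd cc.
by apply/(weak_codiff1P Iu) => f tf; exact: (harmonic_weak Hu).1.
Qed.

Lemma potential_Vtilde u : potential_closure a u -> Vtilde a u.
Proof.
move=> [Iu [w [Pw Cw Lw]]]; have tw n := potential_test1 (Pw n); split.
  by apply/H1P; split=> //; exists w.
apply/(weak_codiff1P Iu) => f tf.
have L1 := ip1_lim (fun n i => test1_sqint i (tw n)) Iu (fun i => test_sqint (test_pd i tf)) Lw.
have L2 : (fun n => ip1 (w n) (grad f)) @ \oo --> (0 : R).
  by under eq_fun => n do rewrite (ip1_potential_grad (Pw n) tf); exact: cvg_cst.
exact: (cvg_unique (@norm_hausdorff _ _) L1 L2).
Qed.

Lemma zext1_add u v i : zext1 a (add1 u v) i = zext1 a u i + zext1 a v i.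
Proof.
apply/funext => x; have [Dx|Dx] := pselect (disc a x).
  by rewrite -[RHS]/(zext1 a u i x + zext1 a v i x) /zext1 !zextE.
by rewrite -[RHS]/(zext1 a u i x + zext1 a v i x) /zext1 !zext_out// addr0.
Qed.

Lemma hcauchyD (s t : nat -> form) : (forall n, test1 a (s n)) -> (forall n, test1 a (t n)) ->
  hcauchy a s -> hcauchy a t -> hcauchy a (fun n => s n + t n).
Proof.
move=> ts tt cs ct e e0; have e2 : 0 < e / 2 by rewrite divr_gt0.
have [N HN] := cs _ e2; have [M HM] := ct _ e2.
exists (maxn N M) => m n; rewrite !geq_max => /andP[mN mM] /andP[nN nM].
have hC v w (_ : test1 a v) (_ : test1 a w) : hform a v w = hform a w v := hformC a v w.
have -> : s m + t m - (s n + t n) = (s m - s n) + (t m - t n) by rewrite opprD addrACA.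
have := snormD (@test1_DZ _ a) hC (@hformDZ _ a) (@hform_ge0 _ a)
  (test1_sub (ts m) (ts n)) (test1_sub (tt m) (tt n)).
move=> /le_lt_trans; apply; rewrite [ltRHS]splitr.
by apply: ltrD; [exact: HN|exact: HM].
Qed.

Lemma Vtilde_add u v : Vtilde a u -> Vtilde a v -> Vtilde a (add1 u v).
Proof.
move=> [/H1P[Iu [s [ts Cs Ls]]] /(weak_codiff1P Iu) du].
move=> [/H1P[Iv [t [tt Ct Lt]]] /(weak_codiff1P Iv) dv].
have Iuv i : sqint leb2 (zext1 a (add1 u v) i) by rewrite zext1_add; exact: sqintD.
split.
  apply/H1P; split=> //; exists (fun n => s n + t n); split.
  - by move=> n i; exact: testD (ts n i) (tt n i).
  - exact: hcauchyD.
  - move=> i; rewrite zext1_add.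
    exact: (l2cvgD (fun n => test1_sqint i (ts n)) (Iu i) (fun n => test1_sqint i (tt n)) (Iv i)).
apply/(weak_codiff1P Iuv) => f tf; rewrite !zext1_add.
have If i := test_sqint (test_pd i tf).
rewrite (ipD (Iu 0) (Iv 0) (If 0)) (ipD (Iu 1) (Iv 1) (If 1)).
have G (p q p' q' : R) : p + q = 0 -> p' + q' = 0 -> p + p' + (q + q') = 0.
  by move=> H1 H2; rewrite addrACA H1 H2 addr0.
exact: G (du f tf) (dv f tf).
Qed.

(** As a harmonic form, u is L^2-orthogonal to every rotated gradient of a test function; as a limit
    of such gradients, it is then orthogonal to itself. *)
Lemma closure_harmonic_ae0 u : potential_closure a u -> L2_harmonic1 a u ->
  ae_eq1 a u (fun _ _ => 0).
Proof.
move=> [Iu [w [Pw Cw Lw]]] Hu; have tw n := potential_test1 (Pw n).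
have L1 := ip1_lim (fun n i => test1_sqint i (tw n)) Iu Iu Lw.
have L2 : (fun n => ip1 (w n) (zext1 a u)) @ \oo --> (0 : R).
  under eq_fun => n do rewrite /ip1 (ipC leb2 (w n 0)) (ipC leb2 (w n 1)).
  rewrite (_ : (fun n => _) = cst 0); first exact: cvg_cst.
  by apply/funext => n; have [f tf <-] := Pw n; exact: (harmonic_weak Hu).2.
have E := cvg_unique (@norm_hausdorff _ _) L1 L2.
have z0 i : ip leb2 (zext1 a u i) (zext1 a u i) = 0.
  apply/eqP; rewrite eq_le ip_ge0 andbT.
  by apply: le_trans (ip1_sq_comp (zext1 a u) i) _; rewrite E.
move=> i; apply: ae_imp (ip_eq0_ae (Iu i) (z0 i)) => x + Dx.
by rewrite /zext1 zextE.
Qed.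

Theorem Vtilde_direct_sum : is_direct_sum a (Vtilde a) (potential_closure a) (L2_harmonic1 a).
Proof.
split; last exact: closure_harmonic_ae0.
apply/seteqP; split=> [u /vtilde_decomposition[gam Hgam Pu]|_ [u Pu [v Hv <-]]].
  exists (sub1 u gam) => //; exists gam => //.
  by apply/funext => i; apply/funext => x; rewrite /add1 /sub1 subrK.
by apply: Vtilde_add; [exact: potential_Vtilde|exact: harmonic_Vtilde].
Qed.

End DirectSum.

Theorem theorem1p4 (R : realType) (a : R) (ha : 0 <= a) :
  is_direct_sum a (Vtilde a) (H1_closure a (Lambda1csigma a))
    (L2_harmonic1 a) /\
  is_direct_sum a (Vtilde a) (H1_closure a (codiff_Lambda2c a))
    (L2_harmonic1 a).
Proof.
have -> : H1_closure a (Lambda1csigma a) = potential_closure a.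
  by apply/seteqP; split=> u; rewrite closure_csigmaP.
have -> : H1_closure a (codiff_Lambda2c a) = potential_closure a.
  by apply/seteqP; split=> u; rewrite closure_codiffP.
by split; exact: Vtilde_direct_sum.
Qed.
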